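(* Let $p$ be a prime, $n\ge 2$, $r=(r_1,\dots,r_n)\in\mathbb{N}_0^n$, $C=(p^{r_1},\dots,p^{r_n})$, and let $\psi,\psi'$ be the characters of $U(\mathbb{Q}_p)/U(\mathbb{Z}_p)$ attached to integers $\psi_1,\dots,\psi_n$ and $\psi'_1,\dots,\psi'_n$. Whenever the Kloosterman sum $\mathrm{Kl}_p(\psi,\psi',C^{\ast}w_{\ast})$ is well-defined, one has $$\mathrm{Kl}_p(\psi,\psi',C^{\ast}w_{\ast})=\sum_{\underline m\in\mathcal{M}_{w_{\ast}}(r)}\mathrm{Kl}_p(\underline m,\psi,\psi',w_{\ast}).$$ Here, with the index set $I=\{(i,j):1\le i\le j\le n,\ i=1\text{ or }j=n\}$ (which has $2n-1$ elements), $$\mathcal{M}_{w_{\ast}}(r)=\Big\{\underline m=(m_{ij})_{(i,j)\in I}\in\mathbb{N}_0^{2n-1}\ :\ \sum_{(i,j)\in I,\ i\le k\le j}m_{ij}=r_k\ \text{ for each }1\le k\le n\Big\},$$ $\mathcal{C}_{w_{\ast}}(\underline m)$ is the set of all $\underline c=(c_{ij})_{(i,j)\in I}$ with $c_{1j}\in\mathbb{Z}/\big(\prod_{k=j}^np^{m_{1k}}\big)\mathbb{Z}$ for $1\le j\le n$, $c_{in}\in\mathbb{Z}/\big(\prod_{k=2}^ip^{m_{kn}}\big)\mathbb{Z}$ for $2\le i\le n$, and $(c_{ij},p^{m_{ij}})=1$ for all $(i,j)\in I$, and $$\mathrm{Kl}_p(\underline m,\psi,\psi',w_{\ast})=\sum_{\underline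 c\in\mathcal{C}_{w_{\ast}}(\underline m)}e\Bigg(\psi_1\frac{\overline{c_{11}}}{p^{m_{11}}}+\sum_{j=2}^n\psi_j\Big(\frac{c_{1(j-1)}\overline{c_{1j}}}{p^{m_{1j}}}+\frac{c_{(j+1)n}\overline{c_{jn}}}{p^{-m_{1(j-1)}+m_{1j}+m_{jn}}}\Big)$$ $$\qquad+\psi'_1\frac{c_{2n}}{p^{m_{2n}}}+\psi'_n\Big(\frac{c_{1n}\overline{c_{nn}}}{p^{m_{1n}}}+\frac{c_{1(n-1)}}{p^{-m_{nn}+m_{1(n-1)}+m_{1n}}}\Big)\Bigg),$$ with the conventions: $c_{ij}=1$ and $m_{ij}=0$ whenever $i>j$; for $(i,j)\in I$, $\overline{c_{ij}}=0$ if $m_{ij}=0$, and otherwise $\overline{c_{ij}}$ is the inverse of $c_{ij}$.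
   Context: Let $G=\mathrm{GL}(n+1)$, $T$ the diagonal torus, $U$ the group of upper triangular unipotent matrices, $U^\top$ the lower triangular unipotent matrices. For $u\in U$ and $1\le i\le j\le n$, $u_{ij}$ denotes the entry of $u$ in row $i$ and column $j+1$, so $u_{jj}$ is the $j$-th superdiagonal entry. $e$ denotes the standard additive character of $\mathbb{Q}_p/\mathbb{Z}_p$ (so $e(x)=\exp(2\pi i x)$ for $x\in\mathbb{Z}[1/p]$). For integers $\psi_j,\psi_j'$ put $\psi(u)=e(\sum_{j=1}^n\psi_ju_{jj})$ and $\psi'(u)=e(\sum_{j=1}^n\psi'_ju_{jj})$. Kloosterman sums: for a signed permutation matrix $w$ put $U_w=U\cap w^{-1}U^\top w$ and $\bar U_w=U\cap w^{-1}Uw$. For $N=tw$ with $t\in T(\mathbb{Q}_p)$ put $C(N)=U(\mathbb{Q}_p)NU(\mathbb{Q}_p)\cap G(\mathbb{Z}_p)$ and $X(N)=U(\mathbb{Z}_p)\backslash C(N)/U_w(\mathbb{Z}_p)$. Each $x\in C(N)$ is uniquely $x=u(x)Nu'(x)$ with $u(x)\in U(\mathbb{Q}_p)$, $u'(x)\in U_w(\mathbb{Q}_p)$; this induces maps $u:X(N)\to U(\mathbb{Z}_p)\backslash U(\mathbb{Q}_p)$ and $u':X(N)\to U_w(\mathbb{Q}_p)/U_w(\mathbb{Z}_p)$, and $$\mathrm{Kl}_p(\psi,\psi',N)=\sum_{x\in X(N)}\psi(u(x))\,\psi'(u'(x)).$$ The Kloosterman sum is called well-defined if $\psi(NvN^{-1})=\psi'(v)$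 for all $v\in\bar U_w(\mathbb{Q}_p)$. $w_{\ast}$ is the $(n+1)\times(n+1)$ matrix $\begin{pmatrix}&&(-1)^n\\&-I_{n-1}&\\1&&\end{pmatrix}$. $C^{\ast}=\mathrm{diag}(p^{-r_1},p^{r_1-r_2},\dots,p^{r_{n-1}-r_n},p^{r_n})$. In the partial sum, for each $(i,j)\in I$ one fixes a system of integer representatives of the residue classes for $c_{ij}$; when $m_{ij}\ge1$, $c_{ij}$ is prime to $p$ and $\overline{c_{ij}}$ may be taken to be its inverse in $\mathbb{Z}_p$. *)

(* Defs.v *)
From HB Require Import structures.
From mathcomp Require Import all_boot all_order all_algebra.
From mathcomp Require Import fraction complex.
From mathcomp Require Import boolp classical_sets cardinality fsbigop.
From mathcomp Require Import reals trigo.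

Set Implicit Arguments.
Unset Strict Implicit.
Unset Printing Implicit Defensive.

Import Order.TTheory GRing.Theory Num.Theory.
Local Open Scope classical_set_scope.
Local Open Scope ring_scope.

Fact modz_dvdm (a m d : int) : (d %| m)%Z -> ((a %% m)%Z = a %[mod d])%Z.
Proof.
move=> dm; apply/eqP; rewrite eqz_mod_dvd {2}(divz_eq a m) opprD addrCA subrr.
by rewrite addr0 rpredN dvdz_mull.
Qed.

(* The p-adic integers are the inverse limit of the rings Z/p^k: an element is
   the compatible sequence of its residues, the k-th one taken in [0, p^k).   *)
Record padic_int (p : nat) (hp : prime p) := PadicInt {
  padic_res :> nat -> int;
  padic_resP : forall k, padic_res k = (padic_res k.+1 %% (p ^ k)%N%:Z)%Z }.

Section PadicIntegers.
Variables (p : nat) (hp : prime p).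

Local Notation padic_int := (padic_int hp).
Local Notation P k := ((p ^ k)%N%:Z).

HB.instance Definition _ := gen_eqMixin padic_int.
HB.instance Definition _ := gen_choiceMixin padic_int.

Lemma padic_int_eq (x y : padic_int) : (forall k, x k = y k) -> x = y.
Proof.
case: x y => [x hx] [y hy] /= /funext exy; subst y.
by congr PadicInt; exact: Prop_irrelevance.
Qed.

Lemma padic_res_mod (x : padic_int) k : (x k %% P k)%Z = x k.
Proof. by rewrite (padic_resP x k) modz_mod. Qed.

Fact padic_modS (a : int) k : ((a %% P k.+1)%Z %% P k)%Z = (a %% P k)%Z.
Proof. by rewrite modz_dvdm // expnS PoszM dvdz_mull. Qed.

(* Reduction of a sequence of integers which is compatible modulo the p^k. *)
Definition padic_lim (x : nat -> int)
  (hx : forall k, (x k.+1 %% P k)%Z = (x k %% P k)%Z) : padic_int.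
Proof.
exists (fun k => (x k %% P k)%Z) => k.
abstract by rewrite padic_modS hx.
Defined.

Fact padic_resS (x : padic_int) k : (x k.+1 %% P k)%Z = (x k %% P k)%Z.
Proof. by rewrite -padic_resP padic_res_mod. Qed.

Fact padic_add_subproof (x y : padic_int) k :
  ((x k.+1 + y k.+1) %% P k)%Z = ((x k + y k) %% P k)%Z.
Proof. by rewrite -modzDm !padic_resS modzDm. Qed.
Definition padic_add x y := padic_lim (padic_add_subproof x y).

Fact padic_opp_subproof (x : padic_int) k :
  ((- x k.+1) %% P k)%Z = ((- x k) %% P k)%Z.
Proof. by rewrite -modzNm padic_resS modzNm. Qed.
Definition padic_opp x := padic_lim (padic_opp_subproof x).

Fact padic_mul_subproof (x y : padic_int) k :
  ((x k.+1 * y k.+1) %% P k)%Z = ((x k * y k) %% P k)%Z.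
Proof. by rewrite -modzMm !padic_resS modzMm. Qed.
Definition padic_mul x y := padic_lim (padic_mul_subproof x y).

Definition padic_of_int (a : int) : padic_int :=
  @padic_lim (fun=> a) (fun=> erefl).

Fact padic_addA : associative padic_add.
Proof. by move=> x y z; apply: padic_int_eq => k /=; rewrite modzDmr modzDml addrA. Qed.
Fact padic_addC : commutative padic_add.
Proof. by move=> x y; apply: padic_int_eq => k /=; rewrite addrC. Qed.
Fact padic_add0 : left_id (padic_of_int 0) padic_add.
Proof. by move=> x; apply: padic_int_eq => k /=; rewrite modzDml add0r padic_res_mod. Qed.
Fact padic_addN : left_inverse (padic_of_int 0) padic_opp padic_add.
Proof. by move=> x; apply: padic_int_eq => k /=; rewrite modzDml addNr. Qed.

HB.instance Definition _ := GRing.isZmodule.Build padic_int padic_addA padic_addC padic_add0 padic_addN.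

Fact padic_mulA : associative padic_mul.
Proof. by move=> x y z; apply: padic_int_eq => k /=; rewrite modzMmr modzMml mulrA. Qed.
Fact padic_mulC : commutative padic_mul.
Proof. by move=> x y; apply: padic_int_eq => k /=; rewrite mulrC. Qed.
Fact padic_mul1 : left_id (padic_of_int 1) padic_mul.
Proof. by move=> x; apply: padic_int_eq => k /=; rewrite modzMml mul1r padic_res_mod. Qed.
Fact padic_mulD : left_distributive padic_mul padic_add.
Proof.
move=> x y z; apply: padic_int_eq => k /=.
by rewrite modzMml modzDm mulrDl.
Qed.
Fact padic_oner_neq0 : padic_of_int 1 != padic_of_int 0.
Proof.
apply/eqP => /(congr1 (fun x : padic_int => x 1%N)) /=.
by rewrite expn1 mod0z modz_small // ltz_nat prime_gt1.
Qed.

HB.instance Definition _ :=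
  GRing.Zmodule_isComNzRing.Build padic_int padic_mulA padic_mulC padic_mul1 padic_mulD padic_oner_neq0.

Definition padic_unit : pred padic_int := fun x => `[< exists y, y * x = 1 >].
Definition padic_inv (x : padic_int) : padic_int :=
  if padic_unit x then xget x [set y | y * x = 1] else x.

Fact padic_mulVx : {in padic_unit, left_inverse 1 padic_inv *%R}.
Proof.
move=> x Ux; rewrite /padic_inv (Ux : padic_unit x).
by move/asboolP: Ux => /(xgetPex x).
Qed.
Fact padic_unitPl x y : y * x = 1 -> padic_unit x.
Proof. by move=> yx; apply/asboolP; exists y. Qed.
Fact padic_invr_out : {in [predC padic_unit], padic_inv =1 id}.
Proof. by move=> x /negbTE Ux; rewrite /padic_inv (Ux : padic_unit x = false). Qed.

HB.instance Definition _ :=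
  GRing.ComNzRing_hasMulInverse.Build padic_int padic_mulVx padic_unitPl padic_invr_out.

Lemma padic_res_le (x : padic_int) a b : (x (a + b)%N %% P a)%Z = x a.
Proof.
elim: b => [|b IH]; first by rewrite addn0 padic_res_mod.
rewrite addnS -IH (padic_resP x (a + b)) modz_dvdm //.
by rewrite expnD PoszM dvdz_mulr.
Qed.

Lemma padic_neq0 (x : padic_int) :
  x != 0 -> exists k, forall b, ~~ (P k %| x (k + b)%N)%Z.
Proof.
move=> x0; apply: contrapT => /forallNP h; case/eqP: x0.
apply: padic_int_eq => k /=; rewrite mod0z.
have /existsNP[b /negP/negPn] := h k.
by move/dvdz_mod0P; rewrite padic_res_le.
Qed.

Fact padic_idom (x y : padic_int) : x * y = 0 -> (x == 0) || (y == 0).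
Proof.
move=> xy0; apply/negPn/negP; rewrite negb_or => /andP[/padic_neq0[a xa]].
move=> /padic_neq0[b yb].
have := congr1 (fun x : padic_int => x (a + b)%N) xy0; rewrite /= mod0z.
move/dvdz_mod0P; rewrite dvdzE abszM => hd.
move: (xa b) (yb a); rewrite [(b + a)%N]addnC !dvdzE.
move: (`|x (a + b)%N|)%N (`|y (a + b)%N|)%N hd => u v hd hu hv.
have u0 : (0 < u)%N by case: u {hd} hu => //; rewrite dvdn0.
have v0 : (0 < v)%N by case: v {hd} hv => //; rewrite dvdn0.
move: hd hv hu => /=; rewrite !pfactor_dvdn ?muln_gt0 ?u0 // lognM // -!ltnNge.
move=> h1 h2 h3; move: h1.
by rewrite leqNgt -addSn (leq_add h3 (ltnW h2)).
Qed.

HB.instance Definition _ := GRing.ComUnitRing_isIntegral.Build padic_int padic_idom.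

End PadicIntegers.


Notation padic hp := {fraction (padic_int hp)}.

Section Kloosterman.
Variables (R : realType) (p : nat) (hp : prime p).
Local Notation Zp := (padic_int hp).
Local Notation Qp := (padic hp).

(* e(x) = exp(2 pi i a / p^k) for any element a / p^k of Z[1/p] which is
   congruent to x modulo Z_p; the value does not depend on its choice.        *)
Definition padic_char (x : Qp) : R[i] :=
  let ak := xget (0, 0%N) [set ak : int * nat |
    exists z : Zp, x = ak.1%:~R / p%:R ^+ ak.2 + tofrac z] in
  let theta : R := 2 * pi * (ak.1%:~R / p%:R ^+ ak.2) in
  Complex (cos theta) (sin theta).

Section Sums.
Variable n : nat.
Local Notation mat := 'M[Qp]_n.+1.

(* G(Z_p), as a subset of G(Q_p); for a subgroup H of G(Q_p), H(Z_p) is the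
   intersection of H with it.                                                 *)
Definition GLZp : set mat :=
  [set A | exists2 B : 'M[Zp]_n.+1, B \in unitmx & A = map_mx (@tofrac Zp) B].

Definition upper_unip : set mat :=
  [set A | forall i j : 'I_n.+1, (j <= i)%N -> A i j = (i == j)%:R].

Definition lower_unip : set mat := [set A | upper_unip A^T].

Definition U_ (w : mat) : set mat :=
  upper_unip `&` [set invmx w *m v *m w | v in lower_unip].

Definition Ubar_ (w : mat) : set mat :=
  upper_unip `&` [set invmx w *m v *m w | v in upper_unip].

(* The integer psi_j is entry j - 1 of the tuple psi, and u_jj, which lies on
   the superdiagonal, is the coefficient of u at (j - 1, j) counting from 0.   *)
Definition unip_char (psi : n.-tuple int) (u : mat) : R[i] :=
  padic_char (\sum_(j < n) (tnth psi j)%:~R *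
                u (widen_ord (leqnSn n) j) (lift ord0 j)).

(* N = t w with t in T(Q_p) and w a signed permutation matrix. *)
Section KloostermanSum.
Variables t w : mat.
Local Notation N := (t *m w).

Definition kl_set : set mat :=
  [set x | exists u v, [/\ upper_unip u, upper_unip v & x = u *m N *m v]] `&` GLZp.

Definition kl_coset (x : mat) : set mat :=
  [set y | exists a b, [/\ (upper_unip `&` GLZp) a, (U_ w `&` GLZp) b &
                          y = a *m x *m b]].

(* X(N), whose elements are the double cosets U(Z_p) x U_w(Z_p), x in C(N). *)
Definition kl_quotient : set (set mat) := [set kl_coset x | x in kl_set].

(* The pair (u(x), u'(x)), which is unique for x in C(N). *)
Definition bruhat (x : mat) : mat * mat :=
  xget (1%:M, 1%:M) [set uv : mat * mat |
    [/\ upper_unip uv.1, U_ w uv.2 & x = uv.1 *m N *m uv.2]].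

(* The classes of u(x) and u'(x), hence the summand, depend only on the double
   coset D of x, so that they may be computed at any x in D.  The set X(N) is
   finite, so that the sum is a genuine one.                                  *)
Definition kloosterman (psi psi' : n.-tuple int) : R[i] :=
  \sum_(D \in kl_quotient)
    (let x := xget 1%:M D in
     unip_char psi (bruhat x).1 * unip_char psi' (bruhat x).2).

Definition kl_well_defined (psi psi' : n.-tuple int) : Prop :=
  forall v, Ubar_ w v -> unip_char psi (N *m v *m invmx N) = unip_char psi' v.

End KloostermanSum.

Definition w_star : mat :=
  \matrix_(i, j)
    if (i == ord0) && (j == ord_max) then (-1) ^+ n
    else if (i == ord_max) && (j == ord0) then 1
    else if [&& i == j, i != ord0 & i != ord_max] then -1
    else 0.

(* Entry k of a sequence indexed from 1, with value 0 at k = 0 and beyond its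
   length; thus r_0 = r_(n+1) = 0 below.                                      *)
Definition at1 (V : nmodType) (s : seq V) (k : nat) : V := nth 0 (0 :: s) k.

Definition C_star (r : n.-tuple nat) : mat :=
  diag_mx (\row_(i < n.+1) (p%:R : Qp) ^ ((at1 r i)%:Z - (at1 r i.+1)%:Z)).

(* The index set I; its elements are the pairs (i, j) counted from 1, which is
   why they live in 'I_n.+1.                                                  *)
Definition idx : finType :=
  {ij : 'I_n.+1 * 'I_n.+1 |
    [&& 0 < ij.1, ij.1 <= ij.2 & (ij.1 == 1 :> nat) || (ij.2 == n :> nat)]%N}.

Definition row_of (ij : idx) : nat := (val ij).1.
Definition col_of (ij : idx) : nat := (val ij).2.

(* The entry at (i, j) of a family indexed by I, with value d outside I. *)
Definition entry (T : Type) (d : T) (f : idx -> T) (i j : nat) : T :=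
  if [pick ij : idx | (row_of ij == i) && (col_of ij == j)] is Some ij
  then f ij else d.

Definition M_star (r : n.-tuple nat) : set {ffun idx -> nat} :=
  [set m | forall k, (1 <= k <= n)%N ->
     (\sum_(ij : idx | row_of ij <= k <= col_of ij) m ij)%N = at1 r k].

Definition modulus (m : {ffun idx -> nat}) (ij : idx) : nat :=
  let mm := entry 0%N m in
  (if row_of ij == 1 then \prod_(col_of ij <= k < n.+1) p ^ mm 1 k
   else \prod_(2 <= k < (row_of ij).+1) p ^ mm k n)%N.

(* A family c of residue classes, the one at (i, j) being an element of
   Z/(modulus m (i, j)) encoded as an ordinal.                                *)
Definition residues (m : {ffun idx -> nat}) : finType :=
  {dffun forall ij : idx, 'I_(modulus m ij)}.

Definition C_set (m : {ffun idx -> nat}) : {set residues m} :=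
  [set c : residues m | [forall ij, coprime (c ij) (p ^ m ij)]].

(* A choice of an integer in each residue class, for every (i, j) in I. *)
Definition rep_system (m : {ffun idx -> nat}) : Type :=
  forall ij : idx, 'I_(modulus m ij) -> int.

Definition is_rep_system (m : {ffun idx -> nat}) (rho : rep_system m) : Prop :=
  forall (ij : idx) (x : 'I_(modulus m ij)),
    (rho ij x = x%:Z %[mod (modulus m ij)%:Z])%Z.

(* The inverse of c_ij is the one in Z_p, computed in Q_p. *)
Definition kl_arg (m : {ffun idx -> nat}) (psi psi' : n.-tuple int)
    (x : idx -> int) : Qp :=
  let mm i j : int := (entry 0%N m i j)%:Z in
  let c i j : Qp := (entry 1 x i j)%:~R in
  let cbar i j : Qp := if mm i j == 0 then 0 else (c i j)^-1 in
  let a k : Qp := (at1 psi k)%:~R in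
  let a' k : Qp := (at1 psi' k)%:~R in
  let P (k : int) : Qp := p%:R ^ k in
  a 1%N * (cbar 1%N 1%N / P (mm 1%N 1%N))
  + \sum_(2 <= j < n.+1)
      a j * (c 1%N j.-1 * cbar 1%N j / P (mm 1%N j)
             + c j.+1 n * cbar j n / P (- mm 1%N j.-1 + mm 1%N j + mm j n))
  + a' 1%N * (c 2%N n / P (mm 2%N n))
  + a' n * (c 1%N n * cbar n n / P (mm 1%N n)
            + c 1%N n.-1 / P (- mm n n + mm 1%N n.-1 + mm 1%N n)).

Definition kl_partial (m : {ffun idx -> nat}) (rho : rep_system m)
    (psi psi' : n.-tuple int) : R[i] :=
  \sum_(c in C_set m) padic_char (kl_arg m psi psi' (fun ij => rho ij (c ij))).

End Sums.
End Kloosterman.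

(* Main.v *)
Require Import Defs.
From HB Require Import structures.
From mathcomp Require Import all_boot all_order all_algebra.
From mathcomp Require Import fraction complex.
From mathcomp Require Import boolp classical_sets cardinality fsbigop.
From mathcomp Require Import reals trigo.
From mathcomp Require Import zify ring.

(* The group U_w consists of the matrices u' which differ from 1 only in the
   first row (1, a_1, ..., a_(n-1), z) and the last column, with entries b_1, ...,
   b_(n-1) in between (indices from 0, and a_0 = 1). A double coset in X(N) is
   determined by the class of u', and u' occurs if and only if u N u' is integral
   for some unipotent u, since its determinant is 1 or -1 anyway. Put
   Z_k = z - sum_(l >= k) a_l b_l. By looking at the minors of the last rows of
   N u' one sees that the condition on u' is
     max (A_k B_k) |Z_k| = p^(r_k)  for 1 <= k <= n,
   where A_k = max_(j < k) |a_j| and B_k is the maximum of 1 and the |b_i|, i >= k.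
   Writing A_k = p^(be k) and al k = r_k - be k, the sequence be increases and al
   decreases, and the family m records their increments:
   be k = m_2n + ... + m_kn and al k = m_1k + ... + m_1n. The residues c_(k+1)n are
   the p^(be (k + 1)) a_k. Given these, (b, z) is described by triangular linear
   coordinates c_1k, equal up to a unit to p^(al k) b_k or to p^(r_k) Z_k according
   to whether m_(k+1)n vanishes, in which the action of U_w(Z_p) becomes
   translation by the product of the p^(al k) Z_p. Solving the row equations
   explicitly in these coordinates gives the superdiagonal of u. The sums agree
   term by term.                                                              *)

Set Implicit Arguments.
Unset Strict Implicit.
Unset Printing Implicit Defensive.

Import Order.TTheory GRing.Theory Num.Theory.
Local Open Scope classical_set_scope.
Local Open Scope ring_scope.

(** * Heisenberg unipotents and their row equations *)

(** For given u' the rows of u can be solved for independently. Row i asks for la, with la a_j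
    integral for j < i, such that la Z_(i+1) plus an integral combination of the b_l, l > i, is
    congruent to p^(r_i - r_(i+1)) b_i modulo Z_p. Expressing b_i by its coordinate splits this into
    a part solved exactly and c_1i, up to sign, times a Bezout relation for the tuple of p^(r_k) Z_k
    and the p^(al k) b_l, l >= k, where k = i + 1. Such a relation is written down by descending in
    k: it is inherited from k + 1 if m_1k = 0, and otherwise a single nonzero coefficient,
    essentially an inverse of c_1k, suffices. This explains the convention that the inverse of c_ij
    is 0 when m_ij = 0. In terms of sizes, p^(al k) is the maximum of B_k and |Z_k| / A_k, so that
    the monotonicity of B_k is not enough to make al decrease; what is needed is Z_(k+1) = Z_k + a_k
    b_k. The analysis of the rows only needs that Z_p is a local ring with maximal ideal generated
    by p, and is carried out for a subring O of a field K. *)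

Section HeisenbergRows.
Variables (K : fieldType) (O : subringClosed K) (p : K).
Hypotheses (p_neq0 : p != 0) (pO : p \in O) (pVO : p^-1 \notin O).
Hypothesis O_local : forall x, x \in O -> x / p \in O \/ x^-1 \in O.

Lemma expO k : p ^+ k \in O.
Proof. exact: rpredX. Qed.

Lemma exp_neq0 k : p ^+ k != 0.
Proof. exact: expf_neq0. Qed.

Lemma nonunit_neq0 x : x / p \notin O -> x != 0.
Proof. by apply: contraNneq => ->; rewrite mul0r rpred0. Qed.

Lemma unit_invO x : x \in O -> x / p \notin O -> x^-1 \in O.
Proof. by move=> xO /negP xp; case: (O_local xO). Qed.

Lemma unit_divp x : x != 0 -> x^-1 \in O -> x / p \notin O.
Proof.
move=> x0 xV; apply: contra pVO => xp.
by rewrite -[p^-1](mulKf x0) rpredM.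
Qed.

Lemma exp_divp k : (0 < k)%N -> p ^+ k / p \in O.
Proof. by case: k => // k _; rewrite exprSr mulfK // expO. Qed.

Variable n : nat.

Definition tailz (a b : nat -> K) (z : K) (k : nat) : K :=
  z - \sum_(k <= l < n) a l * b l.

Lemma tailz_ge a b z k : (n <= k)%N -> tailz a b z k = z.
Proof. by move=> nk; rewrite /tailz big_geq ?subr0. Qed.

Lemma tailzS a b z k : (k < n)%N -> tailz a b z k = tailz a b z k.+1 - a k * b k.
Proof. by move=> kn; rewrite /tailz big_ltn // opprD addrA addrAC. Qed.

Variable r : nat -> nat.

(* Row i of u N u' is integral for a suitable row i of u: here la is the entry
   of u N u' in column 0 and g l its entry in column l > i.                     *)
Definition row_sys (a b : nat -> K) z i (la : K) (g : nat -> K) : Prop :=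
  [/\ forall l, (i < l < n)%N -> g l \in O,
      forall j, (j < i)%N -> la * a j \in O,
      p ^+ r i / p ^+ r i.+1 - la * a i \in O &
      la * tailz a b z i.+1 + \sum_(i.+1 <= l < n) g l * b l
        - p ^+ r i / p ^+ r i.+1 * b i \in O].

Definition row0_sys (a b : nat -> K) z (la : K) (g : nat -> K) : Prop :=
  [/\ la \in O, forall l, (0 < l < n)%N -> g l \in O &
      la * tailz a b z 1 + \sum_(1 <= l < n) g l * b l
        + (-1) ^+ n / p ^+ r 1 \in O].

Definition rown_sys (a : nat -> K) z : Prop :=
  (forall j, (j < n)%N -> p ^+ r n * a j \in O) /\ p ^+ r n * z \in O.

Variables (be mu : nat -> nat).
Hypotheses (be0 : be 0 = 0%N) (beS : forall k, (k < n)%N -> be k.+1 = (be k + mu k)%N).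

(** Together with a_0 = 1 this says that p^(be k) is the maximum of the |a_j| with j < k; mu k > 0
    marks the indices k > 0 at which |a_k| exceeds all earlier ones. *)
Definition adapted (a : nat -> K) : Prop :=
  forall k, (k < n)%N -> p ^+ be k.+1 * a k \in O /\
     ((0 < mu k)%N -> (p ^+ be k.+1 * a k) / p \notin O).

Lemma be_le j k : (j <= k <= n)%N -> (be j <= be k)%N.
Proof.
elim: k => [|k IH]; first by case: j.
move=> jk; case: (ltngtP j k.+1) => [jk1|?|->] //; last lia.
have := IH ltac:(lia); rewrite beS; lia.
Qed.

Lemma adapted_int a j k : adapted a -> (j < k <= n)%N -> p ^+ be k * a j \in O.
Proof.
move=> ad jk; have [jO _] := ad j ltac:(lia).
have le : (be j.+1 <= be k)%N by apply: be_le; lia.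
by rewrite -(subnK le) exprD -mulrA rpredM // expO.
Qed.

(** The maximum is attained at the last j < k with mu j > 0, or at a_0 = 1 if there is none. *)
Lemma adapted_unit a k : adapted a -> a 0%N = 1 -> (0 < k <= n)%N ->
  exists2 j, (j < k)%N & (p ^+ be k * a j) / p \notin O.
Proof.
move=> ad a0; elim: k => // k IH kn.
have [m0|m0] := posnP (mu k); last first.
  by exists k => //; have [_ ->] := ad k ltac:(lia).
rewrite beS; last lia.
case: k => [|k] in IH kn m0 *.
  by exists 0%N => //; rewrite be0 m0 a0 mulr1 mul1r.
have [j jk h] := IH ltac:(lia); exists j; first lia.
by rewrite m0 addn0.
Qed.

(** * Conditions on u' forced by integrality *)

Section Backward.
Variables (a b : nat -> K) (z : K).
Hypotheses (n_gt1 : (1 < n)%N) (a0 : a 0%N = 1) (rown : rown_sys a z)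
  (rowi : forall i, (0 < i < n)%N -> exists la g, row_sys a b z i la g)
  (row0 : exists la g, row0_sys a b z la g).
Hypothesis ad : adapted a.
Local Notation Z := (tailz a b z).

(* Up to sign and to the factor c, these are the maximal minors of the last
   n - k + 1 rows of N u'. By the row equations the ideals generated by them
   increase with k; row n bounds them by Z_p and row 0 puts 1 into the first
   one, so that all of them are Z_p.                                          *)
Definition minors_in (c : K) k : Prop :=
  [/\ forall j, (j < k)%N -> p ^+ r k * a j / c \in O,
      forall j i, (j < k)%N -> (k <= i < n)%N -> p ^+ r k * a j * b i / c \in O &
      p ^+ r k * Z k / c \in O].

Lemma minors_inS c k : (0 < k < n)%N -> minors_in c k.+1 -> minors_in c k.
Proof.
move=> kn [ha hab hz]; have [la [g [gO laO h1 h2]]] := rowi kn.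
set X := p ^+ r k in h1 h2 *; set Y := p ^+ r k.+1 in h1 h2 ha hab hz *.
have Y0 : Y != 0 by exact: exp_neq0.
set k1 := X / Y - la * a k in h1.
set k2 := la * Z k.+1 + _ - _ in h2.
(* Row k, multiplied by Y, writes p^(r k) and p^(r k) b_k through the data at level k + 1.
   Substituting these two identities turns every generator at level k into an integral combination
   of generators at level k + 1. *)
have XE : X = Y * (la * a k + k1) by rewrite /k1; field.
have bE : X * b k = Y * (la * Z k.+1 + \sum_(k.+1 <= l < n) g l * b l - k2).
  by rewrite /k2; field.
have sO j : (j < k.+1)%N -> (\sum_(k.+1 <= l < n) g l * b l) * (Y * a j) / c \in O.
  move=> jk; rewrite mulr_suml mulr_suml big_nat rpred_sum // => l lk.
  have -> : g l * b l * (Y * a j) / c = g l * (Y * a j * b l / c) by ring.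
  by apply: rpredM; [exact: gO | apply: hab].
split.
- move=> j jk.
  have -> : X * a j / c = (la * a j) * (Y * a k / c) + k1 * (Y * a j / c) by rewrite XE; ring.
  by apply: rpredD; apply: rpredM => //; [exact: laO|apply: ha|apply: ha; lia].
- move=> j i jk ki; case: (eqVneq i k) => [->|ik].
    have -> : X * a j * b k / c = (la * a j) * (Y * Z k.+1 / c)
      + (\sum_(k.+1 <= l < n) g l * b l) * (Y * a j) / c - k2 * (Y * a j / c).
      by transitivity (X * b k * a j / c); [ring | rewrite bE; ring].
    rewrite rpredB // ?rpredD ?sO //; try lia.
      by apply: rpredM => //; exact: laO.
    by apply: rpredM => //; apply: ha; lia.
  have -> : X * a j * b i / c = (la * a j) * (Y * a k * b i / c) + k1 * (Y * a j * b i / c).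
    by rewrite XE; ring.
  by apply: rpredD; apply: rpredM => //; [exact: laO|apply: hab; lia|apply: hab; lia].
- have -> : X * Z k / c = k1 * (Y * Z k.+1 / c)
      - (\sum_(k.+1 <= l < n) g l * b l) * (Y * a k) / c + k2 * (Y * a k / c).
    rewrite tailzS; last lia.
    transitivity ((X * Z k.+1 - a k * (X * b k)) / c); first by ring.
    by rewrite bE XE; ring.
  rewrite rpredD ?rpredB ?sO //; first by apply: rpredM.
  by apply: rpredM => //; apply: ha; lia.
Qed.

Lemma minors_in_all c k : (0 < k <= n)%N -> minors_in c n -> minors_in c k.
Proof.
move=> kn; move: {2}(n - k)%N (erefl (n - k)%N) => d; elim: d k kn => [|d IH] k kn dE mn.
  by have -> : k = n by lia.
by apply: minors_inS; [lia|apply: IH => //; lia].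
Qed.

Lemma minors_int k : (0 < k <= n)%N -> minors_in 1 k.
Proof.
move=> kn; apply: minors_in_all => //; case: rown => h1 h2; split.
- by move=> j jn; rewrite divr1 h1.
- by move=> j i jn; lia.
- by rewrite divr1 tailz_ge.
Qed.

Lemma minors_prim k : (0 < k <= n)%N -> ~ minors_in p k.
Proof.
move=> kn mk; have : minors_in p 1.
  move: mk; elim: k kn => // k IH kn mk.
  by case: k => // k in IH kn mk *; apply: IH; [lia|apply: minors_inS => //; lia].
case=> ha hab hz; have [la [g [laO gO h]]] := row0.
set k1 := (X in X \in O) in h; set X := p ^+ r 1 in ha hab hz k1 h.
have X0 : X != 0 by exact: exp_neq0.
have : (-1) ^+ n / p \in O.
  have -> : (-1) ^+ n / p = k1 * (X * a 0%N / p) - la * (X * Z 1 / p)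
     - \sum_(1 <= l < n) g l * (X * a 0%N * b l / p).
    rewrite a0 /k1.
    have -> : \sum_(1 <= l < n) g l * (X * 1 * b l / p) = X / p * \sum_(1 <= l < n) g l * b l.
      by rewrite mulr_sumr; apply: eq_bigr => l _; ring.
    by field; rewrite p_neq0.
  apply: rpredB; first apply: rpredB.
  - by apply: rpredM; [|apply: ha].
  - exact: rpredM.
  by rewrite big_nat rpred_sum // => l ln; apply: rpredM; [apply: gO | apply: hab].
have sO : (-1) ^+ n \in O by rewrite rpredX // rpredN rpred1.
move=> /(rpredM sO); rewrite mulrA -expr2 sqrr_sign mul1r; exact/negP.
Qed.

(** Some p^(be k) a_j with j < k is not divisible by p, whereas p^(r k) a_j is integral. *)
Lemma be_le_r k : (0 < k <= n)%N -> (be k <= r k)%N.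
Proof.
move=> kn; have [j jk /negP ju] := adapted_unit ad a0 kn.
rewrite leqNgt; apply/negP => lt; apply: ju.
have [/(_ _ jk) h _ _] := minors_int kn.
have -> : p ^+ be k * a j / p = p ^+ (be k - (r k).+1) * (p ^+ r k * a j / 1).
  have -> : p ^+ be k = p ^+ (be k - (r k).+1) * (p * p ^+ r k) by rewrite -exprS -exprD subnK.
  by field; rewrite oner_neq0.
by rewrite rpredM // expO.
Qed.

Local Notation al k := (r k - be k)%N.

(** For a_j of maximal size p^(be k) a_j is a unit, and dividing the integral p^(r k) a_j b_i by it
    leaves p^(al k) b_i. *)
Lemma b_int k i : (0 < k)%N -> (k <= i < n)%N -> p ^+ al k * b i \in O.
Proof.
move=> k0 ki; have kn : (0 < k <= n)%N by lia.
have [j jk ju] := adapted_unit ad a0 kn.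
have jO := adapted_int ad (j := j) (k := k) ltac:(lia).
have [_ /(_ _ _ jk ki) h _] := minors_int kn.
have := nonunit_neq0 ju; rewrite mulf_eq0 negb_or => /andP[_ aj0].
have -> : p ^+ al k * b i = (p ^+ r k * a j * b i / 1) * (p ^+ be k * a j)^-1.
  have -> : p ^+ r k = p ^+ al k * p ^+ be k by rewrite -exprD subnK // be_le_r.
  by field; rewrite aj0 exp_neq0 oner_neq0.
by rewrite rpredM // unit_invO.
Qed.

Lemma tailz_int k : (0 < k <= n)%N -> p ^+ r k * Z k \in O.
Proof. by move=> /minors_int[_ _]; rewrite divr1. Qed.

(** Otherwise p would divide every generator at level k: the p^(r k) a_j because al k > 0, and the
    p^(r k) a_j b_i because of the hypothesis on the b_i. *)
Lemma tuple_prim k : (0 < k <= n)%N -> (0 < al k)%N ->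
  (forall i, (k <= i < n)%N -> p ^+ al k * b i / p \in O) ->
  p ^+ r k * Z k / p \notin O.
Proof.
move=> kn al0 hb; have rkE : p ^+ r k = p ^+ al k * p ^+ be k by rewrite -exprD subnK // be_le_r.
apply/negP => hz; apply: (minors_prim kn); split => //.
  move=> j jk; rewrite rkE.
  have -> : p ^+ al k * p ^+ be k * a j / p = p ^+ be k * a j * (p ^+ al k / p) by ring.
  by rewrite rpredM ?exp_divp // (adapted_int ad) //; lia.
move=> j i jk ki; rewrite rkE.
have -> : p ^+ al k * p ^+ be k * a j * b i / p = (p ^+ be k * a j) * (p ^+ al k * b i / p).
  by ring.
by apply: rpredM (hb _ ki); apply: (adapted_int ad); lia.
Qed.

Lemma exp_divp_lt x e f : (e < f)%N -> p ^+ e * x \in O -> p ^+ f * x / p \in O.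
Proof.
move=> ef h; have -> : p ^+ f * x / p = p ^+ (f - e.+1) * (p ^+ e * x).
  have -> : p ^+ f = p ^+ (f - e.+1) * (p * p ^+ e) by rewrite -exprS -exprD subnK.
  by field.
by rewrite rpredM // expO.
Qed.

(** If al k < al k.+1, then the b_i are too small at level k + 1, so that p^(r k.+1) Z_(k+1) is
    prime to p by [tuple_prim]. But in Z_(k+1) = Z_k + a_k b_k both terms become divisible by p
    after multiplication by p^(r k.+1), since also r k < r k.+1. *)
Lemma al_mono k : (0 < k < n)%N -> (al k.+1 <= al k)%N.
Proof.
move=> kn; rewrite leqNgt; apply/negP => lt.
have kn1 : (0 < k.+1 <= n)%N by lia.
have kn0 : (0 < k <= n)%N by lia.
have bS : (be k.+1 = be k + mu k)%N by apply: beS; lia.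
have rk := be_le_r kn0; have rk1 := be_le_r kn1.
have : p ^+ r k.+1 * Z k.+1 / p \notin O.
  apply: tuple_prim => //; first lia.
  by move=> i ki; apply: (exp_divp_lt lt); apply: b_int; lia.
apply/negP/negPn.
have -> : Z k.+1 = Z k + a k * b k by rewrite (@tailzS a b z k) ?subrK //; lia.
rewrite mulrDr mulrDl rpredD //.
  by apply: (@exp_divp_lt _ (r k)); [lia | exact: tailz_int].
have -> : p ^+ r k.+1 = p ^+ al k.+1 * p ^+ be k.+1 by rewrite -exprD subnK.
have -> : p ^+ al k.+1 * p ^+ be k.+1 * (a k * b k) / p
  = (p ^+ be k.+1 * a k) * (p ^+ al k.+1 * b k / p) by ring.
apply: rpredM; first by apply: (adapted_int ad); lia.
by apply: (exp_divp_lt lt); apply: b_int; lia.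
Qed.

Lemma coordn_unit : (0 < al n)%N -> p ^+ r n * z / p \notin O.
Proof.
move=> h; rewrite -(tailz_ge a b z (leqnn n)); apply: tuple_prim => //; first lia.
by move=> i; lia.
Qed.

(** If mu k = 0, then y is p^(al k) b_k; were it divisible by p, Z_k would have to be prime to p
    after scaling, against Z_k = Z_(k+1) - a_k b_k. If mu k > 0, then b_k - Z_(k+1) / a_k = - Z_k /
    a_k, and y is p^(r k) Z_k up to the unit p^(be k.+1) a_k. *)
Lemma coord_backward k : (0 < k < n)%N ->
  let y := (b k - Z k.+1 * (if mu k == 0%N then 0 else (a k)^-1))
     * p ^+ al k / p ^+ mu k in
  y \in O /\ ((al k.+1 < al k)%N -> y / p \notin O).
Proof.
move=> kn y; rewrite /y {y}.
have kn1 : (0 < k.+1 <= n)%N by lia.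
have kn0 : (0 < k <= n)%N by lia.
have bS : (be k.+1 = be k + mu k)%N by apply: beS; lia.
have rk := be_le_r kn0; have rk1 := be_le_r kn1.
have bk : p ^+ al k * b k \in O by apply: b_int; lia.
case: eqVneq => m0.
  rewrite m0 expr0 divr1 mulr0 subr0 mulrC; split => // lt.
  apply/negP => bp.
  have : p ^+ r k * Z k / p \notin O.
    apply: tuple_prim => //; first lia.
    move=> i ki; case: (eqVneq i k) => [->//|ik].
    by apply: (exp_divp_lt lt); apply: b_int; lia.
  apply/negP/negPn; rewrite tailzS; last lia.
  rewrite mulrBr mulrBl rpredB //.
    by apply: (@exp_divp_lt _ (r k.+1)); [lia | exact: tailz_int].
  have -> : p ^+ r k = p ^+ al k * p ^+ be k by rewrite -exprD subnK.
  have -> : p ^+ al k * p ^+ be k * (a k * b k) / p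
    = (p ^+ be k * a k) * (p ^+ al k * b k / p) by ring.
  apply: rpredM => //; have := adapted_int ad (j := k) (k := k.+1) ltac:(lia).
  by rewrite bS m0 addn0.
have [qO qU] := ad (k := k) ltac:(lia); have {}qU := qU ltac:(lia).
have := nonunit_neq0 qU; rewrite mulf_eq0 negb_or => /andP[_ ak0].
have ZE : Z k.+1 = Z k + a k * b k by rewrite (@tailzS a b z k) ?subrK //; lia.
have rE : p ^+ r k = p ^+ al k * p ^+ be k by rewrite -exprD subnK.
have bE : p ^+ be k.+1 = p ^+ be k * p ^+ mu k by rewrite bS exprD.
have -> : (b k - Z k.+1 / a k) * p ^+ al k / p ^+ mu k =
   - (p ^+ r k * Z k) * (p ^+ be k.+1 * a k)^-1.
  by rewrite ZE rE bE; field; rewrite ak0 !exp_neq0.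
have qV := unit_invO qO qU.
split; first by rewrite rpredM ?rpredN ?tailz_int.
move=> lt; have zu : p ^+ r k * Z k / p \notin O.
  apply: tuple_prim => //; first lia.
  move=> i ki; case: (eqVneq i k) => [->|ik]; last first.
    by apply: (exp_divp_lt lt); apply: b_int; lia.
  (* The exponent al k + be k.+1 exceeds r k.+1 because al k.+1 < al k, and exceeds r k because mu k
     > 0. *)
  have -> : p ^+ al k * b k / p = (p ^+ (al k + be k.+1) * Z k.+1 / p
       - p ^+ (al k + be k.+1) * Z k / p) * (p ^+ be k.+1 * a k)^-1.
    by rewrite exprD ZE; field; rewrite p_neq0 ak0 !exp_neq0.
  apply: rpredM qV; apply: rpredB.
    by apply: (@exp_divp_lt _ (r k.+1)); [lia | exact: tailz_int].
  by apply: (@exp_divp_lt _ (r k)); [lia | exact: tailz_int].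
apply: contra zu => h.
have -> : p ^+ r k * Z k / p =
   - (p ^+ be k.+1 * a k) * (- (p ^+ r k * Z k) / (p ^+ be k.+1 * a k) / p).
  by field; rewrite p_neq0 ak0 exp_neq0.
by rewrite rpredM ?rpredN.
Qed.

End Backward.
Variables (al nu : nat -> nat).
Hypotheses (alS : forall k, (0 < k <= n)%N -> al k = (al k.+1 + nu k)%N) (aln : al n.+1 = 0%N).
Hypothesis rE : forall k, (0 < k <= n)%N -> r k = (al k + be k)%N.

(** * Coordinates on (b, z) and the translations by integral (b', z') *)

Section Coordinates.
Variable a : nat -> K.
Hypotheses (ad : adapted a) (a0 : a 0%N = 1) (mu0 : mu 0%N = 0%N).

Definition ainv k : K := if mu k == 0%N then 0 else (a k)^-1.

(* The coordinate c_1k of the paper up to sign: it is p^(al k) b_k if mu k = 0,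
   and -(p^(r k) Z_k) / (p^(be (k + 1)) a_k) otherwise. In these coordinates the
   integral (b', z') act as translations by the product of the p^(al k) Z_p.   *)
Definition bcoord (b : nat -> K) z k : K :=
  (b k - tailz a b z k.+1 * ainv k) * p ^+ al k / p ^+ mu k.

(** Right multiplication of u' by the integral matrix with a = 0 and entries b', z' adds b' to b,
    [shiftz b' z' n] to z, and hence [shiftz b' z' k] to Z_k. *)
Definition shiftz (b' : nat -> K) z' k : K := z' + \sum_(1 <= l < k) a l * b' l.

Lemma shiftzS b' z' k : (0 < k)%N -> shiftz b' z' k.+1 = shiftz b' z' k + a k * b' k.
Proof. by move=> k0; rewrite /shiftz big_nat_recr //= addrA. Qed.

Lemma tailz_shift b z b' z' k : (0 < k <= n)%N ->
  tailz a (fun l => b l + b' l) (z + shiftz b' z' n) k = tailz a b z k + shiftz b' z' k.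
Proof.
move=> kn; rewrite /tailz /shiftz.
rewrite (@big_cat_nat _ _ _ k 1 n) //=; try lia.
have -> : \sum_(k <= l < n) a l * (b l + b' l)
   = \sum_(k <= l < n) a l * b l + \sum_(k <= l < n) a l * b' l.
  by rewrite -big_split; apply: eq_bigr => l _; rewrite mulrDr.
by ring.
Qed.

Lemma bcoord_shift b z b' z' k : (0 < k < n)%N ->
  bcoord (fun l => b l + b' l) (z + shiftz b' z' n) k =
  bcoord b z k + (b' k - shiftz b' z' k.+1 * ainv k) * p ^+ al k / p ^+ mu k.
Proof. by move=> kn; rewrite /bcoord tailz_shift; [ring|lia]. Qed.

(** By descending induction: besides b_l, the coordinate at l involves only Z_(l+1), hence only the
    b_i with i > l. *)
Lemma bcoord_inj b z b' k : (0 < k)%N ->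
  (forall l, (k <= l < n)%N -> bcoord b z l = bcoord b' z l) ->
  forall l, (k <= l < n)%N -> b l = b' l.
Proof.
move=> k0 h l ln; move: {2}(n - l)%N (leqnn (n - l)%N) => d.
elim: d l ln => [|d IH] l ln dl; first lia.
have hl : forall i, (l < i < n)%N -> b i = b' i by move=> i ?; apply: IH; lia.
have zE : tailz a b z l.+1 = tailz a b' z l.+1.
  by rewrite /tailz; congr (_ - _); apply: eq_big_nat => i ?; rewrite hl //; lia.
have := h l ln; rewrite /bcoord zE => /(mulIf (invr_neq0 (exp_neq0 _))).
by move=> /(mulIf (exp_neq0 _)) /(addIr _).
Qed.

Lemma bcoord_surj z (y : nat -> K) :
  exists b, forall k, (0 < k < n)%N -> bcoord b z k = y k.
Proof.
suff /(_ n) [b hb] : forall d, exists b,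
    forall k, (0 < k < n)%N -> (n - d <= k)%N -> bcoord b z k = y k.
  by exists b => k kn; apply: hb => //; lia.
elim=> [|d [b hb]]; first by exists (fun=> 0) => k; lia.
exists (fun k => if k == (n - d.+1)%N
   then y k * p ^+ mu k / p ^+ al k + tailz a b z k.+1 * ainv k else b k) => k kn kd.
have zE : tailz a (fun k => if k == (n - d.+1)%N
   then y k * p ^+ mu k / p ^+ al k + tailz a b z k.+1 * ainv k else b k) z k.+1 = tailz a b z k.+1.
  by rewrite /tailz; congr (_ - _); apply: eq_big_nat => i ?; rewrite ifN //; lia.
rewrite /bcoord zE; case: eqVneq => kd'; last by apply: hb; lia.
by field; rewrite !exp_neq0.
Qed.

Lemma shiftz_int b' z' k : (forall l, (0 < l < n)%N -> b' l \in O) -> z' \in O ->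
  (0 < k <= n)%N -> p ^+ be k * shiftz b' z' k \in O.
Proof.
move=> bO zO kn; rewrite /shiftz mulrDr rpredD //; first exact: rpredM (expO _) zO.
rewrite mulr_sumr big_nat rpred_sum // => l lk; rewrite mulrA.
by apply: rpredM; [apply: (adapted_int ad) | apply: bO]; lia.
Qed.

(** If mu k = 0 the translation at k is p^(al k) b'_k. If mu k > 0 the terms in b'_k cancel, and
    [shiftz] at k remains, whose denominator divides p^(be k), over the unit p^(be k.+1) a_k. *)
Lemma lattice_int b' z' : (forall l, (0 < l < n)%N -> b' l \in O) -> z' \in O ->
  (0 < n)%N ->
  p ^+ r n * shiftz b' z' n / p ^+ al n \in O /\
  forall k, (0 < k < n)%N ->
    (b' k - shiftz b' z' k.+1 * ainv k) * p ^+ al k / p ^+ mu k / p ^+ al k \in O.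
Proof.
move=> bO zO n0; have nn : (0 < n <= n)%N by lia.
split.
  have -> : p ^+ r n * shiftz b' z' n / p ^+ al n = p ^+ be n * shiftz b' z' n.
    by rewrite rE // exprD; field; rewrite exp_neq0.
  exact: shiftz_int.
move=> k kn; rewrite /ainv; case: eqVneq => m0.
  by rewrite m0 mulr0 subr0 expr0 divr1 mulfK ?exp_neq0 // bO.
have [qO qU] := ad (k := k) ltac:(lia); have {}qU := qU ltac:(lia).
have := nonunit_neq0 qU; rewrite mulf_eq0 negb_or => /andP[_ ak0].
have bE : p ^+ be k.+1 = p ^+ be k * p ^+ mu k by rewrite beS ?exprD //; lia.
rewrite shiftzS; last lia.
have -> : (b' k - (shiftz b' z' k + a k * b' k) / a k) * p ^+ al k / p ^+ mu k / p ^+ al k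
   = - (p ^+ be k * shiftz b' z' k) * (p ^+ be k.+1 * a k)^-1.
  by rewrite bE; field; rewrite ak0 !exp_neq0.
by rewrite rpredM ?rpredN ?unit_invO // shiftz_int //; lia.
Qed.

(** To descend from level k + 1 to level k, choose b'_k so that S - a_k b'_k satisfies the bound at
    level k. If mu k = 0, the value of tau at k dictates b'_k. Otherwise it dictates S - a_k b'_k,
    and b'_k is then integral because p^(be (k + 1)) a_k is a unit. *)
Lemma lattice_solve_aux (tau : nat -> K) k S : (0 < k <= n)%N -> p ^+ be k * S \in O ->
  (forall j, (0 < j < k)%N -> tau j / p ^+ al j \in O) ->
  exists b' z', [/\ forall l, b' l \in O, z' \in O, shiftz b' z' k = S &
    forall j, (0 < j < k)%N ->
      (b' j - shiftz b' z' j.+1 * ainv j) * p ^+ al j / p ^+ mu j = tau j].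
Proof.
elim: k S => // -[|k] IH S kn SO tauO.
  exists (fun=> 0), S; split => //.
  - by move=> _; rewrite rpred0.
  - by move: SO; rewrite beS ?be0 ?mu0 ?expr0 ?mul1r //; lia.
  - by rewrite /shiftz big_geq // addr0.
  - by move=> j; lia.
have tO := tauO k.+1 ltac:(lia).
have [qO qU] := ad (k := k.+1) ltac:(lia).
have bE : p ^+ be k.+2 = p ^+ be k.+1 * p ^+ mu k.+1 by rewrite beS ?exprD //; lia.
suff [c [cO SO' cE]] : exists c, [/\ c \in O, p ^+ be k.+1 * (S - a k.+1 * c) \in O &
    (c - S * ainv k.+1) * p ^+ al k.+1 / p ^+ mu k.+1 = tau k.+1].
  have [||b' [z' [b'O z'O sE h]]] := IH (S - a k.+1 * c) _ SO'; first lia.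
    by move=> j jk; apply: tauO; lia.
  have sE' j : (j <= k.+1)%N -> shiftz (fun l => if l == k.+1 then c else b' l) z' j = shiftz b' z' j.
    move=> jk; rewrite /shiftz; congr (_ + _); apply: eq_big_nat => l ?.
    by rewrite ifN //; lia.
  exists (fun l => if l == k.+1 then c else b' l), z'; split => //.
  - by move=> l; case: ifP.
  - by rewrite shiftzS // eqxx sE' // sE subrK.
  - move=> j jk; case: (eqVneq j k.+1) => [->|jk1].
      by rewrite shiftzS // eqxx sE' // sE subrK.
    by rewrite sE'; [apply: h; lia | lia].
rewrite /ainv; case: eqVneq => m0.
  exists (tau k.+1 / p ^+ al k.+1); split => //.
    have qO' : p ^+ be k.+1 * a k.+1 \in O by move: qO; rewrite bE m0 mulr1.
    rewrite mulrBr rpredB //; first by move: SO; rewrite bE m0 mulr1.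
    by rewrite [_ * (a _ * _)]mulrA; exact: rpredM qO' tO.
  by rewrite m0 expr0 mulr0 subr0 divr1 divfK // exp_neq0.
have {}qU := qU ltac:(lia).
have := nonunit_neq0 qU; rewrite mulf_eq0 negb_or => /andP[_ ak0].
have qV := unit_invO qO qU.
pose S' : K := - tau k.+1 * a k.+1 * p ^+ mu k.+1 / p ^+ al k.+1.
have S'O : p ^+ be k.+1 * S' \in O.
  have -> : p ^+ be k.+1 * S' = - (tau k.+1 / p ^+ al k.+1) * (p ^+ be k.+2 * a k.+1).
    by rewrite /S' bE; ring.
  by rewrite rpredM // rpredN.
exists ((S - S') / a k.+1); split.
- have -> : (S - S') / a k.+1 = (p ^+ be k.+2 * S - p ^+ mu k.+1 * (p ^+ be k.+1 * S'))
     * (p ^+ be k.+2 * a k.+1)^-1.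
    by rewrite bE; field; rewrite ak0 !exp_neq0.
  apply: rpredM qV; apply: rpredB => //.
  by apply: rpredM S'O; exact: expO.
- by have -> : S - a k.+1 * ((S - S') / a k.+1) = S' by field.
- by rewrite /S'; field; rewrite ak0 !exp_neq0.
Qed.

Lemma lattice_solve (tau : nat -> K) : (0 < n)%N ->
  (forall j, (0 < j <= n)%N -> tau j / p ^+ al j \in O) ->
  exists b' z', [/\ forall l, b' l \in O, z' \in O, p ^+ r n * shiftz b' z' n = tau n &
    forall j, (0 < j < n)%N ->
      (b' j - shiftz b' z' j.+1 * ainv j) * p ^+ al j / p ^+ mu j = tau j].
Proof.
move=> n0 tO; have nn : (0 < n <= n)%N by lia.
have [|||b' [z' [h1 h2 h3 h4]]] := @lattice_solve_aux tau n (tau n / p ^+ r n) => //.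
- rewrite rE // exprD.
  have -> : p ^+ be n * (tau n / (p ^+ al n * p ^+ be n)) = tau n / p ^+ al n.
    by field; rewrite !exp_neq0.
  exact: tO.
- by move=> j jn; apply: tO; lia.
exists b', z'; split => //.
by rewrite h3 mulrC divfK // exp_neq0.
Qed.

End Coordinates.

(** * Solving the rows for given residues *)

Section Forward.
Variables (a b q t : nat -> K) (z : K) (eps : nat -> K).
Hypotheses (eps2 : forall k, eps k * eps k = 1) (epsO : forall k, eps k \in O).
Let qb k : K := if mu k == 0%N then 0 else (q k)^-1.
Let tb k : K := if nu k == 0%N then 0 else (t k)^-1.
Local Notation Z := (tailz a b z).

Hypotheses (qO : forall k, (0 < k < n)%N -> q k \in O)
  (qU : forall k, (0 < k < n)%N -> (0 < mu k)%N -> q k != 0 /\ (q k)^-1 \in O)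
  (tO : forall k, (0 < k <= n)%N -> t k \in O)
  (tU : forall k, (0 < k <= n)%N -> (0 < nu k)%N -> t k != 0 /\ (t k)^-1 \in O).
Hypotheses (a0 : a 0%N = 1) (mu0 : mu 0%N = 0%N)
  (aE : forall k, (0 < k < n)%N -> a k = q k / p ^+ be k.+1)
  (zE : z = t n / p ^+ r n)
  (bE : forall k, (0 < k < n)%N ->
     b k = Z k.+1 * qb k * p ^+ be k.+1 + eps k * t k * p ^+ mu k / p ^+ al k).

Lemma param_adapted : adapted a.
Proof.
move=> [|k] kn.
  by rewrite beS // be0 mu0 a0 mulr1 expr0 rpred1.
have aq : p ^+ be k.+2 * a k.+1 = q k.+1.
  by rewrite aE; [rewrite mulrC divfK // exp_neq0 | lia].
rewrite aq; split; first by apply: qO; lia.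
by move=> m0; have [q0 qV] := qU (k := k.+1) ltac:(lia) m0; apply: unit_divp.
Qed.

Lemma qbO k : (0 < k < n)%N -> qb k \in O.
Proof.
move=> kn; rewrite /qb; case: eqVneq => m0; first by rewrite rpred0.
by have [] := qU kn ltac:(lia).
Qed.

Lemma tbO k : (0 < k <= n)%N -> tb k \in O.
Proof.
move=> kn; rewrite /tb; case: eqVneq => m0; first by rewrite rpred0.
by have [] := tU kn ltac:(lia).
Qed.

(** A Bezout relation modulo p^(al k), divided by p^(al k): the coefficients of p^(r k) Z_k and of
    the p^(al k) b_l are de / p^(be k) and the g l. The last clause records what this relation
    contributes to the superdiagonal entry of u in column k. *)
Lemma primitive_sol k : (0 < k <= n)%N -> exists de g,
  [/\ de / p ^+ be k \in O, forall l, (k <= l < n)%N -> g l \in O,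
      de * Z k + \sum_(k <= l < n) g l * b l - (p ^+ al k)^-1 \in O &
      if (k < n)%N
      then (de * a k - g k) * (p ^+ r k.+1 / p ^+ r k) = - eps k * tb k / p ^+ nu k
      else de / p ^+ r n = tb n / p ^+ nu n].
Proof.
move: {2}(n - k)%N (erefl (n - k)%N) => d; elim: d k => [|d IH] k dE kn.
  have kE : k = n by lia.
  subst k; rewrite ltnn.
  exists (tb n * p ^+ be n), (fun=> 0); split => //.
  - by rewrite mulfK ?exp_neq0 // tbO.
  - by move=> l _; rewrite rpred0.
  - rewrite big_nat_cond big_pred0 => [|l]; last by lia.
    rewrite addr0 tailz_ge // zE rE //.
    have -> : al n = nu n by rewrite alS ?aln.
    rewrite /tb; case: eqVneq => [->|m0].
      by rewrite mul0r mul0r sub0r expr0 invr1 rpredN rpred1.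
    have [t0 _] := tU kn ltac:(lia); rewrite exprD.
    suff -> : (t n)^-1 * p ^+ be n * (t n / (p ^+ nu n * p ^+ be n)) - (p ^+ nu n)^-1 = 0
      by rewrite rpred0.
    by field; rewrite t0 !exp_neq0.
  - have -> : r n = (nu n + be n)%N by rewrite rE // alS ?aln.
    rewrite exprD; by field; rewrite !exp_neq0.
have kn1 : (k < n)%N by lia.
have beE : p ^+ be k.+1 = p ^+ be k * p ^+ mu k by rewrite beS // exprD.
have alE : p ^+ al k = p ^+ al k.+1 * p ^+ nu k by rewrite alS // exprD.
have rkE : p ^+ r k = p ^+ al k * p ^+ be k by rewrite rE // exprD.
have rk1E : p ^+ r k.+1 = p ^+ al k.+1 * p ^+ be k.+1 by rewrite rE ?exprD //; lia.
have kn2 : (0 < k < n)%N by lia.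
have nzs := (exp_neq0 (be k), exp_neq0 (mu k), exp_neq0 (nu k), exp_neq0 (al k.+1)).
rewrite kn1.
have [n0|n0] := posnP (nu k).
  have [de [g [h1 h2 h3 _]]] := IH k.+1 ltac:(lia) ltac:(lia).
  (* As al k = al k.+1 and de Z_(k+1) = de Z_k + de a_k b_k, the relation for k + 1 is one for k,
     with zero contribution to the superdiagonal. *)
  exists de, (fun l => if l == k then de * a k else g l); split.
  - have -> : de / p ^+ be k = de / p ^+ be k.+1 * p ^+ mu k.
      by rewrite beE; field; rewrite !nzs.
    by rewrite rpredM // expO.
  - move=> l lk; case: eqVneq => [_|lk']; last by apply: h2; lia.
    have := rpredM h1 (adapted_int (j := k) (k := k.+1) param_adapted ltac:(lia)).
    by rewrite mulrA divfK // exp_neq0.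
  - rewrite big_ltn // eqxx tailzS //.
    move: h3; rewrite alE n0 expr0 mulr1.
    rewrite (eq_big_nat _ _ (F2 := fun l => (if l == k then de * a k else g l) * b l)).
      by congr (_ \in O); ring.
    by move=> l lk; rewrite ifN //; lia.
  - by rewrite eqxx subrr mul0r /tb n0 eqxx mulr0 mul0r.
have [t0 tV] := tU kn n0.
have tbE : tb k = (t k)^-1 by rewrite /tb ifN //; lia.
have [m0|m0] := posnP (mu k).
  (* For mu k = 0 one has b_k = eps k t_k / p^(al k), with t_k a unit, so b_k alone suffices. *)
  exists 0, (fun l => if l == k then eps k * (t k)^-1 else 0); split.
  - by rewrite mul0r rpred0.
  - by move=> l _; case: ifP => _; rewrite ?rpred0 // rpredM.
  - rewrite big_ltn // eqxx big_nat_cond big1 => [|l lk]; last first.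
      by rewrite ifN ?mul0r //; lia.
    rewrite mul0r add0r addr0 (bE kn2) /qb m0 eqxx mulr0 mul0r add0r expr0.
    have -> : eps k / t k * (eps k * t k * 1 / p ^+ al k) = eps k * eps k / p ^+ al k.
      by field; rewrite t0 exp_neq0.
    by rewrite eps2 mul1r subrr rpred0.
  - rewrite eqxx rkE rk1E beE alE m0 expr0 tbE.
    by field; rewrite !nzs t0.
have [q0 qV] := qU kn2 m0.
have qbE : qb k = (q k)^-1 by rewrite /qb ifN //; lia.
(* Here Z_k = - eps k q_k t_k / p^(r k) with q_k and t_k units, so Z_k alone suffices. *)
exists (- eps k * (q k)^-1 * (t k)^-1 * p ^+ be k), (fun=> 0); split => //.
- by rewrite mulfK ?exp_neq0 // !rpredM // rpredN.
- by move=> l _; rewrite rpred0.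
- rewrite big1 => [|l _]; last by rewrite mul0r.
  rewrite tailzS // (bE kn2) qbE (aE kn2) addr0 beE.
  set X := (X in X - _).
  suff -> : X = (eps k * eps k) / p ^+ al k by rewrite eps2 mul1r subrr rpred0.
  by rewrite /X; field; rewrite q0 t0 !nzs exp_neq0.
- rewrite (aE kn2) rkE rk1E beE alE tbE.
  by field; rewrite !nzs q0 t0.
Qed.

Lemma param_rown : (0 < n)%N -> rown_sys a z.
Proof.
move=> n0; have nn : (0 < n <= n)%N by lia.
split; last by rewrite zE mulrC divfK ?exp_neq0 // tO.
move=> j jn; rewrite rE // exprD -mulrA rpredM ?expO //.
by apply: adapted_int => //; [exact: param_adapted | lia].
Qed.

Lemma param_row0 : (1 < n)%N -> exists la g, row0_sys a b z la g /\
   p ^+ r 2 / p ^+ r 1 * (la * a 1 - g 1) = (-1) ^+ n * eps 1 * tb 1 / p ^+ nu 1.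
Proof.
move=> n1; have [de [g [h1 h2 h3]]] := primitive_sol (k := 1) ltac:(lia).
rewrite n1 => h4.
have be1 : be 1 = 0%N by rewrite beS ?be0 ?mu0 //; lia.
(* Since be 1 = 0 and al 1 = r 1, row 0 is the relation for k = 1 multiplied by - (-1)^n. *)
exists (- (-1) ^+ n * de), (fun l => - (-1) ^+ n * g l); split; last first.
  have -> : (-1) ^+ n * eps 1 * tb 1 / p ^+ nu 1 = - (-1) ^+ n * (- eps 1 * tb 1 / p ^+ nu 1).
    by ring.
  by rewrite -h4; ring.
have sO : - (-1) ^+ n \in O by rewrite rpredN rpredX // rpredN rpred1.
split.
- by move: h1; rewrite be1 expr0 divr1 => h1; rewrite rpredM.
- by move=> l ln; rewrite rpredM // h2.
- move: (rpredM sO h3); rewrite rE ?be1 ?addn0; last lia.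
  congr (_ \in O); rewrite mulrBr mulrDr mulr_sumr.
  under eq_bigr do rewrite mulrA.
  by ring.
Qed.

Lemma param_rowi i : (0 < i < n)%N -> exists la g, row_sys a b z i la g /\
  if (i.+1 < n)%N then
    p ^+ r i.+2 / p ^+ r i.+1 * (la * a i.+1 - g i.+1) =
     q i.+1 * qb i * p ^+ nu i / (p ^+ mu i * p ^+ nu i.+1)
     - eps i * eps i.+1 * t i * tb i.+1 / p ^+ nu i.+1
  else la / p ^+ r n = qb i * p ^+ nu i / (p ^+ mu i * p ^+ nu i.+1)
     + eps i * t i * tb i.+1 / p ^+ nu i.+1.
Proof.
move=> iN; have [de [g [h1 h2 h3 h4]]] := primitive_sol (k := i.+1) ltac:(lia).
have beE : p ^+ be i.+1 = p ^+ be i * p ^+ mu i by rewrite beS ?exprD //; lia.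
have alE : p ^+ al i = p ^+ al i.+1 * p ^+ nu i by rewrite alS ?exprD //; lia.
have riE : p ^+ r i = p ^+ al i * p ^+ be i by rewrite rE ?exprD //; lia.
have ri1E : p ^+ r i.+1 = p ^+ al i.+1 * p ^+ be i.+1 by rewrite rE ?exprD //; lia.
have nzs := (exp_neq0 (be i), exp_neq0 (mu i), exp_neq0 (nu i), exp_neq0 (al i.+1)).
have tiO := tO (k := i) ltac:(lia).
have la0E : qb i * (p ^+ r i / p ^+ r i.+1 * p ^+ be i.+1) = qb i * p ^+ nu i * p ^+ be i.
  by rewrite ri1E riE alE beE; field; rewrite !nzs.
(* The two terms of la answer the two terms of b_i. After multiplication by p^(r i) / p^(r i.+1) the
   first is a multiple of Z_(i+1) and is matched exactly; the second is eps i t_i / p^(al i.+1),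
   that is eps i t_i times the relation for i + 1. *)
exists (qb i * (p ^+ r i / p ^+ r i.+1 * p ^+ be i.+1) + eps i * t i * de),
  (fun l => eps i * t i * g l); split; last first.
  case: ifP h4 => iN1 h4.
    have al1E : p ^+ al i.+1 = p ^+ al i.+2 * p ^+ nu i.+1 by rewrite alS ?exprD //; lia.
    have be1E : p ^+ be i.+2 = p ^+ be i.+1 * p ^+ mu i.+1 by rewrite beS ?exprD //; lia.
    have ri2E : p ^+ r i.+2 = p ^+ al i.+2 * p ^+ be i.+2 by rewrite rE ?exprD //; lia.
    transitivity (p ^+ r i.+2 / p ^+ r i.+1 * (qb i * p ^+ nu i * p ^+ be i * a i.+1)
       + eps i * t i * (- eps i.+1 * tb i.+1 / p ^+ nu i.+1)).
      by rewrite -h4 la0E; ring.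
    rewrite aE; last lia.
    rewrite ri2E ri1E al1E be1E beE.
    by field; rewrite !exp_neq0.
  have iE : i.+1 = n by lia.
  transitivity (qb i * p ^+ nu i * p ^+ be i / p ^+ r n + eps i * t i * (de / p ^+ r n)).
    by rewrite la0E; ring.
  rewrite h4 -iE ri1E.
  have -> : al i.+1 = nu i.+1 by rewrite alS ?iE ?aln //; lia.
  by rewrite beE; field; rewrite !exp_neq0.
have h1' : de / p ^+ be i \in O.
  have -> : de / p ^+ be i = de / p ^+ be i.+1 * p ^+ mu i by rewrite beE; field; rewrite !nzs.
  by rewrite rpredM ?expO.
have ad := param_adapted.
split.
- by move=> l lN; rewrite !rpredM // h2.
- move=> j ji; have haj := adapted_int (j := j) (k := i) ad ltac:(lia).
  rewrite la0E mulrDl rpredD //.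
    by rewrite -mulrA (rpredM _ haj) // rpredM ?qbO ?expO.
  have -> : eps i * t i * de * a j = eps i * t i * (de / p ^+ be i) * (p ^+ be i * a j).
    by field; rewrite !nzs.
  exact: rpredM (rpredM (rpredM (epsO i) tiO) h1') haj.
- have haj := adapted_int (j := i) (k := i.+1) ad ltac:(lia).
  rewrite mulrDl opprD addrA rpredB //; last first.
    have -> : eps i * t i * de * a i = eps i * t i * (de / p ^+ be i.+1) * (p ^+ be i.+1 * a i).
      by field; rewrite !exp_neq0.
    exact: rpredM (rpredM (rpredM (epsO i) tiO) h1) haj.
  rewrite aE // /qb; case: eqVneq => m0.
    rewrite mul0r mul0r subr0 riE ri1E beE alE m0.
    have -> : p ^+ al i.+1 * p ^+ nu i * p ^+ be i / (p ^+ al i.+1 * (p ^+ be i * p ^+ 0)) = p ^+ nu i.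
      by rewrite expr0; field; rewrite !nzs.
    exact: expO.
  have [q0 _] := qU iN ltac:(lia).
  suff -> : p ^+ r i / p ^+ r i.+1 -
    (q i)^-1 * (p ^+ r i / p ^+ r i.+1 * p ^+ be i.+1) * (q i / p ^+ be i.+1) = 0 by rewrite rpred0.
  by field; rewrite !exp_neq0 q0.
- move: (rpredM (rpredM (epsO i) tiO) h3); congr (_ \in O).
  rewrite mulrBr mulrDr mulr_sumr.
  under eq_bigr do rewrite mulrA.
  rewrite (bE iN) riE ri1E beE alE.
  by field; rewrite !nzs.
Qed.

End Forward.
End HeisenbergRows.

(** * The p-adic integers as a valuation ring *)

Lemma fraction_split (A : idomainType) (x : {fraction A}) :
  exists u d : A, d != 0 /\ x = tofrac u / tofrac d.
Proof.
elim/quotW: x => -[[u d] /= d0]; exists u, d; split => //.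
have fd0 : tofrac d != 0 :> {fraction A} by rewrite tofrac_eq0.
apply: (mulIf fd0); rewrite divfK // {fd0}.
rewrite -[_ * tofrac d]/(FracField.mul _ _) !piE; apply/eqmodP.
rewrite /= FracField.equivfE /FracField.mulf !numden_Ratio ?oner_eq0 ?mulr1 //.
by rewrite mulrC.
Qed.

Section FieldIdentities.
Variables (K : fieldType) (a b c d x y : K).
Hypotheses (c0 : c != 0) (d0 : d != 0).

Lemma mul_div_cancel : c * (a / (c * d)) = a * d^-1.
Proof. by field; rewrite c0 d0. Qed.

Lemma frac_subl : x = b / d + y -> (a * d - b * c) / (c * d) = y - (x - a / c).
Proof. by move=> ->; field; rewrite c0. Qed.

Lemma frac_addB : x - a / c + (y - b / d) = x + y - (a * d + b * c) / (c * d).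
Proof. by field; rewrite c0 d0. Qed.

End FieldIdentities.

Section Padic.
Variables (p : nat) (hp : prime p).
Local Notation Zp := (padic_int hp).
Local Notation Qp := (padic hp).
Local Notation P k := ((p ^ k)%N%:Z).

Let P_gt0 k : 0 < P k.
Proof. by rewrite ltz_nat expn_gt0 prime_gt0. Qed.

Lemma padic_res_int (a : int) k : (a%:~R : Zp) k = (a %% P k)%Z.
Proof.
have natE (m : nat) : (m%:R : Zp) k = (m%:Z %% P k)%Z.
  elim: m => [|m IH]; first by rewrite mulr0n /= mod0z.
  by rewrite mulrS /= IH modzDm -PoszD add1n.
case: a => m; first by rewrite -pmulrn natE.
by rewrite NegzE mulrNz -pmulrn /= natE modzNm.
Qed.

(** The quotient has the residues x_(k+j) / p^k, which are compatible because x_(k+j+1) and x_(k+j)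
    agree modulo p^(k+j). *)
Lemma padic_res_dvd (x : Zp) k : x k = 0 -> exists y, x = p%:R ^+ k * y.
Proof.
move=> xk0.
have dv j : (P k %| x (k + j)%N)%Z.
  by apply/dvdz_mod0P; rewrite padic_res_le.
have comp j : ((x (k + j.+1)%N %/ P k)%Z %% P j = (x (k + j)%N %/ P k)%Z %% P j)%Z.
  have := padic_resP x (k + j); rewrite -addnS => h.
  have [u uE] := dvdzP (dv j.+1); have [v vE] := dvdzP (dv j).
  move: h; rewrite uE vE !mulzK ?gt_eqF // expnD PoszM mulrC [u * _]mulrC.
  move=> /(congr1 (fun a => a %% (P k * P j))%Z); rewrite modz_mod => /esym /eqP.
  by rewrite eqz_mod_dvd -mulrBr dvdz_mul2l ?gt_eqF // -eqz_mod_dvd => /eqP.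
exists (padic_lim hp comp); apply: padic_int_eq => j.
rewrite -natrX; set w : Zp := (p ^ k)%:R.
have wE : w j = (P k %% P j)%Z by rewrite /w pmulrn padic_res_int.
rewrite /= wE {w wE}.
rewrite modzMm mulrC divzK // addnC.
by rewrite padic_res_le.
Qed.

(** Every x_k is prime to p; inverses modulo p^k chosen for each k are compatible since such
    inverses are unique modulo p^k. *)
Lemma padic_res_unit (x : Zp) : x 1%N != 0 -> exists y, x * y = 1.
Proof.
move=> x1.
have cop k : coprimez (x k) (P k).
  case: k => [|k]; first by rewrite /coprimez expn0 gcdz1.
  rewrite coprimezE /= coprimeXr // coprime_sym prime_coprime //.
  apply: contra x1 => pk; apply/eqP.
  rewrite -(padic_res_le x 1 k) add1n expn1; apply/dvdz_mod0P.
  by rewrite dvdzE.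
have inv k : exists y, (x k * y %% P k = 1 %% P k)%Z.
  have /eqP g1 := cop k; have [u [v uv]] := Bezoutz (x k) (P k).
  by exists u; rewrite -g1 -uv [x k * u]mulrC addrC modzMDl.
have {inv}[y yE] := choice inv.
have comp k : (y k.+1 %% P k = y k %% P k)%Z.
  apply/eqP; rewrite eqz_mod_dvd -(@Gauss_dvdzr _ (x k)); last first.
    by rewrite coprimez_sym.
  rewrite mulrBr -eqz_mod_dvd yE.
  have -> : (x k * y k.+1 %% P k)%Z = ((x k.+1 * y k.+1) %% P k)%Z.
    by rewrite -modzMml -padic_resS modzMml.
  rewrite -(modz_dvdm (x k.+1 * y k.+1) (m := P k.+1)) ?yE ?modz_dvdm //.
    by rewrite expnS PoszM dvdz_mull.
  by rewrite expnS PoszM dvdz_mull.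
exists (padic_lim hp comp); apply: padic_int_eq => k.
by rewrite /= modzMmr yE.
Qed.

Definition pint : Qp -> bool := fun x => `[< exists z : Zp, x = tofrac z >].

Lemma pintP (x : Qp) : reflect (exists z : Zp, x = tofrac z) (x \in pint).
Proof. exact: asboolP. Qed.

Fact pint_subring : subring_closed pint.
Proof.
split; first by apply/pintP; exists 1; rewrite rmorph1.
  by move=> x y /pintP[u ->] /pintP[v ->]; apply/pintP; exists (u - v); rewrite rmorphB.
by move=> x y /pintP[u ->] /pintP[v ->]; apply/pintP; exists (u * v); rewrite rmorphM.
Qed.
HB.instance Definition _ := GRing.isSubringClosed.Build Qp pint pint_subring.

Local Notation pi := (p%:R : Qp).

Lemma tofrac_pint (z : Zp) : tofrac z \in pint.
Proof. by apply/pintP; exists z. Qed.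

Lemma tofrac_piX k : tofrac (p%:R ^+ k : Zp) = pi ^+ k.
Proof. by rewrite rmorphXn rmorph_nat. Qed.

Lemma padic_p_neq0 : pi != 0.
Proof.
rewrite -(expr1 pi) -tofrac_piX tofrac_eq0; apply/eqP => /(congr1 (fun x : Zp => x 2)).
rewrite expr1 pmulrn padic_res_int /= mod0z => /dvdz_mod0P.
rewrite dvdzE /= => /dvdn_leq; rewrite prime_gt0 // => /(_ isT).
by rewrite leqNgt -{1}(expn1 p) ltn_exp2l ?prime_gt1.
Qed.

Lemma intr_divX (a : int) k : (a%:~R / pi ^+ k \in pint) = (P k %| a)%Z.
Proof.
apply/pintP/idP => [[z zE]|/dvdzP[c ->]]; last first.
  exists c%:~R; rewrite rmorphM /= rmorph_int -pmulrn natrX mulfK //.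
  exact/expf_neq0/padic_p_neq0.
have : (a%:~R : Zp) = p%:R ^+ k * z.
  apply/eqP; rewrite -tofrac_eq rmorphM /= tofrac_piX -zE rmorph_int.
  by rewrite mulrC divfK // expf_neq0 // padic_p_neq0.
move=> /(congr1 (fun x : Zp => x k)); rewrite padic_res_int -natrX pmulrn /= padic_res_int.
by rewrite modzz mul0r mod0z => /dvdz_mod0P.
Qed.

Lemma padic_pVO : pi^-1 \notin pint.
Proof.
rewrite -[pi^-1]mul1r -{1}[pi]expr1 (intr_divX 1 1) expn1 dvdzE /= dvdn1.
by rewrite neq_ltn prime_gt1 ?orbT.
Qed.

Lemma padic_local x : x \in pint -> x / pi \in pint \/ x^-1 \in pint.
Proof.
move=> /pintP[z ->]; case: (eqVneq (z 1%N) 0) => z1.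
  have [y ->] := padic_res_dvd z1; left.
  by rewrite rmorphM /= tofrac_piX expr1 mulrC mulKf ?padic_p_neq0 // tofrac_pint.
have [y yE] := padic_res_unit z1; right.
suff -> : (tofrac z)^-1 = tofrac y by exact: tofrac_pint.
have : tofrac z * tofrac y = 1 :> Qp by rewrite -rmorphM yE rmorph1.
by move=> h; apply: (@mulfI _ (tofrac z)); [apply: contra_eq_neq h => ->; rewrite mul0r eq_sym oner_neq0
  | rewrite h divff //; apply: contra_eq_neq h => ->; rewrite mul0r eq_sym oner_neq0].
Qed.

(** The exponent k is the last index at which the residue of d vanishes; the cofactor has nonzero
    residue modulo p, as the next residue of d is nonzero. *)
Lemma padic_int_factor (d : Zp) : d != 0 -> exists k e y, d = p%:R ^+ k * e /\ e * y = 1.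
Proof.
move=> d0.
have exk : exists k, d k != 0.
  have [k hk] := padic_neq0 d0; exists k; apply: contraNneq (hk 0%N) => h.
  by rewrite addn0 h dvdz0.
case: (ex_minnP exk) => -[|k] dk kmin.
  by case/eqP: dk; rewrite (padic_resP d 0) expn0 modz1.
have dk0 : d k = 0 by apply/eqP; apply/negPn/negP => /kmin; rewrite ltnn.
have [e eE] := padic_res_dvd dk0.
have [|y yE] := @padic_res_unit e; last by exists k, e, y.
apply: contra dk => /eqP /padic_res_dvd[f fE].
rewrite eE fE mulrA -exprD -natrX addn1 /= pmulrn padic_res_int modzz mul0r.
by rewrite mod0z.
Qed.

Lemma padic_arch (x : Qp) : exists N, pi ^+ N * x \in pint.
Proof.
have [u [d [d0 ->]]] := fraction_split x.
have [k [e [y [-> ey]]]] := padic_int_factor d0; exists k.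
have e0 : e != 0 by apply: contra_eq_neq ey => ->; rewrite mul0r eq_sym oner_neq0.
apply/pintP; exists (u * y).
have fe : tofrac y = (tofrac e)^-1 :> Qp.
  apply: (@mulfI _ (tofrac e)); first by rewrite tofrac_eq0.
  by rewrite -rmorphM ey rmorph1 divff // tofrac_eq0.
rewrite !rmorphM /= tofrac_piX fe.
by rewrite mul_div_cancel // ?expf_neq0 ?padic_p_neq0 // tofrac_eq0.
Qed.

Lemma padic_approx (x : Qp) k : x \in pint ->
  exists2 m : nat, (m < p ^ k)%N & (x - m%:R) / pi ^+ k \in pint.
Proof.
move=> /pintP[z ->]; exists `|z k|%N.
  by rewrite -ltz_nat gez0_abs -padic_res_mod ?ltz_pmod ?modz_ge0 ?gt_eqF.
have [|y yE] := @padic_res_dvd (z - `|z k|%N%:R) k.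
  rewrite pmulrn /= padic_res_int gez0_abs; last by rewrite -padic_res_mod modz_ge0 ?gt_eqF.
  by rewrite modzNm modzDmr addrN mod0z.
apply/pintP; exists y; have : tofrac (z - `|z k|%N%:R) = pi ^+ k * tofrac y :> Qp.
  by rewrite yE rmorphM /= tofrac_piX.
rewrite rmorphB rmorph_nat => ->; rewrite mulrC mulKf //.
by rewrite expf_neq0 // padic_p_neq0.
Qed.

Lemma padic_order (x : Qp) N :
  exists2 M, (N <= M)%N & pi ^+ M * x \in pint /\ ((N < M)%N -> pi ^+ M * x / pi \notin pint).
Proof.
have exM : exists M, (N <= M)%N && (pi ^+ M * x \in pint).
  have [M h] := padic_arch x; exists (N + M)%N; rewrite leq_addr exprD -mulrA.
  by rewrite rpredM // rpredX // rpred_nat.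
case: (ex_minnP exM) => M /andP[NM MO] Mmin; exists M => //; split=> // lt.
apply/negP => h; suff : (M <= M.-1)%N by lia.
apply: Mmin; apply/andP; split; first lia.
by case: M lt h {NM MO} => // M _; rewrite exprSr mulrAC mulfK ?padic_p_neq0.
Qed.

Section Character.
Variable R : realType.
Local Notation twopi := (2 * trigo.pi : R).

Let expc (x : R) : R[i] := Complex (cos (twopi * x)) (sin (twopi * x)).

Let expcD x y : expc (x + y) = expc x * expc y.
Proof. by rewrite /expc mulrDr cosD sinD; apply/eqP; rewrite eq_complex /= eqxx [X in _ == X]addrC eqxx. Qed.

Let expcZ (c : int) : expc c%:~R = 1.
Proof.
have expN (m : nat) : expc m%:R = 1.
  elim: m => [|m IH]; first by rewrite /expc mulr0 cos0 sin0.
  rewrite -natr1 expcD IH mul1r /expc mulr1 mulr_natl.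
  by rewrite cos2pi sin2pi.
case: c => m; first exact: expN.
rewrite NegzE mulrNz; have := expcD (- m.+1%:R) m.+1%:R.
by rewrite addNr -{1}[0]/(0%:R) !expN mulr1.
Qed.

(** Two fractions congruent to x differ by an element of Z[1/p] lying in Z_p, which is an integer by
    [intr_divX], and [expc] is 1 at integers. *)
Lemma padic_charE (x : Qp) (a : int) k : x - a%:~R / pi ^+ k \in pint ->
  padic_char R x = expc (a%:~R / p%:R ^+ k).
Proof.
move=> xa; rewrite /padic_char.
set A := [set ak : int * nat | _].
have Aak : A (a, k) by case/pintP: xa => z zE; exists z; rewrite /= -zE addrC subrK.
have /= := @xgetPex _ (0, 0%N) A (ex_intro _ _ Aak).
case: (xget _ A) => b l /= [z zE].
have dE : (a * P l - b * P k)%:~R / pi ^+ (k + l) \in pint.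
  have -> : (a * P l - b * P k)%:~R / pi ^+ (k + l) = tofrac z - (x - a%:~R / pi ^+ k).
    rewrite rmorphB /= !rmorphM /= -!pmulrn !natrX exprD.
    by apply: frac_subl; rewrite // expf_neq0 ?padic_p_neq0.
  by rewrite rpredB // tofrac_pint.
move: dE; rewrite intr_divX => /dvdzP[c cE].
have pR : p%:R != 0 :> R by rewrite pnatr_eq0 -lt0n prime_gt0.
have : (a * P l - b * P k)%:~R = (c * P (k + l))%:~R :> R by rewrite cE.
rewrite rmorphB /= !rmorphM /= -!pmulrn !natrX exprD => e.
suff -> : a%:~R / p%:R ^+ k = b%:~R / p%:R ^+ l + c%:~R :> R.
  by rewrite expcD expcZ mulr1.
apply: (@mulIf _ (p%:R ^+ k * p%:R ^+ l)); first by rewrite mulf_neq0 ?expf_neq0.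
rewrite mulrDl -e; field.
by rewrite !expf_neq0.
Qed.

Lemma padic_approx_frac (x : Qp) : exists (a : int) k, x - a%:~R / pi ^+ k \in pint.
Proof.
have [k h] := padic_arch x; have [m _ hm] := padic_approx k h.
exists m%:Z, k; move: hm; rewrite -pmulrn mulrBl mulrAC mulfV ?mul1r //.
by rewrite expf_neq0 // padic_p_neq0.
Qed.

Lemma padic_charD (x y : Qp) : padic_char R (x + y) = padic_char R x * padic_char R y.
Proof.
have [a [k ha]] := padic_approx_frac x; have [b [l hb]] := padic_approx_frac y.
rewrite (padic_charE ha) (padic_charE hb) -expcD.
rewrite (@padic_charE _ (a * P l + b * P k) (k + l)).
  have pR : p%:R != 0 :> R by rewrite pnatr_eq0 -lt0n prime_gt0.
  congr expc; rewrite rmorphD /= !rmorphM /= -!pmulrn !natrX exprD.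
  by field; rewrite !expf_neq0.
rewrite rmorphD /= !rmorphM /= -!pmulrn !natrX exprD.
rewrite -frac_addB ?expf_neq0 ?padic_p_neq0 //; exact: rpredD.
Qed.

Lemma padic_char_int (x y : Qp) : x - y \in pint -> padic_char R x = padic_char R y.
Proof.
move=> xy; have [a [k ha]] := padic_approx_frac y.
rewrite (padic_charE ha) (@padic_charE _ a k) //.
by rewrite -(subrK y x) -addrA rpredD.
Qed.

End Character.
End Padic.

(** * Unitriangular matrices and the element [w_star] *)

Lemma ord_gt_eqF m (i j : 'I_m) : (i < j)%N -> (j == i) = false.
Proof. by move=> ij; rewrite -val_eqE /= gtn_eqF. Qed.

Section UnipotentMatrices.
Variables (K : fieldType) (n : nat).
Implicit Types A B : 'M[K]_n.+1.

Definition unitriangular A : Prop :=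
  forall i j : 'I_n.+1, (j <= i)%N -> A i j = (i == j)%:R.

Lemma unitriangular1 : unitriangular 1%:M.
Proof. by move=> i j _; rewrite mxE. Qed.

Lemma unitriangular_det A : unitriangular A -> \det A = 1.
Proof.
move=> uA; rewrite -det_tr det_trig ?big1 // => [i _|].
  by rewrite mxE uA // eqxx.
by apply/is_trig_mxP => i j ij; rewrite mxE uA ?(ltnW ij) // ord_gt_eqF.
Qed.

Lemma unitriangular_unit A : unitriangular A -> A \in unitmx.
Proof. by move=> uA; rewrite unitmxE unitriangular_det // unitr1. Qed.

Lemma unitriangularM A B : unitriangular A -> unitriangular B -> unitriangular (A *m B).
Proof.
move=> uA uB i j ji; rewrite mxE (bigD1 i) //= uA // eqxx mul1r uB //.
rewrite big1 ?addr0 // => k ki; case: (leqP k i) => [ki'|ik].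
  by rewrite uA // eq_sym (negPf ki) mul0r.
by rewrite (uB k j) ?(leq_trans ji (ltnW ik)) // ord_gt_eqF ?mulr0 // (leq_ltn_trans ji).
Qed.

Lemma unitriangularV A : unitriangular A -> unitriangular (invmx A).
Proof.
move=> uA i j; move: {2}(n - i)%N (leqnn (n - i)%N) => d.
elim: d i => [|d IH] i id ji; have := mulmxV (unitriangular_unit uA);
  move=> /matrixP/(_ i j); rewrite !mxE (bigD1 i) //= uA // eqxx mul1r big1 ?addr0 // => k ki;
  (case: (leqP k i) => [ki'|ik]; first by rewrite uA // eq_sym (negPf ki) mul0r).
  by have := ltn_ord k; lia.
by rewrite IH ?ord_gt_eqF ?mulr0 //; have := ltn_ord k; lia.
Qed.

Lemma unitriangular_superdiagM A B (j : 'I_n) : unitriangular A -> unitriangular B ->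
  (A *m B) (widen_ord (leqnSn n) j) (lift ord0 j) =
  A (widen_ord (leqnSn n) j) (lift ord0 j) + B (widen_ord (leqnSn n) j) (lift ord0 j).
Proof.
move=> uA uB; set i := widen_ord _ _; set i' := lift ord0 j.
have ii : i != i' by rewrite -val_eqE /= /bump leq0n; lia.
rewrite mxE (bigD1 i) //= (bigD1 i') 1?eq_sym //= (uA i i) // (uB i' i') // !eqxx mul1r mulr1.
rewrite big1 ?addr0 1?addrC // => k /andP[ki ki'].
case: (leqP k i) => [le|lt]; first by rewrite uA // eq_sym (negPf ki) mul0r.
by rewrite (uB k i') ?(negPf ki') ?mulr0.
Qed.

Lemma unitriangular_tr_eq1 A : unitriangular A -> unitriangular A^T -> A = 1%:M.
Proof.
move=> uA uAT; apply/matrixP => i j; rewrite mxE; case: (leqP j i) => [|/ltnW] ij.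
  exact: uA.
by have := uAT j i ij; rewrite mxE eq_sym.
Qed.

Lemma unitriangular_diag_conj A (d : 'rV[K]_n.+1) : (forall i, d 0 i != 0) ->
  unitriangular A -> exists2 B, unitriangular B & diag_mx d *m A = B *m diag_mx d.
Proof.
move=> d0 uA; exists (\matrix_(i, j) (d 0 i * A i j / d 0 j)).
  move=> i j ji; rewrite mxE uA //; case: eqVneq => [->|_]; last by rewrite mulr0 mul0r.
  by rewrite mulr1 divff.
apply/matrixP => i j; rewrite mul_diag_mx mul_mx_diag !mxE.
by rewrite divfK.
Qed.

Lemma unitriangular_diag_conj_tr A (d : 'rV[K]_n.+1) : (forall i, d 0 i != 0) ->
  unitriangular A^T -> exists2 B, unitriangular B^T & diag_mx d *m A = B *m diag_mx d.
Proof.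
move=> d0 uA; exists (\matrix_(i, j) (d 0 i * A i j / d 0 j)).
  move=> i j ji; rewrite 2!mxE; have := uA i j ji; rewrite mxE => ->.
  case: eqVneq => [->|_]; last by rewrite mulr0 mul0r.
  by rewrite mulr1 divff.
apply/matrixP => i j; rewrite mul_diag_mx mul_mx_diag !mxE.
by rewrite divfK.
Qed.

Lemma sum_ends (F : 'I_n.+1 -> K) : (0 < n)%N ->
  \sum_l F l = F ord0 + \sum_(1 <= l < n) F (inord l) + F ord_max.
Proof.
move=> n0; have FE : forall l : 'I_n.+1, F l = F (inord l) by move=> l; rewrite inord_val.
rewrite (eq_bigr (fun l : 'I_n.+1 => F (inord l))) //.
rewrite -(big_mkord xpredT (fun l => F (inord l))) big_nat_recr //= big_ltn //.
by congr (F _ + _ + F _); apply: val_inj; rewrite /= inordK.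
Qed.

(** Only the values of a and b at 0 < l < n are read, which leaves room for the convention a_0 = 1
    of the row equations. *)
Definition heis (a b : nat -> K) (z : K) : 'M[K]_n.+1 :=
  \matrix_(i, j) ((i == j)%:R + (if (i == 0 :> nat) && (0 < j < n)%N then a j else 0)
    + (if (j == n :> nat) && (0 < i < n)%N then b i else 0)
    + (if (i == 0 :> nat) && (j == n :> nat) then z else 0)).

Hypothesis n_gt0 : (0 < n)%N.

Lemma heis_unitri a b z : unitriangular (heis a b z).
Proof.
move=> i j ji; rewrite mxE !ifN ?addr0 //; have := ltn_ord i; lia.
Qed.

Let nilp (a b : nat -> K) z : 'M[K]_n.+1 :=
  \matrix_(i, j) ((if (i == 0 :> nat) && (0 < j < n)%N then a j else 0)
    + (if (j == n :> nat) && (0 < i < n)%N then b i else 0)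
    + (if (i == 0 :> nat) && (j == n :> nat) then z else 0)).

Let heisE a b z : heis a b z = 1%:M + nilp a b z.
Proof. by apply/matrixP => i j; rewrite !mxE !addrA. Qed.

Let nilpM a b z a' b' z' : nilp a b z *m nilp a' b' z' =
  nilp (fun=> 0) (fun=> 0) (\sum_(1 <= l < n) a l * b' l).
Proof.
apply/matrixP => i j; rewrite [LHS]mxE sum_ends //.
have -> : nilp a b z i ord0 = 0 by rewrite mxE /= !ifN ?addr0 //; lia.
have -> : nilp a' b' z' ord_max j = 0 by rewrite mxE /= !ifN ?addr0 //; lia.
rewrite mul0r mulr0 add0r addr0 mxE !if_same !add0r.
case: ifP => [/andP[i0 jn]|ij].
  apply: eq_big_nat => l ln; rewrite !mxE !inordK; last lia.
  rewrite i0 jn ln /=; have -> : (l == n) = false by lia.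
  have -> : (l == 0%N) = false by lia.
  by rewrite !addr0 add0r.
rewrite big_nat big1 // => l ln; rewrite !mxE !inordK; last lia.
have -> : (l == n) = false by lia.
have -> : (l == 0%N) = false by lia.
rewrite ln andbF /= !addr0 add0r !andbT.
by move: ij; case: eqP => _ /=; case: eqP => _ //=; rewrite ?mulr0 ?mul0r.
Qed.

Lemma heisM a b z a' b' z' : heis a b z *m heis a' b' z' =
  heis (fun l => a l + a' l) (fun l => b l + b' l) (z + (z' + \sum_(1 <= l < n) a l * b' l)).
Proof.
rewrite !heisE mulmxDl !mulmxDr !mul1mx mulmx1 nilpM -addrA; congr (_ + _).
apply/matrixP => i j; rewrite !mxE.
by do 3!case: ifP => _; ring.
Qed.

Lemma heis_eq A : unitriangular A ->
  (forall i j : 'I_n.+1, (0 < i)%N -> (i < j)%N -> (j < n)%N -> A i j = 0) ->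
  A = heis (fun j => A ord0 (inord j)) (fun i => A (inord i) ord_max) (A ord0 ord_max).
Proof.
move=> uA A0; apply/matrixP => i j; rewrite mxE.
have [ji|ij] := leqP j i.
  by rewrite uA // !ifN ?addr0 //; have := ltn_ord i; lia.
rewrite -val_eqE ltn_eqF // add0r !inord_val.
have [i0|i0] := eqVneq (i : nat) 0%N.
  have -> : i = ord0 by apply: val_inj.
  rewrite andbF addr0 /=; have [jn|jn] := eqVneq (j : nat) n.
    rewrite jn ltnn andbF add0r; congr (A _ _); exact: val_inj.
  by rewrite ifT ?addr0 //; have := ltn_ord j; lia.
rewrite /= add0r addr0; have [jn|jn] := eqVneq (j : nat) n.
  have -> : j = ord_max by apply: val_inj.
  by rewrite ifT //; lia.
by rewrite A0 //; have := ltn_ord j; lia.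
Qed.

Lemma heis_inj a b z a' b' z' : heis a b z = heis a' b' z' ->
  [/\ forall l, (0 < l < n)%N -> a l = a' l, forall l, (0 < l < n)%N -> b l = b' l & z = z'].
Proof.
move=> /matrixP h; split.
- move=> l ln; have := h ord0 (inord l); rewrite !mxE -val_eqE /= !inordK; last lia.
  by rewrite ln andbF !ltn_eqF ?addr0 ?add0r //; lia.
- move=> l ln; have := h (inord l) ord_max; rewrite !mxE -val_eqE /= !inordK; last lia.
  have -> : (l == n) = false by lia.
  have -> : (l == 0%N) = false by lia.
  by rewrite ln eqxx !addr0 !add0r.
- have := h ord0 ord_max; rewrite !mxE -val_eqE /= ltnn !eqxx andbF.
  by rewrite ltn_eqF // !addr0 !add0r.
Qed.

End UnipotentMatrices.

(** * The group U_w of w_star *)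

Section SignedPermutation.
Variables (K : fieldType) (n : nat).
Hypothesis n_gt0 : (0 < n)%N.
Local Notation mat := 'M[K]_n.+1.

Definition signed_swap : mat :=
  \matrix_(i, j)
    if (i == ord0) && (j == ord_max) then (-1) ^+ n
    else if (i == ord_max) && (j == ord0) then 1
    else if [&& i == j, i != ord0 & i != ord_max] then -1
    else 0.
Local Notation w := signed_swap.

Definition opp_unip (v : mat) : Prop :=
  unitriangular v /\ exists2 l, unitriangular l^T & invmx w *m l *m w = v.

Definition wsign (i : 'I_n.+1) : K :=
  if i == ord0 then (-1) ^+ n else if i == ord_max then 1 else -1.

Definition wswap (i : 'I_n.+1) : 'I_n.+1 :=
  if i == ord0 then ord_max else if i == ord_max then ord0 else i.

Let maxN0 : (ord_max == ord0 :> 'I_n.+1) = false.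
Proof. by rewrite -val_eqE /= gtn_eqF. Qed.

Lemma wswapK : involutive wswap.
Proof.
move=> i; rewrite /wswap; case: (eqVneq i ord0) => [->|i0]; first by rewrite maxN0 eqxx.
by case: (eqVneq i ord_max) => [->|/negPf im]; rewrite ?eqxx // (negPf i0) im.
Qed.

Lemma wsign2 i : wsign i * wsign i = 1.
Proof.
rewrite /wsign; case: eqP => _; first by rewrite -expr2 sqrr_sign.
by case: eqP => _; rewrite ?mulr1 // mulrNN mulr1.
Qed.

Lemma signed_swapE i j : w i j = wsign i * (j == wswap i)%:R.
Proof.
rewrite mxE /wsign /wswap; case: (eqVneq i ord0) => [->|i0] /=.
  rewrite [ord0 == ord_max]eq_sym maxN0 /= andbF.
  by case: eqVneq => _; rewrite ?mulr1 ?mulr0.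
case: (eqVneq i ord_max) => [->|im] /=.
  by rewrite mul1r andbF; case: eqVneq.
by rewrite andbT eq_sym; case: eqVneq; rewrite ?mulr1 ?mulr0.
Qed.

Lemma mul_signed_swap (v : mat) i j : (w *m v) i j = wsign i * v (wswap i) j.
Proof.
rewrite mxE (bigD1 (wswap i)) //= big1 ?addr0 => [|k ki].
  by rewrite signed_swapE eqxx mulr1.
by rewrite signed_swapE (negPf ki) mulr0 mul0r.
Qed.

Lemma mul_mx_signed_swap (v : mat) i j : (v *m w) i j = v i (wswap j) * wsign (wswap j).
Proof.
rewrite mxE (bigD1 (wswap j)) //= big1 ?addr0 => [|k ki].
  by rewrite signed_swapE wswapK eqxx mulr1.
rewrite signed_swapE; case: eqVneq => [jk|_]; last by rewrite !mulr0.
by rewrite jk wswapK eqxx in ki.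
Qed.

Lemma signed_swap_tr : w *m w^T = 1%:M.
Proof.
apply/matrixP => i j; rewrite mul_signed_swap [w^T _ _]mxE signed_swapE [RHS]mxE.
rewrite (can_eq wswapK) eq_sym; case: eqVneq => [->|_]; last by rewrite !mulr0.
by rewrite mulr1 wsign2.
Qed.

Lemma signed_swap_unit : w \in unitmx.
Proof. exact: (mulmx1_unit signed_swap_tr).1. Qed.

Lemma signed_swap_det : \det w = 1 \/ \det w = -1.
Proof.
have := congr1 determinant signed_swap_tr; rewrite det_mulmx det_tr det1 => /eqP.
by rewrite -expr2 sqrf_eq1 => /orP[] /eqP ->; [left | right].
Qed.

(** Conjugation by w_star exchanges the first and the last index and fixes the others, up to signs.
    Hence the middle block of v has to be both upper and lower triangular, while the first row and
    the last column are free. *)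
Lemma opp_unipP (v : mat) : opp_unip v <-> unitriangular v /\
  (forall i j : 'I_n.+1, (0 < i)%N -> (i < j)%N -> (j < n)%N -> v i j = 0).
Proof.
split=> [[uv [l ll vE]]|[uv v0]].
  split=> // i j i0 ij jn.
  have wv : w *m v = l *m w by rewrite -vE !mulmxA mulmxV ?signed_swap_unit // mul1mx.
  have fix_ (k : 'I_n.+1) : (0 < k)%N -> (k < n)%N -> wswap k = k.
    by move=> k0 kn; rewrite /wswap -!val_eqE /= gtn_eqF // ltn_eqF.
  have := congr1 (fun A : mat => A i j) wv; rewrite mul_signed_swap mul_mx_signed_swap.
  rewrite !fix_ //; try lia.
  have -> : l i j = 0.
    by have := ll j i (ltnW ij); rewrite mxE ord_gt_eqF.
  rewrite mul0r => /eqP; rewrite mulf_eq0 => /orP[/eqP s0|/eqP//].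
  by have /eqP := wsign2 i; rewrite s0 mul0r eq_sym oner_eq0.
split=> //; exists (w *m v *m w^T); last first.
  have wV : invmx w = w^T by rewrite -[RHS]mul1mx -(mulVmx signed_swap_unit) -mulmxA signed_swap_tr mulmx1.
  rewrite wV !mulmxA; have wTw : w^T *m w = 1%:M by rewrite -wV mulVmx ?signed_swap_unit.
  by rewrite wTw mul1mx -mulmxA wTw mulmx1.
move=> i j ji; rewrite mxE.
have -> : (w *m v *m w^T) j i = wsign j * wsign i * v (wswap j) (wswap i).
  have := mul_mx_signed_swap (w *m v *m w^T) j (wswap i); rewrite -mulmxA.
  have -> : w^T *m w = 1%:M by apply/mulmx1C/signed_swap_tr.
  rewrite mulmx1 mul_signed_swap wswapK => h.
  by rewrite mulrAC h -mulrA wsign2 mulr1.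
have [le|lt] := leqP (wswap i) (wswap j).
  rewrite uv // (can_eq wswapK) eq_sym; case: eqVneq => [->|_]; last by rewrite mulr0.
  by rewrite mulr1 wsign2.
suff [i0 [ij jn]] : (0 < wswap j)%N /\ (wswap i < n)%N /\ j != i.
  by rewrite v0 // mulr0 eq_sym (negPf jn).
move: ji lt; rewrite /wswap; case: (eqVneq i ord0) => [->|i0].
  rewrite leqn0 => /eqP j0; have -> : j = ord0 by apply: val_inj.
  by rewrite eqxx ltnn.
case: (eqVneq i ord_max) => [->//|im].
case: (eqVneq j ord0) => [->|j0] /=; first by have := ltn_ord i; lia.
have ineq : (i < n)%N.
  by rewrite ltn_neqAle -ltnS ltn_ord andbT; move: im; rewrite -val_eqE.
case: (eqVneq j ord_max) => [->|jm] /=; first by lia.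
have jpos : (0 < j)%N by rewrite lt0n.
by move=> _ lt; split => //; split => //; rewrite -val_eqE ltn_eqF.
Qed.

Lemma heis_opp_unip a b z : opp_unip (heis n a b z : mat).
Proof.
apply/opp_unipP; split; first exact: heis_unitri.
move=> i j i0 ij jn; rewrite mxE -val_eqE ltn_eqF // !ifN ?addr0 //; lia.
Qed.

Lemma opp_unip_heis (v : mat) : opp_unip v ->
  v = heis n (fun j => v ord0 (inord j)) (fun i => v (inord i) ord_max) (v ord0 ord_max).
Proof. by case/opp_unipP => uv v0; exact: heis_eq. Qed.

(** The factor vb is the middle block of v. It commutes with w_star, which acts there as the scalar
    -1. *)
Lemma unitriangular_split (v : mat) : unitriangular v ->
  exists vb h, [/\ unitriangular vb, opp_unip h, v = vb *m h & w *m vb = vb *m w].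
Proof.
move=> uv; pose vb : mat := \matrix_(i, j)
  if (0 < i)%N && (j < n)%N then v i j else (i == j)%:R.
have uvb : unitriangular vb by move=> i j ji; rewrite mxE uv // if_same.
have vbu := unitriangular_unit uvb.
exists vb, (invmx vb *m v); split => //.
- apply/opp_unipP; split; first exact: unitriangularM (unitriangularV uvb) uv.
  move=> i j i0 ij jn.
  have -> : (invmx vb *m v) i j = (invmx vb *m vb) i j.
    rewrite !mxE; apply: eq_bigr => k _; have [k0|k0] := posnP k.
      by rewrite (unitriangularV uvb) ?ord_gt_eqF ?mul0r ?k0 // eq_sym ord_gt_eqF ?k0 // !mul0r.
    by rewrite [vb k j]mxE k0 jn.
  by rewrite mulVmx // mxE eq_sym ord_gt_eqF.
- by rewrite mulKVmx.
apply/matrixP => i j; rewrite mul_signed_swap mul_mx_signed_swap.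
have vb0 k : vb ord0 k = (ord0 == k)%:R by rewrite mxE.
have vbn k : vb ord_max k = (ord_max == k)%:R by rewrite uvb // -ltnS ltn_ord.
have v0b k : vb k ord0 = (k == ord0)%:R by rewrite uvb.
have vnb k : vb k ord_max = (k == ord_max)%:R by rewrite mxE ltnn andbF.
have swap0 : wswap ord0 = ord_max by rewrite /wswap eqxx.
have swapn : wswap ord_max = ord0 by rewrite /wswap maxN0 eqxx.
case: (eqVneq i ord0) => [->|i0].
  rewrite swap0 vbn vb0 -[ord0 in RHS]swapn (can_eq wswapK); case: eqVneq => [<-|_].
    by rewrite swapn mulrC.
  by rewrite mulr0 mul0r.
case: (eqVneq i ord_max) => [->|im].
  rewrite swapn vbn vb0 -[in RHS]swap0 (can_eq wswapK); case: eqVneq => [<-|_].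
    by rewrite swap0 mulrC.
  by rewrite mulr0 mul0r.
have ii : wswap i = i by rewrite /wswap (negPf i0) (negPf im).
rewrite ii; case: (eqVneq j ord0) => [->|j0].
  by rewrite swap0 v0b vnb (negPf i0) (negPf im) mulr0 mul0r.
case: (eqVneq j ord_max) => [->|jm].
  by rewrite swapn v0b vnb (negPf i0) (negPf im) mulr0 mul0r.
have jj : wswap j = j by rewrite /wswap (negPf j0) (negPf jm).
by rewrite jj /wsign (negPf i0) (negPf im) (negPf j0) (negPf jm) mulrC.
Qed.

Lemma opp_unip1 : opp_unip (1%:M : mat).
Proof.
split; first exact: unitriangular1.
exists 1%:M; first by rewrite trmx1; exact: unitriangular1.
by rewrite mulmx1 mulVmx // signed_swap_unit.
Qed.

Lemma opp_unipM (v v' : mat) : opp_unip v -> opp_unip v' -> opp_unip (v *m v').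
Proof.
move=> [uv [l ll lE]] [uv' [l' ll' lE']]; split; first exact: unitriangularM.
exists (l *m l'); first by rewrite trmx_mul; exact: unitriangularM.
by rewrite -lE -lE' !mulmxA mulmxK // signed_swap_unit.
Qed.

Lemma opp_unipV (v : mat) : opp_unip v -> opp_unip (invmx v).
Proof.
move=> [uv [l ll lE]]; split; first exact: unitriangularV.
exists (invmx l); first by rewrite trmx_inv; exact: unitriangularV.
have lu : l \in unitmx by rewrite -unitmx_tr; exact: unitriangular_unit.
have e : v *m (invmx w *m invmx l *m w) = 1%:M.
  by rewrite -lE !mulmxA (mulmxK signed_swap_unit) (mulmxK lu) (mulVmx signed_swap_unit).
by rewrite -[RHS]mulmx1 -e (mulKmx (unitriangular_unit uv)).
Qed.

End SignedPermutation.

(** * Integrality of u N u' in terms of the row equations *)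

Section BruhatRows.
Variables (K : fieldType) (O : subringClosed K) (p : K) (n : nat) (r : nat -> nat).
Hypotheses (p_neq0 : p != 0) (n_gt0 : (0 < n)%N) (r0 : r 0 = 0%N) (rn1 : r n.+1 = 0%N).
Local Notation mat := 'M[K]_n.+1.
Local Notation tau k := (p ^+ r k / p ^+ r k.+1).

Definition torus_row : 'rV[K]_n.+1 := \row_i tau i.
Local Notation N := (diag_mx torus_row *m signed_swap K n).

Let tau0 k : tau k != 0.
Proof. by rewrite mulf_neq0 ?invr_eq0 ?expf_neq0. Qed.

Let taun : tau n = p ^+ r n.
Proof. by rewrite rn1 expr0 divr1. Qed.

Lemma mul_N_heis (u : mat) a b z (X := u *m N *m heis n a b z) i :
  [/\ X i ord0 = u i ord_max * p ^+ r n,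
      forall j, (0 < j < n)%N -> X i (inord j) =
        u i ord_max * p ^+ r n * a j - u i (inord j) * tau j &
      X i ord_max = u i ord0 * tau 0 * (-1) ^+ n
        - \sum_(1 <= l < n) u i (inord l) * tau l * b l + u i ord_max * p ^+ r n * z].
Proof.
have XE j : X i j = u i ord0 * tau 0 * (-1) ^+ n * heis n a b z ord_max j
   - \sum_(1 <= l < n) u i (inord l) * tau l * heis n a b z (inord l) j
   + u i ord_max * p ^+ r n * heis n a b z ord0 j.
  have -> : X i j = \sum_l u i l * (tau l * (wsign K l * heis n a b z (wswap l) j)).
    rewrite /X -!mulmxA mxE; apply: eq_bigr => l _.
    by rewrite mul_diag_mx mxE mul_signed_swap // mxE.
  rewrite sum_ends // /wsign /wswap eqxx.
  have -> : (ord_max == ord0 :> 'I_n.+1) = false by rewrite -val_eqE /= gtn_eqF.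
  rewrite eqxx taun mul1r; congr (_ + _ + _); last by rewrite mulrA.
    by rewrite !mulrA.
  rewrite -sumrN; apply: eq_big_nat => l ln.
  have lE : (inord l : 'I_n.+1) = l :> nat by rewrite inordK; lia.
  rewrite -!val_eqE /= lE; have -> : (l == 0%N) = false by lia.
  have -> : (l == n) = false by lia.
  by rewrite mulN1r mulrN mulrN mulrA.
split.
- have n0 : (n == 0%N) = false by lia.
  have n0' : (0%N == n) = false by lia.
  rewrite XE; have -> : heis n a b z ord_max ord0 = 0.
    by rewrite mxE -val_eqE /= ltnn !andbF n0 n0' !addr0.
  have -> : heis n a b z ord0 ord0 = 1.
    by rewrite mxE eqxx /= n0' !addr0.
  rewrite mulr0 mulr1 big_nat big1 ?oppr0 ?add0r ?subr0 // => l ln.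
  have lE : (inord l : 'I_n.+1) = l :> nat by rewrite inordK; lia.
  rewrite mxE -val_eqE /= lE n0' !andbF /=.
  have -> : (l == 0%N) = false by lia.
  by rewrite !addr0 mulr0.
- move=> j jn; rewrite XE.
  have jE : (inord j : 'I_n.+1) = j :> nat by rewrite inordK; lia.
  have j0 : (j == 0%N) = false by lia.
  have jn' : (j == n) = false by lia.
  have -> : heis n a b z ord_max (inord j) = 0.
    rewrite mxE -val_eqE /= jE ltnn andbF jn' eq_sym jn' !ifN ?addr0 //; lia.
  have -> : heis n a b z ord0 (inord j) = a j.
    by rewrite mxE -val_eqE /= jE jn' jn eq_sym j0 !addr0 add0r.
  rewrite mulr0 add0r addrC; congr (_ - _).
  rewrite (@big_cat_nat _ _ _ j 1 n) //=; try lia.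
  rewrite [Y in _ + Y]big_ltn; last lia.
  have mid l : (0 < l < n)%N -> heis n a b z (inord l) (inord j) = (l == j)%:R.
    move=> ln; rewrite mxE -val_eqE /= !inordK ?jn'; try lia.
    have -> : (l == 0%N) = false by lia.
    by rewrite /= !addr0.
  rewrite big_nat big1 ?add0r => [|l lj]; last first.
    by rewrite mid ?ltn_eqF ?mulr0 //; lia.
  rewrite big_nat big1 ?addr0 => [|l lj]; last first.
    by rewrite mid ?gtn_eqF ?mulr0 //; lia.
  by rewrite mid // eqxx mulr1.
- rewrite XE; have -> : heis n a b z ord_max ord_max = 1.
    by rewrite mxE eqxx /= ltnn andbF eqxx !ifN ?addr0 //; lia.
  have -> : heis n a b z ord0 ord_max = z.
    by rewrite mxE /= -val_eqE /= ltnn !eqxx andbF ltn_eqF // !addr0 add0r.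
  rewrite mulr1; congr (_ - _ + _); apply: eq_big_nat => l ln.
  congr (_ * _); rewrite mxE -val_eqE /= inordK; last lia.
  by rewrite ltnn andbF eqxx ln ltn_eqF ?gtn_eqF ?addr0 ?add0r //; lia.
Qed.

Lemma unitriangular_inord (u : mat) (i : 'I_n.+1) j : unitriangular u -> (j < i)%N -> u i (inord j) = 0.
Proof.
move=> uu ji; have jE : (inord j : 'I_n.+1) = j :> nat.
  by rewrite inordK // (ltn_trans ji).
by rewrite uu ?jE ?(ltnW ji) // ord_gt_eqF // jE.
Qed.

Lemma rows_of_integral (u : mat) a b z (X := u *m N *m heis n a b z) :
  unitriangular u -> a 0%N = 1 -> (forall i j, X i j \in O) ->
  [/\ rown_sys O p n r a z,
      forall i, (0 < i < n)%N -> exists la g, row_sys O p n r a b z i la g &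
      exists la g, row0_sys O p n r a b z la g].
Proof.
move=> uu a0 XO; have rowX := mul_N_heis u a b z; cbv zeta in rowX; fold X in rowX.
(* The equations of the middle columns eliminate the entries of u from the last column; the terms la
   a_l b_l combine with la z to the tail Z. *)
have last_col i (la := u i ord_max * p ^+ r n) (m : nat) : (0 < m <= n)%N -> 
    \sum_(m <= l < n) u i (inord l) * tau l * b l = 
    la * (\sum_(m <= l < n) a l * b l) - \sum_(m <= l < n) X i (inord l) * b l.
  move=> mn; rewrite mulr_sumr -sumrB; apply: eq_big_nat => l lm.
  have [_ /(_ l ltac:(lia)) h _] := rowX i.
  by rewrite h /la; ring.
split.
- have [h0 hj hn] := rowX ord_max; have umax := uu ord_max ord_max (leqnn _).
  rewrite eqxx in umax; split.
    move=> j jn; have [->|j0] := posnP j.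
      by have := XO ord_max ord0; rewrite h0 umax mul1r a0 mulr1.
    have := XO ord_max (inord j); rewrite hj ?umax; last lia.
    by rewrite unitriangular_inord // mul0r mul1r subr0.
  have := XO ord_max ord_max; rewrite hn umax mul1r.
  rewrite (uu ord_max ord0) // ord_gt_eqF // !mul0r big_nat big1 ?subr0 ?add0r // => l ln.
  by rewrite unitriangular_inord ?mul0r //; case/andP: ln.
- move=> i iN; pose io : 'I_n.+1 := inord i; have iE : io = i :> nat by rewrite inordK; lia.
  have [h0 hj hn] := rowX io.
  exists (u io ord_max * p ^+ r n), (fun l => X io (inord l)); split.
  + by move=> l _; exact: XO.
  + move=> j ji; have [->|j0] := posnP j.
      by have := XO io ord0; rewrite h0 a0 mulr1.
    have := XO io (inord j); rewrite hj; last lia.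
    by rewrite unitriangular_inord ?iE // mul0r subr0.
  + have := XO io (inord i); rewrite -rpredN hj; last lia.
    by rewrite -/io (uu io io) // eqxx mul1r opprB.
  + set y := (Y in Y \in O); suff -> : y = X io ord_max by exact: XO.
    apply: esym; rewrite /y hn.
    have -> : u io ord0 = 0.
      by rewrite (uu io ord0) // ord_gt_eqF // iE; case/andP: iN.
    rewrite !mul0r (@big_cat_nat _ _ _ i 1 n) //=; try lia.
    rewrite [Y in _ - (_ + Y) + _]big_ltn; last lia.
    rewrite [Y in _ - (Y + _) + _]big_nat big1 ?add0r; last first.
      by move=> l ln; rewrite unitriangular_inord ?mul0r // iE; case/andP: ln.
    rewrite last_col; last lia.
    rewrite -/io (uu io io) // eqxx mul1r /tailz; ring.
- have [h0 hj hn] := rowX ord0.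
  exists (u ord0 ord_max * p ^+ r n), (fun l => X ord0 (inord l)); split.
  + by rewrite -h0.
  + by move=> l _; exact: XO.
  + set y := (Y in Y \in O); suff -> : y = X ord0 ord_max by exact: XO.
    apply: esym; rewrite /y hn.
    rewrite last_col // (uu ord0 ord0) // eqxx mulr1n /tailz r0 expr0; ring.
Qed.

Lemma integral_of_rows a b z (la : nat -> K) (g : nat -> nat -> K) :
  rown_sys O p n r a z -> a 0%N = 1 -> p ^+ r n \in O ->
  (forall i, (0 < i < n)%N -> row_sys O p n r a b z i (la i) (g i)) ->
  row0_sys O p n r a b z (la 0%N) (g 0%N) ->
  exists u : mat, [/\ unitriangular u,
     forall i j, (u *m N *m heis n a b z) i j \in O,
     forall i, (i.+1 < n)%N ->
       u (inord i) (inord i.+1) = p ^+ r i.+2 / p ^+ r i.+1 * (la i * a i.+1 - g i i.+1) &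
     u (inord n.-1) ord_max = la n.-1 / p ^+ r n].
Proof.
move=> [hna hnz] a0 rnO hi h0.
(* The formulas of [mul_N_heis] solved for u, with la i prescribed in column 0 and g i l in column l
   > i. *)
pose u : mat := \matrix_(i, j) if (j <= i)%N then (i == j)%:R
   else if (j < n)%N then (la i * a j - g i j) / tau j else la i / p ^+ r n.
have uu : unitriangular u by move=> i j ji; rewrite mxE ji.
have pn0 : p ^+ r n != 0 by rewrite expf_neq0.
have uM (i : 'I_n.+1) : (i < n)%N -> u i ord_max * p ^+ r n = la i.
  by move=> iN; rewrite mxE leqNgt iN ltnn divfK.
have uL (i : 'I_n.+1) l : (i < l < n)%N -> u i (inord l) * tau l = la i * a l - g i l.
  move=> lN; rewrite mxE inordK; last lia.
  have -> : (l <= i)%N = false by lia.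
  have -> : (l < n)%N by lia.
  by rewrite divfK.
exists u; split => //; last first.
- have := uM (inord n.-1); rewrite inordK; last lia.
  by move=> <-; [rewrite mulfK | lia].
- move=> i iN; have := uL (inord i) i.+1; rewrite inordK; last lia.
  move=> h; rewrite -h; last lia.
  by field; rewrite !expf_neq0.
have last_col (i : 'I_n.+1) (m : nat) : (i < m <= n)%N -> 
    \sum_(m <= l < n) u i (inord l) * tau l * b l = 
    la i * (\sum_(m <= l < n) a l * b l) - \sum_(m <= l < n) g i l * b l.
  move=> mn; rewrite mulr_sumr -sumrB; apply: eq_big_nat => l lm.
  by rewrite uL; [ring | lia].
move=> i j; have [e0 ej en] := mul_N_heis u a b z i.
set X := _ *m _ *m _ in e0 ej en *.
have jcases : [\/ j = ord0, j = ord_max | (0 < j < n)%N].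
  case: (eqVneq j ord0) => [->|j0]; first by constructor 1.
  case: (eqVneq j ord_max) => [->|jm]; first by constructor 2.
  constructor 3; move: j0 jm; rewrite -!val_eqE /=; have := ltn_ord j; lia.
have [iN|] := ltnP i n; last first.
  move=> ni; have iE : i = ord_max by apply: val_inj => /=; have := ltn_ord i; lia.
  have umax : u i ord_max = 1 by rewrite iE uu // eqxx.
  case: jcases => [->|->|jn].
  - by rewrite e0 umax mul1r.
  - rewrite en umax mul1r (uu i ord0) ?iE // ord_gt_eqF // !mul0r big_nat big1 ?subr0 ?add0r // => l ln.
    by rewrite unitriangular_inord ?mul0r //; case/andP: ln.
  - rewrite -(inord_val j) ej // umax mul1r unitriangular_inord ?iE //=; last lia.
    by rewrite mul0r subr0 hna //; lia.
have [i0|ipos] := posnP i.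
  have iE : i = ord0 by apply: val_inj.
  have [laO gO h] := h0; case: jcases => [->|->|jn].
  - by rewrite e0 uM // i0.
  - set c := X i ord_max; set y := (Y in Y \in O) in h; suff -> : c = y by exact: h.
    apply: esym; rewrite /c en /y uM // last_col ?i0 //.
    by rewrite iE (uu ord0 ord0) // eqxx mulr1n /tailz r0 expr0; ring.
  - rewrite -(inord_val j) ej // uM // uL ?i0 //.
    by rewrite opprB addrC subrK gO.
have [gO laO h1 h2] := hi i ltac:(lia).
case: jcases => [->|->|jn].
- by rewrite e0 uM //; have := laO 0%N ipos; rewrite a0 mulr1.
- set c := X i ord_max; set y := (Y in Y \in O) in h2; suff -> : c = y by exact: h2.
    apply: esym; rewrite /c en /y uM //.
  rewrite (uu i ord0) // ord_gt_eqF // !mul0r (@big_cat_nat _ _ _ i 1 n) //=; try lia.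
  rewrite [Y in _ - (_ + Y) + _]big_ltn; last lia.
  have -> : \sum_(1 <= l < i) u i (inord l) * tau l * b l = 0.
    by rewrite big_nat big1 // => l ln; rewrite unitriangular_inord ?mul0r //; case/andP: ln.
  rewrite add0r.
  rewrite last_col ?inord_val; last lia.
  rewrite (uu i i) // eqxx mulr1n /tailz; ring.
rewrite -(inord_val j) ej // uM //.
case: (ltngtP i j) => ij.
- by rewrite uL ?opprB ?[_ + (_ - _)]addrC ?subrK ?gO //; lia.
- by rewrite unitriangular_inord // mul0r subr0 laO.
- have ijE : j = i by apply: val_inj.
  by rewrite ijE inord_val (uu i i) // eqxx mul1r -opprB rpredN.
Qed.

Lemma det_N : \det N = 1 \/ \det N = -1.
Proof.
rewrite det_mulmx det_diag.
have -> : \prod_(i < n.+1) torus_row 0 i = 1.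
  rewrite (eq_bigr (fun i : 'I_n.+1 => tau i)) => [|i _]; last by rewrite mxE.
  have h m : \prod_(i < m) tau i = (p ^+ r m)^-1.
    elim: m => [|m IH]; first by rewrite big_ord0 r0 expr0 invr1.
    by rewrite big_ord_recr /= IH mulrA mulVf ?mul1r // expf_neq0.
  by rewrite h rn1 expr0 invr1.
by rewrite mul1r; exact: signed_swap_det.
Qed.

Lemma det_bruhat (u v : mat) : unitriangular u -> unitriangular v ->
  \det (u *m N *m v) = 1 \/ \det (u *m N *m v) = -1.
Proof.
move=> uu uv; rewrite det_mulmx [\det (u *m N)]det_mulmx (unitriangular_det uu) (unitriangular_det uv) mul1r mulr1.
exact: det_N.
Qed.

Let torus_neq0 i : torus_row 0 i != 0.
Proof. by rewrite mxE. Qed.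

Let diag_unit : diag_mx torus_row \in unitmx.
Proof.
rewrite unitmxE det_diag unitfE; apply/prodf_neq0 => i _; exact: torus_neq0.
Qed.

(** Moving the lower unitriangular matrices behind v and v' across the torus shows that the quotient
    of u and u' is lower as well as upper unitriangular, hence 1. *)
Lemma bruhat_unique (u u' v v' : mat) :
  unitriangular u -> unitriangular u' -> opp_unip v -> opp_unip v' ->
  u *m N *m v = u' *m N *m v' -> u = u' /\ v = v'.
Proof.
move=> uu uu' [uv [l ll lE]] [uv' [l' ll' lE']].
have wu := signed_swap_unit K n_gt0.
move=> e0; suff uE : u = u'.
  split => //; move: e0; rewrite uE.
  apply: (can_inj (mulKmx _)); rewrite !unitmx_mul diag_unit wu andbT.
  by rewrite unitriangular_unit.
move: e0; rewrite -lE -lE' !mulmxA => e.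
have {e} : u *m (diag_mx torus_row *m l) = u' *m (diag_mx torus_row *m l').
  have := congr1 (fun A => A *m invmx (signed_swap K n)) e.
  by rewrite !mulmxK // !mulmxA.
have [m um ->] := unitriangular_diag_conj_tr torus_neq0 ll.
have [m' um' ->] := unitriangular_diag_conj_tr torus_neq0 ll'.
rewrite !mulmxA => /(congr1 (fun A => A *m invmx (diag_mx torus_row))).
rewrite !mulmxK // => e.
have mu : m' \in unitmx by rewrite -unitmx_tr unitriangular_unit.
have e1 : invmx u' *m u = m' *m invmx m.
  have mu0 : m \in unitmx by rewrite -unitmx_tr unitriangular_unit.
  have -> : u = u' *m m' *m invmx m by rewrite -e mulmxK.
  by rewrite !mulmxA mulVmx ?mul1mx // unitriangular_unit.
have e2 : invmx u' *m u = 1%:M.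
  apply: unitriangular_tr_eq1.
    exact: unitriangularM (unitriangularV uu') uu.
  rewrite e1 trmx_mul trmx_inv; exact: unitriangularM (unitriangularV um) um'.
by rewrite -[RHS]mulmx1 -e2 mulmxA mulmxV ?mul1mx // unitriangular_unit.
Qed.

(** The middle block of v passes w_star unchanged and the torus up to conjugation, so that u absorbs
    it. This reduces the right factor from U to U_w. *)
Lemma bruhat_refine (u v : mat) : unitriangular u -> unitriangular v ->
  exists u' h, [/\ unitriangular u', opp_unip h & u *m N *m v = u' *m N *m h].
Proof.
move=> uu uv; have [vb [h [uvb oh -> wvb]]] := unitriangular_split n_gt0 uv.
have [B uB BE] := unitriangular_diag_conj torus_neq0 uvb.
exists (u *m B), h; split => //; first exact: unitriangularM.
by rewrite !mulmxA -[u *m _ *m _ *m vb]mulmxA wvb !mulmxA -[u *m _ *m vb]mulmxA BE !mulmxA.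
Qed.

End BruhatRows.

(** * Parametrization of the cells *)

Section Parametrization.
Variables (K : fieldType) (O : subringClosed K) (p : K).
Hypotheses (p_neq0 : p != 0) (pO : p \in O) (pVO : p^-1 \notin O).
Hypothesis O_local : forall x, x \in O -> x / p \in O \/ x^-1 \in O.
Variable n : nat.

(** The exponents be measure max(1, |a_j|), which an integral perturbation of a does not change; so
    they are invariants of the double coset. *)
Lemma adapted_be_le be mu be' mu' a a' k :
  be 0 = 0%N -> (forall k, (k < n)%N -> be k.+1 = (be k + mu k)%N) ->
  be' 0 = 0%N -> (forall k, (k < n)%N -> be' k.+1 = (be' k + mu' k)%N) ->
  a 0%N = 1 ->
  adapted O p n be mu a -> adapted O p n be' mu' a' ->
  (forall l, (l < n)%N -> a' l - a l \in O) -> (0 < k <= n)%N -> (be k <= be' k)%N.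
Proof.
move=> be0 beS be'0 be'S a0 ad ad' aa kn.
have [j jk ju] := adapted_unit p_neq0 pO pVO be0 beS ad a0 kn.
rewrite leqNgt; apply/negP => lt.
have jO := adapted_int p_neq0 pO pVO be'0 be'S (j := j) (k := k) ad' ltac:(lia).
case/negP: ju; apply: (exp_divp_lt p_neq0 pO lt).
have -> : p ^+ be' k * a j = p ^+ be' k * a' j - p ^+ be' k * (a' j - a j) by ring.
by rewrite rpredB // rpredM ?rpredX // aa //; lia.
Qed.

Variables (r be mu al nu : nat -> nat).
Hypotheses (n_gt1 : (1 < n)%N) (be0 : be 0 = 0%N)
  (beS : forall k, (k < n)%N -> be k.+1 = (be k + mu k)%N)
  (alS : forall k, (0 < k <= n)%N -> al k = (al k.+1 + nu k)%N) (aln : al n.+1 = 0%N)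
  (rE : forall k, (0 < k <= n)%N -> r k = (al k + be k)%N)
  (r0 : r 0 = 0%N) (rn1 : r n.+1 = 0%N) (mu0 : mu 0 = 0%N).

(* Compensates the entries (-1)^n and -1 of w_star, which the formula for the
   partial sums does not show.                                                *)
Definition swap_sign k : K := (-1) ^+ (n.-1 - k).
Local Notation eps := swap_sign.

Lemma swap_sign2 k : eps k * eps k = 1.
Proof. by rewrite /eps -expr2 sqrr_sign. Qed.

(** Here q_k and t_k stand for representatives of c_(k+1)n and c_1k. *)
Definition param (q t a b : nat -> K) z : Prop :=
  [/\ a 0%N = 1, forall k, (0 < k < n)%N -> a k = q k / p ^+ be k.+1,
      z = t n / p ^+ r n &
      forall k, (0 < k < n)%N -> bcoord p n mu al a b z k = eps k * t k].

Lemma param_exists q t : exists a b z, param q t a b z.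
Proof.
pose a k : K := if k is 0 then 1 else q k / p ^+ be k.+1.
have [b bE] := bcoord_surj p_neq0 pO pVO be0 aln a mu0 (t n / p ^+ r n) (fun k => eps k * t k).
by exists a, b, (t n / p ^+ r n); split => // -[|k].
Qed.

Variables (q t a b : nat -> K) (z : K).
Hypothesis prm : param q t a b z.
Hypotheses (qO : forall k, (0 < k < n)%N -> q k \in O)
  (qU : forall k, (0 < k < n)%N -> (0 < mu k)%N -> q k != 0 /\ (q k)^-1 \in O)
  (tO : forall k, (0 < k <= n)%N -> t k \in O)
  (tU : forall k, (0 < k <= n)%N -> (0 < nu k)%N -> t k != 0 /\ (t k)^-1 \in O).
Let qb k : K := if mu k == 0%N then 0 else (q k)^-1.
Let tb k : K := if nu k == 0%N then 0 else (t k)^-1.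

Lemma adapted_of_param : adapted O p n be mu a.
Proof.
case: prm => a0 aE _ _.
exact: (@param_adapted _ O p p_neq0 pO pVO n be mu be0 beS al aln a q qO qU a0 mu0 aE).
Qed.

Lemma param_bE k : (0 < k < n)%N ->
  b k = tailz n a b z k.+1 * qb k * p ^+ be k.+1 + eps k * t k * p ^+ mu k / p ^+ al k.
Proof.
case: prm => a0 aE _ bE kn; rewrite -(bE _ kn) /bcoord.
have -> : ainv mu a k = qb k * p ^+ be k.+1.
  rewrite /ainv /qb; case: eqP => [|_]; first by rewrite mul0r.
  by rewrite aE // invf_div mulrC.
by field; rewrite !expf_neq0.
Qed.

Lemma superdiag_of_param : a 1%N = q 1%N / p ^+ mu 1 /\
  b n.-1 = t n * qb n.-1 / p ^+ nu n + t n.-1 * p ^+ mu n.-1 / (p ^+ nu n.-1 * p ^+ nu n).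
Proof.
case: prm => a0 aE zE _; split.
  rewrite aE //; congr (_ / p ^+ _).
  by rewrite !beS ?be0 ?mu0 //; lia.
rewrite param_bE; last lia.
rewrite tailz_ge; last lia.
have nE : n.-1.+1 = n by lia.
rewrite nE zE rE; last lia.
have alE : al n = nu n.
  have := alS (k := n) ltac:(lia); rewrite aln; lia.
have -> : al n.-1 = (nu n + nu n.-1)%N.
  have := alS (k := n.-1) ltac:(lia); rewrite nE alE; lia.
rewrite alE.
rewrite /eps subnn expr0 mul1r !exprD.
by field; rewrite !expf_neq0.
Qed.

Lemma param_integral : exists u : 'M[K]_n.+1, [/\ unitriangular u,
  forall i j, (u *m (diag_mx (torus_row p n r) *m signed_swap K n) *m heis n a b z) i j \in O,
  u (inord 0) (inord 1) = tb 1 / p ^+ nu 1 &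
  forall k, (1 < k <= n)%N -> u (inord k.-1) (inord k) =
    t k.-1 * tb k / p ^+ nu k
    + (if (k < n)%N then q k else 1) * qb k.-1 * p ^+ nu k.-1 / (p ^+ mu k.-1 * p ^+ nu k)].
Proof.
case: (prm) => a0 aE zE _.
have epsO k : eps k \in O by rewrite rpredX // rpredN rpred1.
have [la0 [g0 [h0 h0E]]] := param_row0 p_neq0 pO pVO be0 beS alS aln rE swap_sign2 epsO
  qO qU tU a0 mu0 aE zE param_bE n_gt1.
have hi i (iN : (0 < i < n)%N) := param_rowi p_neq0 pO pVO be0 beS alS aln rE swap_sign2 epsO
  qO qU tO tU a0 mu0 aE zE param_bE iN.
have hn : rown_sys O p n r a z.
  by apply: (@param_rown _ O p p_neq0 pO pVO n r be mu be0 beS al aln rE a q t z) => //; lia.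
have [lag lagE] : exists lag : nat -> K * (nat -> K), forall i, (0 < i < n)%N ->
    row_sys O p n r a b z i (lag i).1 (lag i).2 /\
    if (i.+1 < n)%N then
      p ^+ r i.+2 / p ^+ r i.+1 * ((lag i).1 * a i.+1 - (lag i).2 i.+1) =
      q i.+1 * qb i * p ^+ nu i / (p ^+ mu i * p ^+ nu i.+1)
      - eps i * eps i.+1 * t i * tb i.+1 / p ^+ nu i.+1
    else (lag i).1 / p ^+ r n = qb i * p ^+ nu i / (p ^+ mu i * p ^+ nu i.+1)
      + eps i * t i * tb i.+1 / p ^+ nu i.+1.
  have /choice[f fP] : forall i, exists lg : K * (nat -> K), (0 < i < n)%N ->
      row_sys O p n r a b z i lg.1 lg.2 /\
      if (i.+1 < n)%N then
        p ^+ r i.+2 / p ^+ r i.+1 * (lg.1 * a i.+1 - lg.2 i.+1) =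
        q i.+1 * qb i * p ^+ nu i / (p ^+ mu i * p ^+ nu i.+1)
        - eps i * eps i.+1 * t i * tb i.+1 / p ^+ nu i.+1
      else lg.1 / p ^+ r n = qb i * p ^+ nu i / (p ^+ mu i * p ^+ nu i.+1)
        + eps i * t i * tb i.+1 / p ^+ nu i.+1.
    move=> i; case: (boolP (0 < i < n)%N) => [iN|_]; last by exists (0, fun=> 0).
    by have [la [g laP]] := hi i iN; exists (la, g).
  by exists f.
pose la i := if i is 0 then la0 else (lag i).1.
pose g i := if i is 0 then g0 else (lag i).2.
have rnO : p ^+ r n \in O by rewrite rpredX.
have laP i : (0 < i < n)%N -> row_sys O p n r a b z i (la i) (g i).
  by case: i => [//|i] iN; have [] := lagE i.+1 iN.
have [u [uu uO uE un]] :=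
  integral_of_rows (la := la) (g := g) p_neq0 (ltnW n_gt1) r0 rn1 hn a0 rnO laP h0.
exists u; split => //.
  rewrite uE // /la /g h0E /eps.
  suff -> : (-1) ^+ n * (-1) ^+ (n.-1 - 1) = 1 :> K by rewrite mul1r.
  rewrite -exprD; have -> : (n + (n.-1 - 1) = 2 * n.-1)%N by lia.
  by rewrite exprM sqrrN expr1n expr1n.
case=> // i iN; have i0 : (0 < i)%N by lia.
have [_ lk] := lagE i ltac:(lia).
have laE : la i = (lag i).1 by rewrite /la; case: (i) i0.
have gE : g i = (lag i).2 by rewrite /g; case: (i) i0.
case: ifP lk => iN' lk.
  rewrite uE // laE gE lk.
  (* The alternation of eps makes up for the minus sign in the formula of [param_rowi]. *)
  have -> : eps i * eps i.+1 = -1.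
    rewrite /eps; have -> : (n.-1 - i = (n.-1 - i.+1).+1)%N by lia.
    by rewrite exprS -mulrA -expr2 sqrr_sign mulr1.
  by rewrite /=; field; rewrite !expf_neq0.
have iE : i = n.-1 by lia.
have -> : inord i.+1 = ord_max :> 'I_n.+1.
  by apply: val_inj; rewrite /= inordK; lia.
rewrite /= {1}iE un -iE laE lk.
have -> : eps i = 1 by rewrite /eps iE subnn.
by field; rewrite !expf_neq0.
Qed.

End Parametrization.

(** * Families indexed by I *)

Section IndexSet.
Variable n : nat.
Hypothesis n_gt1 : (1 < n)%N.

Lemma idxP (ij : idx n) : [/\ (0 < row_of ij)%N, (row_of ij <= col_of ij)%N, (col_of ij <= n)%N &
  row_of ij = 1%N \/ col_of ij = n].
Proof.
case: ij => [[i j] /= h]; rewrite /row_of /col_of /=; case/and3P: (h) => h1 h2 h3.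
by split => //; [rewrite -ltnS | case/orP: h3 => /eqP; [left|right]].
Qed.

Lemma idx_ex i j : (0 < i <= j)%N -> (j <= n)%N -> (i == 1%N) || (j == n) ->
  exists ij : idx n, row_of ij = i /\ col_of ij = j.
Proof.
move=> ij jn h; have iE : (inord i : 'I_n.+1) = i :> nat by rewrite inordK //; lia.
have jE : (inord j : 'I_n.+1) = j :> nat by rewrite inordK //; lia.
pose P (x : 'I_n.+1 * 'I_n.+1) :=
  [&& 0 < x.1, x.1 <= x.2 & (x.1 == 1 :> nat) || (x.2 == n :> nat)]%N.
have pf : P (inord i, inord j) by rewrite /P /= iE jE h andbT.
by exists (@exist _ (fun x => is_true (P x)) _ pf : idx n); rewrite /row_of /col_of /= iE jE.
Qed.

Lemma idx_inj (ij ij' : idx n) : row_of ij = row_of ij' -> col_of ij = col_of ij' -> ij = ij'.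
Proof.
rewrite /row_of /col_of => hr hc; apply: val_inj.
case: (val ij) (val ij') hr hc => [i j] [i' j'] /= /val_inj -> /val_inj ->; done.
Qed.

Lemma entry_at (T : Type) (d : T) f (ij : idx n) : entry d f (row_of ij) (col_of ij) = f ij.
Proof.
rewrite /entry; case: pickP => [ij' /andP[/eqP hr /eqP hc]|/(_ ij)]; last by rewrite !eqxx.
by congr f; exact: idx_inj.
Qed.

Lemma entry_eq (T : Type) (d : T) f (ij : idx n) i j :
  row_of ij = i -> col_of ij = j -> entry d f i j = f ij.
Proof. by move=> <- <-; exact: entry_at. Qed.

Lemma entry_out (T : Type) (d : T) (f : idx n -> T) i j : (j < i)%N -> entry d f i j = d.
Proof.
move=> ji; rewrite /entry; case: pickP => // ij /andP[/eqP hr /eqP hc].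
by case: (idxP ij) => _; lia.
Qed.

(** The pair (1, n) lies on both arms of I and is counted with row 1, whence the second sum starts
    at 2. *)
Lemma sum_idx (f : idx n -> nat) k : (0 < k <= n)%N ->
  (\sum_(ij : idx n | row_of ij <= k <= col_of ij) f ij =
   \sum_(k <= j < n.+1) entry 0 f 1 j + \sum_(2 <= i < k.+1) entry 0 f i n)%N.
Proof.
move=> kn; rewrite (bigID (fun ij => row_of ij == 1%N)) /=; congr (_ + _)%N.
  rewrite big_geq_mkord (partition_big (fun ij : idx n => (val ij).2)
    (fun j : 'I_n.+1 => (k <= j)%N)) /= => [|ij /andP[/andP[]]//].
  apply: eq_bigr => j kj.
  have [||//|ij0 [r0 c0]] := @idx_ex 1 j; [lia | by rewrite -ltnS |].
  rewrite (entry_eq _ _ r0 c0) (big_pred1 ij0) // => ij /=.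
  apply/idP/eqP => [/andP[/andP[_ /eqP h1] /eqP h2]|->].
    by apply: idx_inj; rewrite ?h1 ?r0 // c0 /col_of h2.
  by rewrite r0 c0 kj -val_eqE /= -/(col_of ij0) c0 !eqxx !andbT; lia.
rewrite (@big_nat_widen _ _ _ 2 k.+1 n.+1) ?ltnS; last by case/andP: kn.
rewrite big_geq_mkord (partition_big (fun ij : idx n => (val ij).1)
    (fun i : 'I_n.+1 => (i < k.+1)%N && (2 <= i)%N)) /= => [|ij].
  apply: eq_bigr => i ik.
  have iN : (0 < i <= n)%N by lia.
  have [|ij0 [r0 c0]] := idx_ex iN (leqnn n); first by rewrite eqxx orbT.
  rewrite (entry_eq _ _ r0 c0) (big_pred1 ij0) // => ij /=.
  apply/idP/eqP => [/andP[/andP[_ h1] /eqP h2]|->].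
    have rE : row_of ij = i by rewrite /row_of h2.
    apply: idx_inj; rewrite ?rE ?r0 // c0.
    by case: (idxP ij) => _ _ _ [h|//]; rewrite h in h1.
  by rewrite r0 c0 -val_eqE /= -/(row_of ij0) r0 eqxx; lia.
case: (idxP ij); rewrite -[nat_of_ord _]/(row_of ij); lia.
Qed.

End IndexSet.

Lemma expz_subnat (K : fieldType) (x : K) (i j : nat) : x != 0 ->
  x ^ (i%:Z - j%:Z) = x ^+ i / x ^+ j.
Proof. by move=> x0; rewrite expfzDr // -exprnN. Qed.

Lemma expz_addsubnat (K : fieldType) (x : K) (i j k : nat) : x != 0 ->
  x ^ (- i%:Z + j%:Z + k%:Z) = x ^+ j * x ^+ k / x ^+ i.
Proof. by move=> x0; rewrite !expfzDr // -exprnN -mulrA mulrC. Qed.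

Section PadicMatrices.
Variables (p : nat) (hp : prime p) (n : nat).
Local Notation Zp := (padic_int hp).
Local Notation Qp := (padic hp).
Local Notation mat := 'M[Qp]_n.+1.
Local Notation pi := (p%:R : Qp).

Lemma w_starE : w_star hp n = signed_swap Qp n.
Proof. by apply/matrixP => i j; rewrite !mxE. Qed.

Lemma C_starE (r : n.-tuple nat) : C_star hp r = diag_mx (torus_row pi n (at1 r)).
Proof.
rewrite /C_star; congr diag_mx; apply/matrixP => i j; rewrite !mxE.
by rewrite expz_subnat ?padic_p_neq0.
Qed.

Lemma GLZp_int (A : mat) : GLZp A -> forall i j, A i j \in @pint p hp.
Proof. by move=> [B _ ->] i j; rewrite mxE tofrac_pint. Qed.

Lemma int_GLZp (A : mat) : (forall i j, A i j \in @pint p hp) -> \det A = 1 \/ \det A = -1 -> GLZp A.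
Proof.
move=> AO dA.
have h i : exists f : 'I_n.+1 -> Zp, forall j, A i j = tofrac (f j).
  have /choice[f fP] : forall j, exists y, A i j = tofrac y by move=> j; apply/pintP.
  by exists f.
have [F FE] := choice h; pose B : 'M[Zp]_n.+1 := \matrix_(i, j) F i j.
have AB : A = map_mx (@tofrac Zp) B by apply/matrixP => i j; rewrite !mxE.
exists B => //; rewrite unitmxE; move: dA; rewrite AB det_map_mx.
have inj (x y : Zp) : tofrac x = tofrac y :> Qp -> x = y by move/eqP; rewrite tofrac_eq => /eqP.
case=> e.
  suff -> : \det B = 1 by exact: unitr1.
  by apply: inj; rewrite e rmorph1.
suff -> : \det B = -1 by exact: unitrN1.
by apply: inj; rewrite e rmorphN1.
Qed.

Lemma GLZpM (A B : mat) : GLZp A -> GLZp B -> GLZp (A *m B).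
Proof.
move=> [A' uA ->] [B' uB ->]; exists (A' *m B'); first by rewrite unitmx_mul uA.
by rewrite map_mxM.
Qed.

Lemma GLZpV (A : mat) : GLZp A -> GLZp (invmx A).
Proof.
move=> [A' uA ->]; exists (invmx A'); first by rewrite unitmx_inv.
have e : map_mx (@tofrac Zp) A' *m map_mx (@tofrac Zp) (invmx A') = 1%:M.
  by rewrite -map_mxM mulmxV // map_mx1.
have uA' := (mulmx1_unit e).1.
by rewrite -[LHS]mulmx1 -e mulKmx.
Qed.

Lemma U_wP (v : mat) : U_ (w_star hp n) v <-> opp_unip v.
Proof. by rewrite w_starE. Qed.

Lemma heis_GLZp a b z : (0 < n)%N -> (forall l, (0 < l < n)%N -> a l \in @pint p hp) ->
  (forall l, (0 < l < n)%N -> b l \in @pint p hp) -> z \in @pint p hp ->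
  GLZp (heis n a b z : mat).
Proof.
move=> n0 aO bO zO; apply: int_GLZp; last first.
  by left; apply: unitriangular_det; exact: heis_unitri.
move=> i j; rewrite mxE !rpredD ?rpred_nat //.
- by case: ifP => [/andP[_]|_]; [exact: aO | rewrite rpred0].
- by case: ifP => [/andP[_]|_]; [exact: bO | rewrite rpred0].
- by case: ifP => _; rewrite ?rpred0.
Qed.

Lemma intr_unit (a : int) : ~~ (p%:Z %| a)%Z -> (a%:~R : Qp) != 0 /\ (a%:~R : Qp)^-1 \in @pint p hp.
Proof.
move=> pa; have aO : (a%:~R : Qp) \in @pint p hp by rewrite rpred_int.
have ap : (a%:~R : Qp) / pi \notin @pint p hp.
  by rewrite -[pi]expr1 intr_divX expn1.
split; first by exact: (nonunit_neq0 ap).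
by case: (padic_local aO) => // h; rewrite h in ap.
Qed.

Section Characters.
Variable R : realType.

Lemma unip_charE (psi : n.-tuple int) (u : mat) : unip_char R psi u =
  padic_char R (\sum_(1 <= k < n.+1) (at1 psi k)%:~R * u (inord k.-1) (inord k)).
Proof.
rewrite /unip_char big_add1 /= big_mkord; congr padic_char; apply: eq_bigr => j _.
rewrite (tnth_nth 0) /at1 /=; congr (_ * u _ _); apply: val_inj.
  by rewrite /= inordK // ltnS ltnW.
by rewrite /= inordK /bump ?leq0n ?add1n // ltnS.
Qed.

Lemma unip_charMl (psi : n.-tuple int) (g u : mat) : unitriangular g -> unitriangular u ->
  (forall i j, g i j \in @pint p hp) ->
  unip_char R psi (g *m u) = unip_char R psi u /\ unip_char R psi (u *m g) = unip_char R psi u.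
Proof.
move=> ug uu gO; split; apply: padic_char_int; rewrite -sumrB rpred_sum // => j _;
  rewrite -mulrBr rpredM ?rpred_int // unitriangular_superdiagM //.
  by rewrite addrK; exact: gO.
by rewrite addrAC subrr add0r; exact: gO.
Qed.

End Characters.

Lemma sum_heis_superdiag (c : nat -> Qp) a b z : (1 < n)%N ->
  \sum_(1 <= k < n.+1) c k * heis n a b z (inord k.-1) (inord k) = c 1%N * a 1%N + c n * b n.-1.
Proof.
move=> n1; rewrite big_ltn; last lia.
rewrite big_nat_recr /=; last lia.
have -> : heis n a b z (inord 0) (inord 1) = a 1%N.
  rewrite mxE -val_eqE /= !inordK ?eqxx ?n1 /=; try lia.
  by rewrite !ifN ?addr0 ?add0r //; lia.
have -> : heis n a b z (inord n.-1) (inord n) = b n.-1.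
  rewrite mxE -val_eqE /= !inordK ?eqxx; try lia.
  have -> : (n.-1 == n) = false by lia.
  have -> : (n.-1 == 0)%N = false by lia.
  have -> : (0 < n.-1 < n)%N by lia.
  by rewrite /= addr0 !add0r.
rewrite big_nat big1 ?add0r // => k kn; rewrite mxE -val_eqE /= !inordK; try lia.
have -> : (k.-1 == k) = false by lia.
have -> : (k.-1 == 0)%N = false by lia.
have -> : (k == n) = false by lia.
by rewrite /= !addr0 mulr0.
Qed.

End PadicMatrices.

(** * The Kloosterman sum *)

Section Exponents.
Variable n : nat.
Hypothesis n_gt1 : (1 < n)%N.
Variable m : {ffun idx n -> nat}.

(* be_of and al_of are the logarithms of the moduli of c_kn and c_1k, and mu_of
   (with index shifted by one) and nu_of their increments m_kn and m_1k.      *)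
Definition mu_of k : nat := if k is 0 then 0%N else entry 0%N m k.+1 n.
Definition be_of k : nat := (\sum_(2 <= i < k.+1) entry 0 m i n)%N.
Definition nu_of k : nat := entry 0%N m 1 k.
Definition al_of k : nat := (\sum_(k <= j < n.+1) entry 0 m 1 j)%N.

Lemma mu_ofE k : (0 < k)%N -> mu_of k = entry 0%N m k.+1 n.
Proof. by case: k. Qed.

Lemma be_of0 : be_of 0 = 0%N.
Proof. by rewrite /be_of big_geq. Qed.

Lemma be_ofS k : (k < n)%N -> be_of k.+1 = (be_of k + mu_of k)%N.
Proof.
by move=> kn; case: k kn => [|k] kn; rewrite /be_of /mu_of; [rewrite !big_geq | rewrite big_nat_recr].
Qed.

Lemma al_ofS k : (0 < k <= n)%N -> al_of k = (al_of k.+1 + nu_of k)%N.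
Proof. by move=> kn; rewrite /al_of big_ltn; [rewrite addnC | lia]. Qed.

Lemma al_ofn : al_of n.+1 = 0%N.
Proof. by rewrite /al_of big_geq. Qed.

Lemma M_starP (r : n.-tuple nat) : M_star r m <->
  forall k, (0 < k <= n)%N -> at1 r k = (al_of k + be_of k)%N.
Proof.
split=> h k kn; first by rewrite -(h k kn) (sum_idx n_gt1).
by rewrite (sum_idx n_gt1) // (h k kn).
Qed.

Lemma modulusE p ij : modulus p m ij =
  (p ^ (if row_of ij == 1%N then al_of (col_of ij) else be_of (row_of ij)))%N.
Proof. by rewrite /modulus; case: ifP => _; rewrite expn_sum. Qed.

End Exponents.

Section Forward.
Variables (R : realType) (p : nat) (hp : prime p) (n : nat).
Hypothesis n_gt1 : (1 < n)%N.
Local Notation Qp := (padic hp).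
Local Notation mat := 'M[Qp]_n.+1.
Local Notation pi := (p%:R : Qp).
Variables (r : n.-tuple nat) (psi psi' : n.-tuple int).
Local Notation N := (C_star hp r *m w_star hp n).
Local Notation OO := (GRing.SubringClosed.clone _ (@pint p hp) _).

Definition qnum (x : idx n -> int) k : Qp := (entry 1 x k.+1 n)%:~R.
Definition tnum (x : idx n -> int) k : Qp := (entry 1 x 1 k)%:~R.

Definition kl_param (m : {ffun idx n -> nat}) (x : idx n -> int) a b z : Prop :=
  param pi n (at1 r) (be_of m) (mu_of m) (al_of m) (qnum x) (tnum x) a b z.

Definition prime_entries (m : {ffun idx n -> nat}) (x : idx n -> int) : Prop :=
  forall ij, (0 < m ij)%N -> ~~ (p%:Z %| x ij)%Z.

Lemma at1_0 : at1 r 0 = 0%N. Proof. by []. Qed.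
Lemma at1_out : at1 r n.+1 = 0%N. Proof. by rewrite /at1 /= nth_default ?size_tuple. Qed.

Section Fixed.
Variables (m : {ffun idx n -> nat}) (x : idx n -> int).
Hypotheses (mM : M_star r m) (xm : prime_entries m x).

Lemma qnum_unit k : (0 < k < n)%N -> (0 < mu_of m k)%N ->
  qnum x k != 0 /\ (qnum x k)^-1 \in @pint p hp.
Proof.
move=> kn; have [|||ij [hr hc]] := @idx_ex n n_gt1 k.+1 n; [lia|lia|by rewrite eqxx orbT|].
rewrite /mu_of; case: k kn hr => // k kn hr.
rewrite (entry_eq _ _ hr hc) /qnum (entry_eq _ _ hr hc) => m0.
exact/intr_unit/xm.
Qed.

Lemma tnum_unit k : (0 < k <= n)%N -> (0 < nu_of m k)%N ->
  tnum x k != 0 /\ (tnum x k)^-1 \in @pint p hp.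
Proof.
move=> kn; have [|||ij [hr hc]] := @idx_ex n n_gt1 1 k; [lia|lia|by []|].
rewrite /nu_of (entry_eq _ _ hr hc) /tnum (entry_eq _ _ hr hc) => m0.
exact/intr_unit/xm.
Qed.

Lemma kl_param_adapted a b z : kl_param m x a b z ->
  adapted OO pi n (be_of m) (mu_of m) a.
Proof.
move=> prm; apply: (adapted_of_param (padic_p_neq0 hp) (rpred_nat _ _) (padic_pVO hp)
  (be_of0 m) (@be_ofS n m) (al_ofn m) (erefl _) prm) => [k _|k].
  by rewrite rpred_int.
exact: qnum_unit.
Qed.

Lemma kl_param_integral a b z : kl_param m x a b z ->
  exists u : mat, [/\ unitriangular u, GLZp (u *m N *m heis n a b z) &
    unip_char R psi u * unip_char R psi' (heis n a b z) =
    padic_char R (kl_arg hp m psi psi' x)].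
Proof.
move=> prm.
have beS := @be_ofS n m; have alS := @al_ofS n n_gt1 m.
have rE := (M_starP n_gt1 m r).1 mM.
have qO k (kn : (0 < k < n)%N) : qnum x k \in @pint p hp by rewrite rpred_int.
have tO k (kn : (0 < k <= n)%N) : tnum x k \in @pint p hp by rewrite rpred_int.
have pO : pi \in @pint p hp by rewrite rpred_nat.
have [u [uu uO u1 uk]] := @param_integral _ OO pi (padic_p_neq0 hp) pO (padic_pVO hp)
  n (at1 r) (be_of m) (mu_of m) (al_of m) (nu_of m)
  n_gt1 (be_of0 m) beS alS (al_ofn m) rE
  at1_0 at1_out (erefl _) (qnum x) (tnum x) a b z prm qO qnum_unit tO tnum_unit.
have [a1 bn] := @superdiag_of_param _ OO pi (padic_p_neq0 hp) pO (padic_pVO hp)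
  n (at1 r) (be_of m) (mu_of m) (al_of m) (nu_of m)
  n_gt1 (be_of0 m) beS alS (al_ofn m) rE
  at1_0 at1_out (erefl _) (qnum x) (tnum x) a b z prm.
have NE : N = diag_mx (torus_row pi n (at1 r)) *m signed_swap Qp n.
  by rewrite C_starE w_starE.
exists u; split => //.
  rewrite NE; apply: int_GLZp; first exact: uO.
  apply: det_bruhat => //; [exact: padic_p_neq0 | exact: ltnW | exact: at1_out |].
  by apply: heis_unitri; exact: ltnW.
rewrite !unip_charE -padic_charD; congr padic_char.
rewrite sum_heis_superdiag // a1 bn.
have pi0 := padic_p_neq0 hp.
rewrite /kl_arg big_ltn; last lia.
rewrite u1 addrA; congr (_ + _ + _ + _).
- apply: eq_big_nat => k kn; congr (_ * _); rewrite uk; last lia.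
  case: k kn => // k kn; rewrite /= expz_addsubnat // invf_div mulrA !eqz_nat.
  (* The summand j = n contains c_(n+1)n, which lies outside I and is read as the default 1. *)
  congr (_ + _); have -> : (if (k.+1 < n)%N then qnum x k.+1 else 1) = qnum x k.+1.
    case: ifP => // kn'; have -> : k.+1 = n by lia.
    by rewrite /qnum entry_out.
  case: k kn => // k kn; rewrite /mu_of /nu_of /qnum /tnum.
  by rewrite [in RHS](mulrC (_ ^+ entry 0%N m 1 k.+2)).
- have -> : mu_of m n.-1 = entry 0%N m n n by rewrite mu_ofE ?prednK //; lia.
  have -> : qnum x n.-1 = (entry 1 x n n)%:~R by rewrite /qnum prednK //; lia.
  by rewrite expz_addsubnat // invf_div mulrA !eqz_nat.
Qed.

End Fixed.
End Forward.

(** * Recovering the parameters from a, b and z *)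

Section Exhaustion.
Variables (K : fieldType) (O : subringClosed K) (p : K).
Hypotheses (p_neq0 : p != 0) (pO : p \in O) (pVO : p^-1 \notin O).
Hypothesis O_local : forall x, x \in O -> x / p \in O \/ x^-1 \in O.
Hypothesis O_order : forall x N, exists2 M, (N <= M)%N &
  p ^+ M * x \in O /\ ((N < M)%N -> p ^+ M * x / p \notin O).
Variable n : nat.

(** Greedy choice: be k.+1 is an exponent M >= be k with p^M a_k integral, and not divisible by p if
    M > be k. *)
Lemma adapted_exists (a : nat -> K) : (0 < n)%N -> a 0%N = 1 ->
  exists be mu, [/\ be 0 = 0%N, mu 0 = 0%N, forall k, be k.+1 = (be k + mu k)%N &
    adapted O p n be mu a].
Proof.
move=> n0 a0.
have /choice[f fP] : forall xN : K * nat, exists M, [/\ (xN.2 <= M)%N,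
    p ^+ M * xN.1 \in O & (xN.2 < M)%N -> p ^+ M * xN.1 / p \notin O].
  by move=> [x N]; have [M h1 [h2 h3]] := O_order x N; exists M.
pose be := nat_rect (fun=> nat) 0%N (fun k b => f (a k, b)).
have beP k := fP (a k, be k).
have beS k : be k.+1 = (be k + (be k.+1 - be k))%N by have [/= h _ _] := beP k; rewrite /=; lia.
exists be, (fun k => be k.+1 - be k)%N; split => //; last first.
  move=> k kn; have [/= h1 h2 h3] := beP k; split => // lt; apply: h3; lia.
have [/= h1 h2 h3] := beP 0%N; rewrite subn0 /=.
apply/eqP; rewrite -leqn0 leqNgt; apply/negP => f_gt0; move: (h3 f_gt0) (f_gt0).
by rewrite a0 mulr1 => /negP h lt0; apply: h; exact: exp_divp.
Qed.

Variables (r be mu al nu : nat -> nat).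
Hypotheses (n_gt1 : (1 < n)%N) (be0 : be 0 = 0%N)
  (beS : forall k, (k < n)%N -> be k.+1 = (be k + mu k)%N)
  (alS : forall k, (0 < k <= n)%N -> al k = (al k.+1 + nu k)%N) (aln : al n.+1 = 0%N)
  (rE : forall k, (0 < k <= n)%N -> r k = (al k + be k)%N) (mu0 : mu 0 = 0%N).

(** Where mu k > 0 also be k.+1 > 0, so p^(be k.+1) times an integral change is divisible by p and
    cannot affect primality to p. *)
Lemma adapted_shift a a' : adapted O p n be mu a ->
  (forall k, (k < n)%N -> a' k - a k \in O) -> adapted O p n be mu a'.
Proof.
move=> ad aa k kn; have [h1 h2] := ad k kn.
have -> : p ^+ be k.+1 * a' k = p ^+ be k.+1 * a k + p ^+ be k.+1 * (a' k - a k) by ring.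
have dO := aa k kn; split; first by rewrite rpredD // rpredM ?rpredX.
move=> m0; apply: contra (h2 m0) => h.
have -> : p ^+ be k.+1 * a k / p = (p ^+ be k.+1 * a k + p ^+ be k.+1 * (a' k - a k)) / p
   - (p ^+ be k.+1 / p) * (a' k - a k) by ring.
rewrite rpredB //; apply: rpredM dO; apply: exp_divp => //.
by rewrite beS //; lia.
Qed.

Lemma bcoord_ext a b z a' b' k : (0 < k < n)%N -> (forall l, (0 < l < n)%N -> a l = a' l) ->
  (forall l, (0 < l < n)%N -> b l = b' l) ->
  bcoord p n mu al a b z k = bcoord p n mu al a' b' z k.
Proof.
move=> kn aa bb; rewrite /bcoord /ainv /tailz aa // bb //; congr ((_ - (_ - _) * _) * _ / _).
by apply: eq_big_nat => l ln; rewrite aa ?bb //; lia.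
Qed.

Lemma param_unique q t a b z a' b' z' :
  param p n r be mu al q t a b z -> param p n r be mu al q t a' b' z' ->
  [/\ forall l, (0 < l < n)%N -> a l = a' l, forall l, (0 < l < n)%N -> b l = b' l & z = z'].
Proof.
move=> [a0 aE zE bE] [a0' aE' zE' bE'].
have aa l : (0 < l < n)%N -> a l = a' l by move=> ln; rewrite aE ?aE'.
have zz : z = z' by rewrite zE zE'.
split => //; apply: (bcoord_inj p_neq0 pO pVO be0 aln (a := a) mu0 (z := z) (b' := b')) => //.
move=> l ln; rewrite bE // (@bcoord_ext a b' z a' b') //.
by rewrite zz bE'.
Qed.

Lemma param_diff_q q t a b z q' t' a' b' z' k :
  param p n r be mu al q t a b z -> param p n r be mu al q' t' a' b' z' ->
  (0 < k < n)%N -> a k - a' k \in O -> (q k - q' k) / p ^+ be k.+1 \in O.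
Proof. by move=> [_ aE _ _] [_ aE' _ _] kn; rewrite aE // aE' // mulrBl. Qed.

Lemma param_diff_t q t a b z q' t' a' b' z' b'' z'' k :
  adapted O p n be mu a ->
  param p n r be mu al q t a b z -> param p n r be mu al q' t' a' b' z' ->
  (forall l, (0 < l < n)%N -> a l = a' l) ->
  (forall l, (0 < l < n)%N -> b' l = b l + b'' l) -> z' = z + shiftz a b'' z'' n ->
  (forall l, (0 < l < n)%N -> b'' l \in O) -> z'' \in O ->
  (0 < k <= n)%N -> (t' k - t k) / p ^+ al k \in O.
Proof.
move=> ad [_ _ zE bE] [_ _ zE' bE'] aa bb zz bO zO kn.
have [h1 h2] := lattice_int p_neq0 pO pVO O_local be0 beS aln rE ad mu0 bO zO (ltnW n_gt1).
have [kn'|kn'] := ltnP k n; last first.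
  have -> : k = n by lia.
  suff -> : t' n - t n = p ^+ r n * shiftz a b'' z'' n by [].
  have -> : shiftz a b'' z'' n = z' - z by rewrite zz; ring.
  by rewrite zE zE'; field; rewrite expf_neq0.
have kn1 : (0 < k < n)%N by lia.
have := h2 k kn1; set d := (b'' k - _) * _ / _ => dO.
have eE : swap_sign K n k * t' k = swap_sign K n k * t k + d.
  rewrite -(bE' _ kn1) -(bE _ kn1) -(bcoord_shift p_neq0 pO pVO be0 aln a mu0 b z b'' z'' kn1).
  by rewrite zz; apply: bcoord_ext => // l ln; rewrite aa.
have -> : (t' k - t k) / p ^+ al k = swap_sign K n k * (d / p ^+ al k).
  have -> : d = swap_sign K n k * (t' k - t k) by rewrite mulrBr eE; ring.
  rewrite !mulrA swap_sign2; ring.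
by rewrite rpredM // rpredX // rpredN rpred1.
Qed.

Variables (a b : nat -> K) (z : K).
Hypotheses (a0 : a 0%N = 1) (ad : adapted O p n be mu a).

Section Rows.
Hypotheses (rown : rown_sys O p n r a z)
  (rowi : forall i, (0 < i < n)%N -> exists la g, row_sys O p n r a b z i la g)
  (row0 : exists la g, row0_sys O p n r a b z la g).

(** The values of t that realize the given a, b, z in [param]; the coordinate at n is z itself,
    scaled. *)
Definition tcoord k : K :=
  if (k < n)%N then swap_sign K n k * bcoord p n mu al a b z k else p ^+ r n * z.

Let alE k : (0 < k <= n)%N -> al k = (r k - be k)%N.
Proof. by move=> kn; rewrite rE // addnK. Qed.

Lemma swap_sign_int k : swap_sign K n k \in O.
Proof. by rewrite rpredX // rpredN rpred1. Qed.

Lemma tcoord_backward k : (0 < k <= n)%N ->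
  tcoord k \in O /\ ((0 < nu k)%N -> tcoord k / p \notin O).
Proof.
move=> kn; rewrite /tcoord; case: ifP => kn'; last first.
  have -> : k = n by lia.
  split; first by case: rown.
  move=> n0; apply: (coordn_unit p_neq0 pO pVO be0 beS n_gt1 a0 rown rowi row0 ad).
  have nn : (0 < n <= n)%N by lia.
  by rewrite -(alE nn) (alS nn); lia.
have kn1 : (0 < k < n)%N by lia.
have [h1 h2] := coord_backward p_neq0 pO pVO O_local be0 beS n_gt1 a0 rown rowi row0 ad kn1.
have -> : bcoord p n mu al a b z k = (b k - tailz n a b z k.+1 * (if mu k == 0%N then 0 else (a k)^-1)) *
   p ^+ (r k - be k) / p ^+ mu k by rewrite /bcoord /ainv alE.
set y := (b k - _) * _ / _ in h1 h2 *.
split; first by rewrite rpredM // swap_sign_int.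
move=> n0; have yU : y / p \notin O.
  have knS : (0 < k.+1 <= n)%N by lia.
  by apply: h2; rewrite -(alE kn) -(alE knS) (alS kn); lia.
apply: contra yU => h.
have -> : y / p = swap_sign K n k * (swap_sign K n k * y / p).
  by rewrite -[LHS]mul1r -(swap_sign2 K n k); ring.
by rewrite rpredM // swap_sign_int.
Qed.

End Rows.

(** The discrepancy between t and [tcoord] is a lattice translation, which [lattice_solve] realizes
    by integral b' and z'. *)
Lemma param_complete (q t : nat -> K) :
  (forall k, (0 < k < n)%N -> a k = q k / p ^+ be k.+1) ->
  (forall k, (0 < k <= n)%N -> (t k - tcoord k) / p ^+ al k \in O) ->
  exists b' z', [/\ forall l, b' l \in O, z' \in O &
    param p n r be mu al q t a (fun l => b l + b' l) (z + shiftz a b' z' n)].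
Proof.
move=> aE tE.
pose tau k := if (k < n)%N then swap_sign K n k * (t k - tcoord k) else t k - tcoord k.
have tauO k : (0 < k <= n)%N -> tau k / p ^+ al k \in O.
  move=> kn; rewrite /tau; case: ifP => _; last exact: tE.
  by rewrite -mulrA rpredM ?swap_sign_int ?tE.
have [b' [z' [b'O z'O hn hk]]] := lattice_solve p_neq0 pO pVO O_local be0 beS aln rE ad mu0
  (ltnW n_gt1) tauO.
exists b', z'; split => //; split => //.
  apply: (mulfI (expf_neq0 (r n) p_neq0)).
  rewrite mulrDr hn /tau ltnn /tcoord ltnn mulrC [in RHS]mulrC divfK ?expf_neq0 //.
  by ring.
move=> k kn; rewrite (bcoord_shift p_neq0 pO pVO be0 aln _ mu0) // hk // /tau.
have -> : (k < n)%N by lia.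
have -> : tcoord k = swap_sign K n k * bcoord p n mu al a b z k.
  by rewrite /tcoord; case: ifP => //; lia.
rewrite mulrBr mulrA swap_sign2 mul1r; ring.
Qed.

End Exhaustion.

Lemma mulmx_cancel2 (K : fieldType) n (g x h : 'M[K]_n.+1) :
  g \in unitmx -> h \in unitmx -> invmx g *m (g *m x *m h) *m invmx h = x.
Proof. by move=> gu hu; rewrite -[g *m x *m h]mulmxA (mulKmx gu) (mulmxK hu). Qed.

(** * Residue classes and their integer representatives *)

Section Representatives.
Variables (p : nat) (hp : prime p) (n : nat).
Hypothesis n_gt1 : (1 < n)%N.

(** Shows that m is determined by the exponents of its moduli, through which it is recovered from a
    double coset. *)
Lemma m_exponent (m : {ffun idx n -> nat}) ij : m ij =
  (if row_of ij == 1%N then al_of m (col_of ij) - al_of m (col_of ij).+1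
   else be_of m (row_of ij) - be_of m (row_of ij).-1)%N.
Proof.
case: (idxP ij) => h1 h2 h3 h4; case: eqP => r1.
  rewrite (al_ofS n_gt1 m) ?addKn; last lia.
  by rewrite /nu_of (entry_eq _ _ r1 (erefl _)).
have c1 : col_of ij = n by case: h4.
have rS : row_of ij = (row_of ij).-1.+1 by lia.
rewrite {1}rS be_ofS ?addKn; last lia.
by rewrite mu_ofE -?rS ?(entry_eq _ _ (erefl _) c1) //; lia.
Qed.

Lemma dvd_modulus (m : {ffun idx n -> nat}) ij : (0 < m ij)%N -> (p %| modulus p m ij)%N.
Proof.
rewrite modulusE {1}m_exponent; case: ifP => _ h.
  by rewrite -(@prednK (al_of m _)) ?expnS ?dvdn_mulr //; lia.
by rewrite -(@prednK (be_of m _)) ?expnS ?dvdn_mulr //; lia.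
Qed.

Lemma C_setP (m : {ffun idx n -> nat}) (c : residues p m) :
  reflect (forall ij, (0 < m ij)%N -> ~~ (p %| c ij)%N) (c \in C_set p m).
Proof.
rewrite inE; apply: (iffP forallP) => h ij.
  by move=> m0; have := h ij; rewrite coprime_pexpr // coprime_sym prime_coprime.
have [->|m0] := posnP (m ij); first by rewrite expn0 coprimen1.
by rewrite coprime_pexpr // coprime_sym prime_coprime // h.
Qed.

Variables (rho : forall m : {ffun idx n -> nat}, rep_system p m)
  (hrho : forall m : {ffun idx n -> nat}, is_rep_system (@rho m)).

Definition xint m (c : residues p m) (ij : idx n) : int := @rho m ij (c ij).

Lemma rho_dvd m ij (o : 'I_(modulus p m ij)) : (0 < m ij)%N ->
  (p%:Z %| @rho m ij o)%Z = (p %| o)%N.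
Proof.
move=> m0; have pM : (p%:Z %| (modulus p m ij)%:Z)%Z by rewrite dvdzE /= dvd_modulus.
rewrite -[RHS]/(p%:Z %| (o : nat)%:Z)%Z; apply/dvdz_mod0P/dvdz_mod0P => h.
  by rewrite -(modz_dvdm _ pM) -hrho modz_dvdm.
by rewrite -(modz_dvdm _ pM) hrho modz_dvdm.
Qed.

Lemma xint_prime m (c : residues p m) : c \in C_set p m -> prime_entries p m (xint c).
Proof. by move=> /C_setP h ij m0; rewrite rho_dvd // h. Qed.

Lemma rho_inj m ij (o o' : 'I_(modulus p m ij)) :
  ((modulus p m ij)%:Z %| @rho m ij o - @rho m ij o')%Z -> o = o'.
Proof.
rewrite -eqz_mod_dvd !hrho eqz_mod_dvd -eqz_mod_dvd => /eqP.
by rewrite !modz_nat => -[]; rewrite !modn_small // => /val_inj.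
Qed.

Lemma rho_surj m ij (y : padic hp) : y \in @pint p hp -> exists o : 'I_(modulus p m ij),
  (y - (@rho m ij o)%:~R) / (modulus p m ij)%:R \in @pint p hp.
Proof.
move=> yO; have [k klt kE] := padic_approx 
  (if row_of ij == 1%N then al_of m (col_of ij) else be_of m (row_of ij)) yO.
rewrite -modulusE in klt; exists (Ordinal klt).
have M0 : ((modulus p m ij)%:R : padic hp) != 0.
  by rewrite modulusE natrX expf_neq0 ?padic_p_neq0.
have -> : y - (@rho m ij (Ordinal klt))%:~R = (y - k%:R) - (@rho m ij (Ordinal klt) - k%:Z)%:~R.
  by rewrite rmorphB /= -pmulrn opprB addrA subrK.
rewrite mulrBl rpredB //.
  by rewrite modulusE natrX.
rewrite [X in _ / X](_ : _ = (p%:R : padic hp) ^+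
   (if row_of ij == 1%N then al_of m (col_of ij) else be_of m (row_of ij))); last first.
  by rewrite modulusE natrX.
by rewrite intr_divX -modulusE -eqz_mod_dvd; apply/eqP; rewrite hrho.
Qed.

End Representatives.

(** * Double cosets and their summands *)

Section Cosets.
Variables (R : realType) (p : nat) (hp : prime p) (n : nat).
Hypothesis n_gt1 : (1 < n)%N.
Local Notation Qp := (padic hp).
Local Notation mat := 'M[Qp]_n.+1.
Local Notation pi := (p%:R : Qp).
Variables (r : n.-tuple nat) (psi psi' : n.-tuple int).
Local Notation t := (C_star hp r).
Local Notation w := (w_star hp n).
Local Notation N := (t *m w).
Let n_gt0 : (0 < n)%N := ltnW n_gt1.

Lemma N_E : N = diag_mx (torus_row pi n (at1 r)) *m signed_swap Qp n.
Proof. by rewrite C_starE w_starE. Qed.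

Lemma bruhat_inj (u u' v v' : mat) : unitriangular u -> unitriangular u' ->
  opp_unip v -> opp_unip v' -> u *m N *m v = u' *m N *m v' -> u = u' /\ v = v'.
Proof. rewrite N_E; apply: bruhat_unique => //; exact: padic_p_neq0. Qed.

Lemma bruhatE (u v : mat) : unitriangular u -> opp_unip v -> bruhat t w (u *m N *m v) = (u, v).
Proof.
move=> uu ov; rewrite /bruhat; set A := [set uv : mat * mat | _].
have Auv : A (u, v) by split => //; exact/U_wP.
have := @xgetPex _ (1%:M, 1%:M) A (ex_intro _ _ Auv).
case: (xget _ A) => u1 v1 [/= uu1 /U_wP ov1 e].
by have [-> ->] := bruhat_inj uu uu1 ov ov1 e.
Qed.

Lemma GLZp1 : GLZp (1%:M : mat).
Proof. by exists 1%:M; rewrite ?unitmx1 ?map_mx1. Qed.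

Lemma kl_coset_refl (x : mat) : kl_coset w x x.
Proof.
exists 1%:M, 1%:M; split; last by rewrite mul1mx mulmx1.
  by split; [exact: unitriangular1 | exact: GLZp1].
by split; [exact/U_wP/opp_unip1 | exact: GLZp1].
Qed.

Lemma kl_coset_sub (x : mat) g h : unitriangular g -> GLZp g -> opp_unip h -> GLZp h ->
  kl_coset w (g *m x *m h) `<=` kl_coset w x.
Proof.
move=> ug gO oh hO y [a [b [[ua aO] [/U_wP ob bO] ->]]].
exists (a *m g), (h *m b); split; last by rewrite !mulmxA.
  by split; [exact: unitriangularM | exact: GLZpM].
by split; [apply/U_wP; exact: opp_unipM | exact: GLZpM].
Qed.

Lemma kl_coset_eq (x : mat) g h : unitriangular g -> GLZp g -> opp_unip h -> GLZp h ->
  kl_coset w (g *m x *m h) = kl_coset w x.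
Proof.
move=> ug gO oh hO; apply/seteqP; split; first exact: kl_coset_sub.
have gu := unitriangular_unit ug; have hu := unitriangular_unit oh.1.
rewrite -{1}(mulmx_cancel2 x gu hu).
by apply: kl_coset_sub; [exact: unitriangularV | exact: GLZpV | exact: opp_unipV | exact: GLZpV].
Qed.

Definition summand (D : set mat) : R[i] :=
  let x := xget 1%:M D in unip_char R psi (bruhat t w x).1 * unip_char R psi' (bruhat t w x).2.

(** Whatever element of the coset [xget] returns, its components are g u and v h with g and h
    integral, and the characters are trivial on these. *)
Lemma summandE (u v : mat) : unitriangular u -> opp_unip v ->
  summand (kl_coset w (u *m N *m v)) = unip_char R psi u * unip_char R psi' v.
Proof.
move=> uu ov; rewrite /summand; set x := xget _ _.
have : kl_coset w (u *m N *m v) x.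
  by apply: (@xgetPex _ 1%:M); exists (u *m N *m v); exact: kl_coset_refl.
case=> g [h [[ug gO] [/U_wP oh hO] ->]].
have -> : g *m (u *m N *m v) *m h = (g *m u) *m N *m (v *m h) by rewrite !mulmxA.
rewrite bruhatE; [|exact: unitriangularM|exact: opp_unipM].
have [-> _] := unip_charMl R psi ug uu (GLZp_int gO).
by have [_ ->] := unip_charMl R psi' oh.1 ov.1 (GLZp_int hO).
Qed.

End Cosets.

Lemma heis_ext (K : fieldType) n (a b a' b' : nat -> K) z :
  (forall l, (0 < l < n)%N -> a l = a' l) -> (forall l, (0 < l < n)%N -> b l = b' l) ->
  heis n a b z = heis n a' b' z.
Proof.
move=> aa bb; apply/matrixP => i j; rewrite !mxE; congr (_ + _ + _ + _).
  by case: ifP => // /andP[_ jn]; exact: aa.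
by case: ifP => // /andP[_ jn]; exact: bb.
Qed.

(** * Double cosets attached to residues *)

Section Classification.
Variables (R : realType) (p : nat) (hp : prime p) (n : nat).
Hypothesis n_gt1 : (1 < n)%N.
Local Notation Qp := (padic hp).
Local Notation mat := 'M[Qp]_n.+1.
Local Notation pi := (p%:R : Qp).
Local Notation OO := (GRing.SubringClosed.clone _ (@pint p hp) _).
Variables (r : n.-tuple nat) (psi psi' : n.-tuple int).
Local Notation t := (C_star hp r).
Local Notation w := (w_star hp n).
Local Notation N := (t *m w).
Variables (rho : forall m : {ffun idx n -> nat}, rep_system p m)
  (hrho : forall m : {ffun idx n -> nat}, is_rep_system (@rho m)).
Let n_gt0 : (0 < n)%N := ltnW n_gt1.
Let pi0 := padic_p_neq0 hp.
Let pVO := padic_pVO hp.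
Let pO : pi \in @pint p hp := rpred_nat _ p.

(** A relation between c and g, because c determines u only up to U(Z_p) on the left. *)
Definition kl_rep m (c : residues p m) (g : mat) : Prop :=
  exists a b z u, [/\ kl_param r m (xint rho c) a b z, unitriangular u, GLZp g &
    g = u *m N *m heis n a b z].

Lemma GLZp_unit (g : mat) : GLZp g -> g \in unitmx.
Proof.
move=> [B uB ->]; have e : map_mx (@tofrac _) B *m map_mx (@tofrac _) (invmx B) = 1%:M :> mat.
  by rewrite -map_mxM mulmxV // map_mx1.
exact: (mulmx1_unit e).1.
Qed.

(** The quotient of u and u' is also the quotient of the two products, hence lies in U(Z_p). *)
Lemma kl_coset_left (u u' h : mat) : unitriangular u -> unitriangular u' ->
  GLZp (u *m N *m h) -> GLZp (u' *m N *m h) ->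
  kl_coset w (u *m N *m h) = kl_coset w (u' *m N *m h).
Proof.
move=> uu uu' gO gO'; pose d := u *m invmx u'.
have dE : u *m N *m h = d *m (u' *m N *m h) *m 1%:M.
  by rewrite mulmx1 /d !mulmxA (mulmxKV (unitriangular_unit uu')).
have dO : GLZp d.
  have -> : d = (u *m N *m h) *m invmx (u' *m N *m h).
    by rewrite dE mulmx1 (mulmxK (GLZp_unit gO')).
  by apply: GLZpM => //; exact: GLZpV.
rewrite dE; apply: kl_coset_eq => //.
- by apply: unitriangularM => //; exact: unitriangularV.
- exact: opp_unip1.
- exact: GLZp1.
Qed.

Lemma kl_rep_coset m (c : residues p m) g g' : kl_rep c g -> kl_rep c g' ->
  kl_coset w g = kl_coset w g'.
Proof.
move=> [a [b [z [u [prm uu gO gE]]]]] [a' [b' [z' [u' [prm' uu' gO' gE']]]]].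
have [aa bb zz] := param_unique pi0 pO pVO n_gt1 (be_of0 m) (al_ofn m) (erefl _) prm prm'.
have hh : heis n a b z = heis n a' b' z' by rewrite zz; exact: heis_ext.
rewrite gE gE' -hh; apply: kl_coset_left => //; first by rewrite -gE.
by rewrite hh -gE'.
Qed.

Lemma kl_rep_exists m (c : residues p m) : M_star r m -> c \in C_set p m ->
  exists2 g, kl_rep c g & summand R r psi psi' (kl_coset w g) =
    padic_char R (kl_arg hp m psi psi' (xint rho c)).
Proof.
move=> mM cC.
have [a [b [z prm]]] := @param_exists _ OO pi pi0 pO pVO n (at1 r) (be_of m) (mu_of m) (al_of m)
  (be_of0 m) (al_ofn m) (erefl _) (qnum hp (xint rho c)) (tnum hp (xint rho c)).
have [u [uu gO e]] := kl_param_integral R n_gt1 psi psi' mM (xint_prime hp n_gt1 hrho cC) prm.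
exists (u *m N *m heis n a b z); first by exists a, b, z, u.
by rewrite summandE //; exact: heis_opp_unip.
Qed.

Lemma kl_rep_summand m (c : residues p m) g : M_star r m -> c \in C_set p m -> kl_rep c g ->
  summand R r psi psi' (kl_coset w g) = padic_char R (kl_arg hp m psi psi' (xint rho c)).
Proof.
move=> mM cC gR; have [g' gR' <-] := kl_rep_exists mM cC.
by rewrite (kl_rep_coset gR gR').
Qed.

Lemma kl_rep_kl_set m (c : residues p m) g : kl_rep c g -> kl_set t w g.
Proof.
move=> [a [b [z [u [_ uu gO gE]]]]]; split => //; exists u, (heis n a b z); split => //.
exact: heis_unitri.
Qed.

(** The sizes of the a_j give be, then r = al + be gives al, and so m. Next a modulo Z_p gives the
    classes c_in. Only then can the coordinates c_1j be compared, since they are defined relative to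
    a common a. *)
Lemma kl_rep_inj m m' (c : residues p m) (c' : residues p m') g g' :
  M_star r m -> M_star r m' -> c \in C_set p m -> c' \in C_set p m' ->
  kl_rep c g -> kl_rep c' g' -> kl_coset w g = kl_coset w g' ->
  existT (fun m => residues p m) m c = existT (fun m => residues p m) m' c'.
Proof.
move=> mM mM' cC cC' [a [b [z [u [prm uu gO gE]]]]] [a' [b' [z' [u' [prm' uu' gO' gE']]]]] e.
have : kl_coset w g g' by rewrite e; exact: kl_coset_refl.
case=> al [be [[ual alO] [/U_wP obe beO] g'E]].
have [uE hE] : u' = al *m u /\ heis n a' b' z' = heis n a b z *m be.
  apply: (bruhat_inj n_gt1 (r := r)) => //.
  - exact: unitriangularM.
  - exact: heis_opp_unip.
  - by apply: opp_unipM => //; exact: heis_opp_unip.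
  by rewrite -gE' g'E gE !mulmxA.
have beI := GLZp_int beO.
move: hE; rewrite (opp_unip_heis n_gt0 obe) heisM //.
set a'' := fun j => be ord0 (inord j); set b'' := fun i => be (inord i) ord_max.
set z'' := be ord0 ord_max => /(heis_inj n_gt0)[aa bb zz].
have ad := kl_param_adapted n_gt1 (xint_prime hp n_gt1 hrho cC) prm.
have ad' := kl_param_adapted n_gt1 (xint_prime hp n_gt1 hrho cC') prm'.
have a0 : a 0%N = 1 by case: prm.
have a0' : a' 0%N = 1 by case: prm'.
have da l : (l < n)%N -> a' l - a l \in @pint p hp.
  move=> ln; have [->|l0] := posnP l; first by rewrite a0 a0' subrr rpred0.
  by rewrite aa ?l0 // addrAC subrr add0r; exact: beI.
have da' l : (l < n)%N -> a l - a' l \in @pint p hp.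
  by move=> ln; rewrite -opprB rpredN da.
have beE k : (k <= n)%N -> be_of m k = be_of m' k.
  move=> kn; have [->|k0] := posnP k; first by rewrite !be_of0.
  have kn' : (0 < k <= n)%N by rewrite k0.
  apply/eqP; rewrite eqn_leq; apply/andP; split.
    exact: (adapted_be_le pi0 pO pVO (be_of0 m) (@be_ofS n m) (be_of0 m') (@be_ofS n m') a0 ad ad' da kn').
  exact: (adapted_be_le pi0 pO pVO (be_of0 m') (@be_ofS n m') (be_of0 m) (@be_ofS n m) a0' ad' ad da' kn').
have alE k : (0 < k)%N -> (k <= n.+1)%N -> al_of m k = al_of m' k.
  move=> k0; rewrite leq_eqVlt => /orP[/eqP ->|kn]; first by rewrite !al_ofn.
  have kn' : (0 < k <= n)%N by rewrite k0.
  have h := (M_starP n_gt1 m r).1 mM k kn'; have h' := (M_starP n_gt1 m' r).1 mM' k kn'.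
  have := beE k kn; lia.
have mE : m = m'.
  apply/ffunP => ij; rewrite !(m_exponent hp n_gt1); case: (idxP ij) => h1 h2 h3 _.
  by rewrite !alE ?beE //; lia.
subst m'; congr existT.
have rE := (M_starP n_gt1 m r).1 mM.
have c_n ij : row_of ij != 1%N -> c ij = c' ij.
  move=> r1; case: (idxP ij) => h1 h2 h3 h4; have c1 : col_of ij = n by case: h4 r1 => // ->.
  have kn : (0 < (row_of ij).-1 < n)%N by move: r1; lia.
  have rS : (row_of ij).-1.+1 = row_of ij by lia.
  apply: (rho_inj hrho); rewrite modulusE (negPf r1) -(intr_divX hp).
  have := param_diff_q prm prm' kn (da' _ _).
  rewrite rS /qnum rS !(entry_eq _ _ (erefl _) c1) rmorphB /=; apply.
  exact: leq_trans h2 h3.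
(* Equal classes have the same representative, so that a and a' are now equal and not merely
   congruent. *)
have aa' l : (0 < l < n)%N -> a l = a' l.
  move=> ln; case: prm prm' => _ aE _ _ [_ aE' _ _]; rewrite aE // aE' // /qnum.
  have [|||ij [hr hc]] := @idx_ex n n_gt1 l.+1 n; [lia|lia|by rewrite eqxx orbT|].
  by rewrite !(entry_eq _ _ hr hc) /xint c_n // hr; lia.
apply/ffunP => ij; have [r1|/c_n//] := eqVneq (row_of ij) 1%N.
case: (idxP ij) => h1 h2 h3 h4.
have kn : (0 < col_of ij <= n)%N by lia.
symmetry; apply: (rho_inj hrho); rewrite modulusE r1 eqxx -(intr_divX hp).
have := param_diff_t pi0 pO pVO (@padic_local p hp) n_gt1 (be_of0 m) (@be_ofS n m) (al_ofn m) rE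
  (erefl _) ad prm prm' aa' bb zz (fun l _ => beI _ _) (beI _ _) kn.
by rewrite /tnum !(entry_eq _ _ r1 (erefl _)) rmorphB.
Qed.

End Classification.

Lemma div_mul_cancel (K : fieldType) (x d q : K) : d != 0 -> q != 0 -> x / (d * q) * d = x / q.
Proof. by move=> d0 q0; field; rewrite d0 q0. Qed.

(** * Every double coset comes from residues *)

Section Surjectivity.
Variables (p : nat) (hp : prime p) (n : nat).
Hypothesis n_gt1 : (1 < n)%N.
Local Notation Qp := (padic hp).
Local Notation mat := 'M[Qp]_n.+1.
Local Notation pi := (p%:R : Qp).
Local Notation OO := (GRing.SubringClosed.clone _ (@pint p hp) _).
Variable r : n.-tuple nat.
Local Notation t := (C_star hp r).
Local Notation w := (w_star hp n).
Local Notation N := (t *m w).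
Variables (rho : forall m : {ffun idx n -> nat}, rep_system p m)
  (hrho : forall m : {ffun idx n -> nat}, is_rep_system (@rho m)).
Let n_gt0 : (0 < n)%N := ltnW n_gt1.
Let pi0 := padic_p_neq0 hp.
Let pVO := padic_pVO hp.
Let pO : pi \in @pint p hp := rpred_nat _ p.

Lemma exponents_of_rows (a b : nat -> Qp) (z : Qp) : a 0%N = 1 ->
  rown_sys OO pi n (at1 r) a z ->
  (forall i, (0 < i < n)%N -> exists la g, row_sys OO pi n (at1 r) a b z i la g) ->
  (exists la g, row0_sys OO pi n (at1 r) a b z la g) ->
  exists m, M_star r m /\ adapted OO pi n (be_of m) (mu_of m) a.
Proof.
move=> a0 rown rowi row0.
have [be [mu [be0 mu0 beS' ad]]] :=
  adapted_exists (O := OO) pi0 pO pVO (@padic_order p hp) n_gt0 a0.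
have beS k : (k < n)%N -> be k.+1 = (be k + mu k)%N by move=> _; exact: beS'.
have ler k := be_le_r pi0 pO pVO be0 beS n_gt1 a0 rown rowi ad (k := k).
have alM k := al_mono pi0 pO pVO (@padic_local p hp) be0 beS n_gt1 a0 rown rowi row0 ad (k := k).
(* The truncated subtractions here and in m are genuine, by [ler] and [alM]; the value 0 beyond n
   agrees with [al_ofn]. *)
pose al k := if (k <= n)%N then (at1 r k - be k)%N else 0%N.
pose m : {ffun idx n -> nat} := [ffun ij => if row_of ij == 1%N
   then al (col_of ij) - al (col_of ij).+1 else mu (row_of ij).-1]%N.
have nuE k : (0 < k <= n)%N -> nu_of m k = (al k - al k.+1)%N.
  move=> kn; have [|||ij [hr hc]] := @idx_ex n n_gt1 1 k; [lia|lia|by []|].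
  by rewrite /nu_of (entry_eq _ _ hr hc) ffunE hr hc.
have muE k : (k < n)%N -> mu_of m k = mu k.
  case: k => [|k] kn; first by rewrite mu0.
  have [|||ij [hr hc]] := @idx_ex n n_gt1 k.+2 n; [lia|lia|by rewrite eqxx orbT|].
  by rewrite /mu_of (entry_eq _ _ hr hc) ffunE hr.
have beE k : (k <= n)%N -> be_of m k = be k.
  elim: k => [|k IH] kn; first by rewrite be_of0 be0.
  by rewrite be_ofS // IH ?(ltnW kn) // muE // beS.
have alE k : (0 < k)%N -> (k <= n.+1)%N -> al_of m k = al k.
  move=> k0; move: {2}(n.+1 - k)%N (erefl (n.+1 - k)%N) => d.
  elim: d k k0 => [|d IH] k k0 dE kn.
    by have -> : k = n.+1 by [lia]; rewrite al_ofn /al ltnn.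
  have kn' : (0 < k <= n)%N by lia.
  rewrite (al_ofS n_gt1 m kn') IH //; try lia.
  rewrite nuE // subnKC // /al; have -> : (k <= n)%N by lia.
  by case: ifP => // kn2; apply: alM; lia.
exists m; split.
  apply/(M_starP n_gt1) => k kn; rewrite alE ?beE //; try lia.
  have := ler k kn; rewrite /al; have -> : (k <= n)%N by lia.
  by lia.
move=> k kn; rewrite beE // muE //; exact: ad.
Qed.

(** As p divides the modulus, y and the representative of its class are divisible by p
    simultaneously. *)
Lemma rho_unit m ij (y : Qp) (o : 'I_(modulus p m ij)) : (0 < m ij)%N ->
  y / pi \notin @pint p hp ->
  (y - (@rho m ij o)%:~R) / (modulus p m ij)%:R \in @pint p hp -> ~~ (p %| o)%N.
Proof.
move=> m0 yU yo; apply: contra yU; rewrite -(rho_dvd hp n_gt1 hrho) // => ho.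
have hO : ((@rho m ij o)%:~R : Qp) / pi \in @pint p hp.
  by rewrite -[pi]expr1 (intr_divX hp) expn1.
rewrite -(subrK (@rho m ij o)%:~R y) mulrDl rpredD //.
have M0 : ((modulus p m ij)%:R : Qp) != 0 by rewrite modulusE natrX expf_neq0.
have /dvdnP[d dE] := dvd_modulus hp n_gt1 m0.
move: yo M0; rewrite dE natrM => yo; rewrite mulf_eq0 negb_or => /andP[d0 _].
set y' := y - _ in yo *.
rewrite -(div_mul_cancel y' d0 pi0).
by rewrite rpredM // rpred_nat.
Qed.

Lemma rho_choice m (y : idx n -> Qp) : (forall ij, y ij \in @pint p hp) ->
  exists o : forall ij, 'I_(modulus p m ij), forall ij,
    (y ij - (@rho m ij (o ij))%:~R) / (modulus p m ij)%:R \in @pint p hp.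
Proof.
move=> yO; have h ij := cid (rho_surj hrho m ij (yO ij)).
by exists (fun ij => projT1 (h ij)) => ij; exact: projT2 (h ij).
Qed.

(** The matrix is moved inside its double coset in two steps: [d1] makes the p^(be k.+1) a_k equal
    to chosen representatives, then [d2] does the same for the coordinates of (b, z). The order
    matters, as these coordinates depend on a. *)
Lemma kl_rep_surj (x : mat) : kl_set t w x -> exists m (c : residues p m) g,
  [/\ M_star r m, c \in C_set p m, kl_rep r rho c g & kl_coset w x = kl_coset w g].
Proof.
case=> -[u0 [v0 [uu0 uv0 xE]]] xO.
have [u [h [uu oh xE']]] : exists u' h, [/\ unitriangular u', opp_unip h &
    u0 *m N *m v0 = u' *m N *m h].
  rewrite N_E; exact: bruhat_refine.
rewrite {}xE' in xE; have hE := opp_unip_heis n_gt0 oh.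
set a := fun j => h ord0 (inord j) in hE; set b := fun i => h (inord i) ord_max in hE.
set z := h ord0 ord_max in hE.
have a0 : a 0%N = 1.
  have i0 : inord 0 = ord0 :> 'I_n.+1 by apply: val_inj; rewrite /= inordK.
  by rewrite /a i0 oh.1 // eqxx.
have rows (g : mat) a1 b1 z1 : a1 0%N = 1 -> GLZp g -> g = u *m N *m heis n a1 b1 z1 ->
    [/\ rown_sys OO pi n (at1 r) a1 z1,
      forall i, (0 < i < n)%N -> exists la g, row_sys OO pi n (at1 r) a1 b1 z1 i la g &
      exists la g, row0_sys OO pi n (at1 r) a1 b1 z1 la g].
  move=> a10 gO gE; have gI := GLZp_int gO.
  apply: (@rows_of_integral _ OO pi n (at1 r) pi0 n_gt0 (at1_0 r) (at1_out r) u a1 b1 z1 uu a10).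
  by move=> i j; have := gI i j; rewrite gE N_E.
have xh : x = u *m N *m heis n a b z by rewrite xE {1}hE.
have [rown rowi row0] := rows x a b z a0 xO xh.
have [m [mM ad]] := exponents_of_rows a0 rown rowi row0.
have rE := (M_starP n_gt1 m r).1 mM.
have [oa oaP] : exists o : forall ij, 'I_(modulus p m ij), forall ij, row_of ij != 1%N ->
    (pi ^+ be_of m (row_of ij) * a (row_of ij).-1 - (@rho m ij (o ij))%:~R)
      / (modulus p m ij)%:R \in @pint p hp.
  have [|o oP] := @rho_choice m (fun ij => if row_of ij == 1%N then 0 else
     pi ^+ be_of m (row_of ij) * a (row_of ij).-1).
    move=> ij; case: eqP => [_|r1]; first exact: rpred0.
    case: (idxP ij) => h1 h2 h3 h4.
    have kn : ((row_of ij).-1 < n)%N by lia.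
    by have [] := ad _ kn; rewrite prednK.
  by exists o => ij r1; have := oP ij; rewrite (negPf r1).
pose q k : Qp := (entry 1 (fun ij => @rho m ij (oa ij)) k.+1 n)%:~R.
pose a1 k : Qp := if k is 0 then 1 else q k / pi ^+ be_of m k.+1.
have qE k : (0 < k < n)%N -> exists ij, [/\ row_of ij = k.+1, col_of ij = n & 
    q k = (@rho m ij (oa ij))%:~R].
  move=> kn; have [|||ij [hr hc]] := @idx_ex n n_gt1 k.+1 n; [lia|lia|by rewrite eqxx orbT|].
  by exists ij; split => //; rewrite /q (entry_eq _ _ hr hc).
have a1O k : (k < n)%N -> a1 k - a k \in @pint p hp.
  case: k => [|k] kn; first by rewrite a0 subrr rpred0.
  have [ij [hr hc qij]] := qE k.+1 ltac:(lia).
  have r1 : row_of ij != 1%N by rewrite hr.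
  have := oaP ij r1; rewrite modulusE (negPf r1) hr -qij natrX.
  rewrite mulrBl [pi ^+ _ * _]mulrC mulfK ?expf_neq0 // => hO.
  by rewrite -opprB rpredN.
have ad1 : adapted OO pi n (be_of m) (mu_of m) a1.
  exact: (adapted_shift pi0 pO pVO n_gt1 (be_of0 m) (@be_ofS n m) (al_ofn m) (erefl _) ad a1O).
pose d1 : mat := heis n (fun l => a1 l - a l) (fun=> 0) 0.
have d1O : GLZp d1.
  by apply: heis_GLZp => // [l ln|l _|]; [apply: a1O; case/andP: ln | exact: rpred0 | exact: rpred0].
have x1E : x *m d1 = u *m N *m heis n a1 b z.
  rewrite xh /d1 -[_ *m heis n a b z *m _]mulmxA heisM // big1 => [|l _]; last by rewrite mulr0.
  rewrite !addr0; congr (_ *m _); apply: heis_ext => l ln.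
    by rewrite addrC subrK.
  by rewrite addr0.
have x1O : GLZp (x *m d1) by exact: GLZpM.
have a10 : a1 0%N = 1 by [].
(* The row equations are derived afresh for the modified a, with respect to which the coordinates
   are now taken. *)
have [rown1 rowi1 row01] := rows _ a1 b z a10 x1O x1E.
have tc k := tcoord_backward pi0 pO pVO (@padic_local p hp) n_gt1 (be_of0 m) (@be_ofS n m)
  (@al_ofS n n_gt1 m) (al_ofn m) rE (erefl _) a10 ad1 rown1 rowi1 row01 (k := k).
set tcd := tcoord pi n _ _ _ a1 b z in tc.
have [ot otP] : exists o : forall ij, 'I_(modulus p m ij), forall ij, row_of ij == 1%N ->
    (tcd (col_of ij) - (@rho m ij (o ij))%:~R) / (modulus p m ij)%:R \in @pint p hp.
  have [|o oP] := @rho_choice m (fun ij => if row_of ij == 1%N then tcd (col_of ij) else 0).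
    move=> ij; case: eqP => [r1|_]; last exact: rpred0.
    by case: (idxP ij) => h1 h2 h3 h4; apply: (tc _ _).1; lia.
  by exists o => ij r1; have := oP ij; rewrite r1.
pose c : residues p m := [ffun ij => if row_of ij == 1%N then ot ij else oa ij].
have cE ij : c ij = if row_of ij == 1%N then ot ij else oa ij by rewrite ffunE.
have cC : c \in C_set p m.
  apply/(C_setP hp) => ij m0; rewrite cE; case: (idxP ij) => h1 h2 h3 h4.
  case: ifP => r1.
    apply: (rho_unit m0 _ (otP ij r1)); apply: (tc _ _).2; first by lia.
    by rewrite /nu_of (entry_eq _ _ (eqP r1) (erefl _)).
  have r1' : row_of ij != 1%N by rewrite r1.
  have c1 : col_of ij = n by case: h4 r1' => // ->.
  apply: (rho_unit m0 _ (oaP ij r1')).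
  have kn : ((row_of ij).-1 < n)%N by lia.
  have [_] := ad _ kn; rewrite prednK //; apply.
  by rewrite mu_ofE ?prednK ?(entry_eq _ _ (erefl _) c1) //; lia.
have [||b' [z' [b'O z'O prm]]] := param_complete pi0 pO pVO (@padic_local p hp) n_gt1 (be_of0 m)
  (@be_ofS n m) (al_ofn m) rE (erefl _) a10 ad1 (b := b) (z := z)
  (q := qnum hp (xint rho c)) (t := tnum hp (xint rho c)).
- move=> k kn; have [ij [hr hc qij]] := qE k kn.
  have -> : a1 k = q k / pi ^+ be_of m k.+1 by case: (k) kn.
  rewrite qij /qnum (entry_eq _ _ hr hc) /xint cE ifN // hr.
  by lia.
- move=> k kn; have [|||ij [hr hc]] := @idx_ex n n_gt1 1 k; [lia|lia|by []|].
  have r1 : row_of ij == 1%N by rewrite hr.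
  have := otP ij r1; rewrite modulusE r1 hc natrX -rpredN -mulNr opprB.
  by rewrite /tnum (entry_eq _ _ hr hc) /xint cE r1.
pose d2 : mat := heis n (fun=> 0) b' z'.
have d2O : GLZp d2 by apply: heis_GLZp => // [l _|l _]; [exact: rpred0 | exact: b'O].
exists m, c, (x *m d1 *m d2); split => //.
- exists a1, (fun l => b l + b' l), (z + shiftz a1 b' z' n), u; split => //.
    exact: GLZpM.
  rewrite x1E /d2 -[_ *m heis n a1 b z *m _]mulmxA heisM //; congr (_ *m _); apply: heis_ext => l ln //.
  by rewrite addr0.
- have -> : x *m d1 *m d2 = 1%:M *m x *m (d1 *m d2) by rewrite mul1mx mulmxA.
  symmetry; apply: kl_coset_eq => //.
  + exact: unitriangular1.
  + exact: GLZp1.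
  + by apply: opp_unipM => //; exact: heis_opp_unip.
  + exact: GLZpM.
Qed.

End Surjectivity.

(** The entry at (i, j) occurs in the condition for k = i, hence is at most r_i. *)
Lemma M_star_finite n (r : n.-tuple nat) : (1 < n)%N -> finite_set (M_star r).
Proof.
move=> n1; pose B := (\sum_(k < n.+1) at1 r k)%N.
pose f (g : {ffun idx n -> 'I_B.+1}) : {ffun idx n -> nat} := [ffun ij => g ij : nat].
apply: (@sub_finite_set _ _ (f @` [set: {ffun idx n -> 'I_B.+1}])); last first.
  by apply: finite_image; exact: finite_finset.
move=> m mM; have mB ij : (m ij < B.+1)%N.
  case: (idxP ij) => h1 h2 h3 _; rewrite ltnS.
  have kn : (row_of ij < n.+1)%N by rewrite ltnS (leq_trans h2 h3).
  apply: (@leq_trans (at1 r (row_of ij))); last first.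
    by rewrite /B (bigD1 (Ordinal kn)) //= leq_addr.
  rewrite -mM ?h1 -1?ltnS // (bigD1 ij) ?leqnn //=; exact: leq_addr.
exists [ffun ij => Ordinal (mB ij)] => //.
by apply/ffunP => ij; rewrite !ffunE.
Qed.

Theorem theorem2 (R : realType) (p : nat) (hp : prime p)
    (n : nat) (hn : (2 <= n)%N)
    (r : n.-tuple nat) (psi psi' : n.-tuple int)
    (rho : forall m : {ffun idx n -> nat}, rep_system p m)
    (hrho : forall m : {ffun idx n -> nat}, is_rep_system (rho m)) :
  kl_well_defined R (C_star hp r) (w_star hp n) psi psi' ->
  kloosterman R (C_star hp r) (w_star hp n) psi psi' =
  \sum_(m \in M_star r) kl_partial R hp (rho m) psi psi'.
Proof.
move=> _; pose w := w_star hp n.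
pose rep m (c : residues p m) : 'M[padic hp]_n.+1 := xget 1%:M [set g | kl_rep r rho c g].
have repP m (c : residues p m) : M_star r m -> c \in C_set p m -> kl_rep r rho c (rep m c).
  move=> mM cC; have [g gR _] := kl_rep_exists R hp hn psi psi' hrho mM cC.
  by apply: (@xgetPex _ 1%:M [set g | kl_rep r rho c g]); exists g.
have [s0 s0E] := (finite_seqP _).1 (M_star_finite r hn).
pose s := undup s0; have sE : M_star r = [set` s].
  by rewrite s0E; apply/seteqP; split => m /=; rewrite mem_undup.
have sP m : m \in s -> M_star r m by rewrite sE.
(* Listing X(N) without repetition by the pairs (m, c) turns the sum over double cosets into the
   double sum. *)
pose D := [seq kl_coset w (rep m c) | m <- s, c <- enum (C_set p m)].
have DE : kl_quotient (C_star hp r) w = [set` D].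
  apply/seteqP; split => [_ [x xK <-]|X /= /allpairsPdep[m [c [mM cC ->]]]].
    have [m [c [g [mM cC gR ->]]]] := kl_rep_surj hn hrho xK.
    rewrite /= (kl_rep_coset hn gR (repP m c mM cC)); apply/allpairsPdep.
    by exists m, c; rewrite mem_enum; split => //; move: mM; rewrite sE.
  rewrite mem_enum in cC.
  by exists (rep m c) => //; exact: (kl_rep_kl_set hn (repP m c (sP m mM) cC)).
have Duniq : uniq D.
  apply: allpairs_uniq_dep => [||_ _ /allpairsPdep[m [c [/sP mM cC ->]]]
      /allpairsPdep[m' [c' [/sP mM' cC' ->]]] /= e].
  - exact: undup_uniq.
  - by move=> m _; exact: enum_uniq.
  rewrite !mem_enum in cC cC'.
  exact: (kl_rep_inj hn hrho mM mM' cC cC' (repP _ _ mM cC) (repP _ _ mM' cC') e).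
rewrite /kloosterman DE sE -!fsbig_seq ?undup_uniq // big_allpairs_dep.
apply: eq_big_seq => m /sP mM.
rewrite big_enum; apply: eq_bigr => c cC.
exact: (kl_rep_summand R hn psi psi' hrho mM cC (repP m c mM cC)).
Qed.
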